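(* Let $G=N\rtimes G_0$ be a finite group, where $N$ is an abelian normal subgroup, $G_0$ is a subgroup with $N\cap G_0=\{1\}$ and $G=NG_0$, and all Sylow subgroups of $G_0$ are cyclic. Let $e=\operatorname{lcm}\{\exp(N),\exp(G_0)\}$. If $k$ is an infinite field containing a primitive $e$-th root of unity $\zeta_e$, then $k(G)$ is retract $k$-rational.
   Context: $\exp(H)$ is the least common multiple of the orders of elements of $H$. For a field $k$ and finite group $G$, let $G$ act on $k(x_g:g\in G)$ by $h\cdot x_g=x_{hg}$, and $k(G)=k(x_g:g\in G)^G$. For an infinite field $k$ and a field $L\supseteq k$: $L$ is retract $k$-rational if there exist an affine domain $A$ over $k$ with quotient field $L$, a polynomial ring $k[X_1,\dots,X_n]$, a nonzero $f\in k[X_1,\dots,X_n]$, and $k$-algebra morphisms $\varphi:A\to k[X_1,\dots,X_n][1/f]$, $\psi:k[X_1,\dots,X_n][1/f]\to A$ with $\psi\circ\varphi=1_A$. *)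

(* Defs.v *)
From HB Require Import structures.
From mathcomp Require Import all_boot all_algebra all_fingroup all_solvable.
From mathcomp Require Import generic_quotient fraction.
From mathcomp Require Import mpoly.

Set Implicit Arguments.
Unset Strict Implicit.
Unset Printing Implicit Defensive.

Import GRing.Theory.
Local Open Scope ring_scope.

Notation "x %:F" := (@FracField.tofrac _ x) : ring_scope.

(* The rational function field k(x_g : g in gT): variables are indexed by
   'I_#|gT|, the variable x_g being 'X_(enum_rank g). *)
Definition ratfun (k : fieldType) (gT : finGroupType) : fieldType :=
  {fraction {mpoly k[#|gT|]}}.

Definition perm_mpoly (k : fieldType) (gT : finGroupType) (h : gT)
  (p : {mpoly k[#|gT|]}) : {mpoly k[#|gT|]} :=
  mmap (@mpolyC _ k) (fun i => 'X_(enum_rank (h * enum_val i)%g)) p.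

(* Its extension to the fraction field: p/q |-> h(p)/h(q), computed on the
   canonical representative (independent of the chosen representative). *)
Definition act_ratfun (k : fieldType) (gT : finGroupType) (h : gT)
  (z : ratfun k gT) : ratfun k gT :=
  let r := repr z in
  (perm_mpoly h (frac r).1)%:F / (perm_mpoly h (frac r).2)%:F.

Definition noether_field (k : fieldType) (gT : finGroupType)
  (z : ratfun k gT) : Prop :=
  forall h : gT, act_ratfun h z = z.

Definition ratfun_const (k : fieldType) (gT : finGroupType) (c : k)
  : ratfun k gT := (c%:MP : {mpoly k[#|gT|]})%:F.

(* Retract k-rationality of a subfield L (given as a predicate) of a field F
   equipped with a structure map iota : k -> F.
   - A is the k-subalgebra of F generated by the finite family s (an affine
     k-domain, being contained in a field), with A ⊆ L and every element of L
     a quotient of elements of A (so L is the quotient field of A);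
   - k[X_1..X_m][1/f] is realised inside the fraction field of k[X_1..X_m]
     as the elements p / f^j;
   - phi : A -> k[X][1/f] and psi : k[X][1/f] -> A are k-algebra morphisms
     with psi \o phi = 1_A. *)
Definition retract_rational (k : fieldType) (F : fieldType) (iota : k -> F)
  (L : F -> Prop) : Prop :=
  exists (s : seq F) (m : nat) (f : {mpoly k[m]})
         (phi : F -> {fraction {mpoly k[m]}})
         (psi : {fraction {mpoly k[m]}} -> F),
    let A := fun a : F =>
      exists P : {mpoly k[size s]}, a = mmap iota (fun i => s`_i) P in
    let Loc := fun z : {fraction {mpoly k[m]}} =>
      exists (p : {mpoly k[m]}) (j : nat), z = p%:F / (f%:F) ^+ j in
    [/\ f != 0,
        (forall a, A a -> L a),
        (forall z, L z -> exists a b, [/\ A a, A b, b != 0 & z = a / b]) &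
        (
        [/\ forall a, A a -> Loc (phi a),
            forall a b, A a -> A b -> phi (a + b) = phi a + phi b,
            forall a b, A a -> A b -> phi (a * b) = phi a * phi b &
            forall c : k, phi (iota c) = (c%:MP)%:F] /\
        [/\ forall z, Loc z -> A (psi z),
            forall y z, Loc y -> Loc z -> psi (y + z) = psi y + psi z,
            forall y z, Loc y -> Loc z -> psi (y * z) = psi y * psi z &
            forall c : k, psi ((c%:MP)%:F) = iota c] /\
        (forall a, A a -> psi (phi a) = a))].

(* Main.v *)
(* Call a field with a faithful G-action and k-rational invariant field dense if
   every field with a faithful G-action receives an equivariant place from it,
   regular at any prescribed finite set. If G0 has a dense field Phi, so has
   G = N ><| G0: take the fraction field of the subring of Phi[x_g : g in G]
   spanned by the monomials whose exponents restrict to a homomorphism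
   N -> Z/e (and are divisible by e off N), on which N acts through powers of
   zeta and G0 by conjugating the indices. The lattice of these exponents is
   coflabby for the cyclic subgroups of G0, hence a direct summand of a permutation
   lattice since the Sylow subgroups of G0 are cyclic (Endo-Miyata); so a place of
   Phi extends by choosing values on a permutation basis, which exist generically.
   By Burnside transfer and Schur-Zassenhaus, G0 itself is reached from 1 by
   extensions of this kind. Finally, if Phi is dense for G with Phi^G = k(X), let
   v_g = sum_j g(y_j) c_j with det (g(y_j)) != 0: then phi is p(x) |-> p(v), from
   k(G) to k(X)(c), and psi is the place into k(x_g), together with the values of
   the c_j that send v_g to x_g. *)
Require Import Defs.
From HB Require Import structures.
From mathcomp Require Import all_boot all_algebra all_fingroup all_solvable.
From mathcomp Require Import generic_quotient fraction.
From mathcomp Require Import mpoly.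
From mathcomp Require Import zify ring.
From Stdlib Require Import Classical ClassicalEpsilon.

Set Implicit Arguments.
Unset Strict Implicit.
Unset Printing Implicit Defensive.

Import GRing.Theory Num.Theory.
Local Open Scope ring_scope.

Lemma int_kernel_basis m n (X : 'M[int]_(m, n)) :
  exists r (E : 'M[int]_(r, m)) (E' : 'M[int]_(m, r)),
    [/\ E *m E' = 1%:M, E *m X = 0 &
        forall t (v : 'M_(t, m)), v *m X = 0 -> v = v *m E' *m E].
Proof.
have [L uL [R uR [d _ defX]]] := int_Smith_normal_form X.
set D : 'M_(m, n) := \matrix_(i, j) _ in defX.
pose Z := [pred i | row i D == 0].
exists #|Z|, (rowsub (@enum_val _ Z) (invmx L)), (colsub (@enum_val _ Z) L).
split.
- apply/matrixP=> i j; rewrite mxE.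
  under eq_bigr do rewrite !mxE.
  transitivity ((invmx L *m L) (enum_val i) (enum_val j)); first by rewrite mxE.
  by rewrite mulVmx // !mxE (inj_eq enum_val_inj).
- rewrite defX !mulmxA mul_rowsub_mx mulVmx // mul_rowsub_mx mul1mx.
  suff -> : rowsub (enum_val (A:=Z)) D = 0 by rewrite mul0mx.
  apply/matrixP=> i j; have /eqP/rowP/(_ j) := enum_valP i.
  by rewrite !mxE.
move=> t v vX0.
have vLD : v *m L *m D = 0.
  have := vX0; rewrite defX !mulmxA => /(congr1 (mulmx^~ (invmx R))).
  by rewrite mulmxK // mul0mx.
have nZ a i : i \notin Z -> (v *m L) a i = 0.
  move=> /negP nz; apply/eqP; apply: contraT => vi; case: nz; apply/eqP/rowP=> j.
  rewrite !mxE; have [eij|] := eqVneq (i : nat) j; last by rewrite mulr0n.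
  have := congr1 (fun Y : 'M_(_, _) => Y a j) vLD; rewrite !mxE (bigD1 i) //=.
  rewrite big1 ?addr0 => [|k nk]; last first.
    rewrite [D _ _]mxE; case: eqVneq => [ekj|]; last by rewrite mulr0n mulr0.
    by case/eqP: nk; apply/val_inj; rewrite /= ekj eij.
  rewrite [D _ _]mxE eij eqxx mulr1n => /eqP; rewrite mulf_eq0 (negPf vi) /=.
  by move/eqP.
rewrite -[LHS](mulmxK uL) mulmx_colsub; apply/matrixP=> a j; rewrite [LHS]mxE [RHS]mxE.
rewrite (bigID (fun i => i \in Z)) /= [X in _ + X]big1 ?addr0 => [|i /nZ->]; last first.
  by rewrite mul0r.
by rewrite (big_enum_val (A := Z)); apply: eq_bigr => i _; rewrite !mxE.
Qed.

Lemma unipotent_det_neq0 (p r n : nat) (S Z M : 'M['F_p]_r) :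
  prime p -> S ^+ (p ^ n) = 1%:M -> M = 1%:M + Z *m (S - 1%:M) ->
  M *m S = S *m M -> \det M != 0.
Proof.
case: r S Z M => [|r] S Z M pr_p Sq defM comMS.
  by rewrite det_mx00 oner_eq0.
have chM : p \in [pchar 'M['F_p]_r.+1].
  by rewrite pchar_lalg; apply: pchar_Fp.
pose P := S - 1%:M; pose U := M - 1%:M.
have PE : P ^+ (p ^ n) = 0.
  have -> : P ^+ (p ^ n) = S ^+ (p ^ n) - 1.
    elim: n {Sq} => [|n IHn]; first by rewrite expn0 !expr1.
    rewrite expnSr !exprM IHn -!(pFrobenius_autE chM).
    by rewrite pFrobenius_autB_comm ?pFrobenius_aut1 //; apply: commr1.
  by rewrite Sq subrr.
have UP : U * P = P * U.
  have cMS : GRing.comm M S by [].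
  apply: commrB (commr1 _); apply/commr_sym/commrB; last exact: commr1.
  exact: commr_sym.
have UE k : exists Zk, U ^+ k = Zk * P ^+ k.
  elim: k => [|k [Zk IHk]]; first by exists 1; rewrite !expr0 mulr1.
  have cUPk : P ^+ k * U = U * P ^+ k by apply/esym/commrX.
  exists (Zk * Z); rewrite exprSr IHk -mulrA cUPk exprS !mulrA; congr (_ * _).
  by rewrite -!mulrA; congr (_ * _); rewrite /U defM addrC addKr.
have [Zq Uq] := UE (p ^ n)%N; rewrite PE mulr0 in Uq.
have: M \in unitmx; last by rewrite unitmxE unitfE.
pose q := (p ^ n)%N.
have := subrX1 (- U) q; rewrite exprNn Uq mulr0 sub0r => /(congr1 -%R).
rewrite opprK -mulNr opprB opprK [1 + U]addrC subrK => /esym E.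
by have [] := mulmx1_unit E.
Qed.

Lemma geometric_sum_mul (R : pzRingType) (x : R) a b :
  \sum_(l < b * a) x ^+ l = (\sum_(k < b) x ^+ (a * k)) * \sum_(l < a) x ^+ l.
Proof.
elim: b => [|b IHb]; first by rewrite mul0n !big_ord0 mul0r.
rewrite mulSn addnC big_split_ord /= IHb big_ord_recr /= mulrDl; congr (_ + _).
by rewrite mulr_sumr; apply: eq_bigr => l _; rewrite exprD mulnC.
Qed.

Lemma mxexprSr (R : pzRingType) n (x : 'M[R]_n) l : x ^+ l.+1 = x ^+ l *m x.
Proof. exact: exprSr. Qed.

Definition mxtrace_orbit d (s sv : 'M[int]_d) q (B : 'M_d) :=
  \sum_(l < q) s ^+ l *m B *m sv ^+ l.

Lemma mxtrace_orbit_comm d (s sv : 'M[int]_d) q B : s * sv = 1 -> sv * s = 1 ->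
  s ^+ q = 1 -> s * mxtrace_orbit s sv q B = mxtrace_orbit s sv q B * s.
Proof.
move=> ssv svs sq1.
have svq1 : sv ^+ q = 1.
  have : s ^+ q * sv ^+ q = 1.
    rewrite -exprMn_comm ?ssv ?expr1n //.
    by rewrite /GRing.comm ssv svs.
  by rewrite sq1 mul1r.
case: q sq1 svq1 => [|q] sq1 svq1; first by rewrite /mxtrace_orbit !big_ord0 mulr0 mul0r.
rewrite /mxtrace_orbit [in LHS]big_ord_recr [in RHS]big_ord_recl /=.
rewrite mulrDr mulrDl addrC; congr (_ + _).
  rewrite !expr0 mul1mx mulmx1 -!mulmxE !mulmxA mulmxE -exprS sq1 mul1r.
  congr (_ * _); by rewrite -[LHS]mulr1 -svs mulrA -exprSr svq1 mul1r.
rewrite mulr_sumr mulr_suml; apply: eq_bigr => l _; rewrite -!mulmxE.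
have -> : sv ^+ bump 0 l = sv ^+ l *m sv by rewrite /bump add1n exprSr.
have -> : s ^+ bump 0 l = s *m s ^+ l by rewrite /bump add1n exprS.
by rewrite -!mulmxA mulmxE svs [sv ^+ l * 1]mulr1.
Qed.

Lemma mx_int_lift p m n (M : 'M['F_p]_(m, n)) :
  exists X : 'M[int]_(m, n), map_mx intr X = M.
Proof.
exists (map_mx (fun x : 'F_p => (nat_of_ord x)%:Z) M).
by apply/matrixP=> i j; rewrite !mxE -[LHS]/((nat_of_ord (M i j))%:R) natr_Zp.
Qed.

Lemma mx_int_div p m n (X : 'M[int]_(m, n)) : prime p ->
  map_mx intr X = 0 :> 'M['F_p]_(m, n) -> exists U, X = p%:Z *: U.
Proof.
move=> pr_p X0; exists (map_mx (fun z => z %/ p)%Z X).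
apply/matrixP=> i j; rewrite !mxE mulrC divzK //.
rewrite (dvdz_pcharf (pchar_Fp pr_p)).
by have /matrixP/(_ i j) := X0; rewrite !mxE => ->.
Qed.

Lemma map_mxexp (R S : pzRingType) (f : {rmorphism R -> S}) n (A : 'M[R]_n) l :
  map_mx f (A ^+ l) = map_mx f A ^+ l.
Proof.
elim: l => [|l IHl]; first by rewrite !expr0 -[1]/(1%:M : 'M_n) map_mx1.
by rewrite !mxexprSr map_mxM IHl.
Qed.

Lemma trace_splitting p n d (s sv : 'M[int]_d) :
  prime p -> s * sv = 1 -> sv * s = 1 -> s ^+ (p ^ n.+1) = 1 ->
  (forall v : 'rV_d, v *m (\sum_(i < p) s ^+ (p ^ n * i)) = 0 ->
     exists w, v = w *m (s ^+ (p ^ n) - 1)) ->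
  exists (c : int) (B : 'M_d), ~~ (p %| c)%Z /\
    mxtrace_orbit s sv (p ^ n.+1) B *m (s ^+ (p ^ n) - 1)
      = c *: (s ^+ (p ^ n) - 1).
Proof.
move=> pr_p ssv svs; set q := (p ^ n.+1)%N; set a := (p ^ n)%N => sq1 H1.
set tau := s ^+ a; pose NH : 'M_d := \sum_(i < p) s ^+ (a * i).
have csv l m : s ^+ l *m sv ^+ m = sv ^+ m *m s ^+ l.
  by apply: commrX; apply/commr_sym/commrX; rewrite /GRing.comm ssv svs.
have cNH m : s ^+ m *m NH = NH *m s ^+ m.
  rewrite mulmx_sumr mulmx_suml; apply: eq_bigr => i _.
  by rewrite !mulmxE -!exprD addnC.
have tauNH : (tau - 1) *m NH = 0.
  rewrite /NH; under eq_bigr do rewrite exprM.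
  by rewrite mulmxE -subrX1 /tau -exprM -expnSr sq1 subrr.
have [r [C [C' [CC' CNH satC]]]] := int_kernel_basis NH.
have [W WC] : exists W, W *m (tau - 1) = C.
  have HW i : exists w, row i C = w *m (tau - 1).
    by apply: H1; rewrite -row_mul CNH row0.
  have {}HW i : {w | row i C = w *m (tau - 1)} by apply: sig_eqW; case: (HW i) => w; exists w.
  exists (\matrix_i (sval (HW i))); apply/row_matrixP=> i.
  by rewrite row_mul rowK; case: (HW i).
have [sY Cs] : exists sY, C *m s = sY *m C.
  by exists (C *m s *m C'); apply: satC; rewrite -mulmxA -[s]expr1 cNH mulmxA CNH mul0mx.
have [sYv Csv] : exists sYv, C *m sv = sYv *m C.
  exists (C *m sv *m C'); apply: satC; rewrite -mulmxA.
  have -> : sv *m NH = NH *m sv.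
    rewrite mulmx_sumr mulmx_suml; apply: eq_bigr => i _.
    by have := csv (a * i)%N 1%N; rewrite expr1.
  by rewrite mulmxA CNH mul0mx.
have CC'K t (M N : 'M_(t, r)) : M *m C = N *m C -> M = N.
  by move/(congr1 (mulmx^~ C')); rewrite -!mulmxA CC' !mulmx1.
have Csl l : C *m s ^+ l = sY ^+ l *m C.
  elim: l => [|l IHl]; first by rewrite !expr0 mulmx1 mul1mx.
  by rewrite !mxexprSr mulmxA IHl -mulmxA Cs mulmxA.
have Csvl l : C *m sv ^+ l = sYv ^+ l *m C.
  elim: l => [|l IHl]; first by rewrite !expr0 mulmx1 mul1mx.
  by rewrite !mxexprSr mulmxA IHl -mulmxA Csv mulmxA.
have sYsYv : sY * sYv = 1.
  have ssv' : s *m sv = 1%:M by [].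
  by apply: CC'K; rewrite -mulmxA -Csv mulmxA -Cs -mulmxA ssv' mulmx1 mul1mx.
have sYvsY : sYv * sY = 1 by apply: mulmx1C.
have sYq1 : sY ^+ q = 1 by apply: CC'K; rewrite -Csl sq1 mulmx1 mul1mx.
have NY0 : \sum_(i < p) sY ^+ (a * i) = 0.
  apply: CC'K; rewrite mul0mx -CNH mulmx_suml mulmx_sumr.
  by apply: eq_bigr => i _; rewrite Csl.
pose G := \sum_(k < p) \sum_(j < k) (sY ^+ a) ^+ j.
pose eta := - (G * \sum_(l < a) sY ^+ l).
have etaP : eta * (sY - 1) = p%:R.
  rewrite /eta mulNr -mulrA.
  have -> : (\sum_(l < a) sY ^+ l) * (sY - 1) = sY ^+ a - 1.
    rewrite subrX1 mulr_suml mulr_sumr; apply: eq_bigr => l _.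
    by rewrite mulrBl mulrBr -exprS -exprSr mul1r mulr1.
  rewrite mulr_suml (eq_bigr (fun k : 'I_p => sY ^+ (a * k) - 1)); last first.
    move=> k _; rewrite exprM [RHS]subrX1 mulr_suml mulr_sumr; apply: eq_bigr => l _.
    by rewrite mulrBl mulrBr -exprS -exprSr mul1r mulr1.
  by rewrite sumrB NY0 sumr_const card_ord sub0r opprK.
have Wtau k : W *m tau ^+ k = W + (\sum_(j < k) (sY ^+ a) ^+ j) *m C.
  have Wt : W *m tau = W + C by rewrite -WC mulmxBr mulmx1 addrC subrK.
  elim: k => [|k IHk]; first by rewrite big_ord0 mul0mx addr0 mulmx1.
  rewrite mxexprSr mulmxA IHk mulmxDl Wt -addrA; congr (_ + _).
  rewrite big_ord_recl expr0 mulmxDl mul1mx; congr (_ + _).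
  rewrite -mulmxA Csl mulmxA mulmx_suml; congr (_ *m _).
  by apply: eq_bigr => j _; rewrite mulmxE -exprSr.
pose NS : 'M_d := \sum_(l < q) s ^+ l.
pose AA : 'M_d := \sum_(l < a) s ^+ l.
have WNS : W *m NS *m C' = p%:R *: (W *m AA *m C') - eta.
  have -> : NS = (\sum_(k < p) tau ^+ k) *m AA.
    rewrite /NS /q expnS geometric_sum_mul -/a; congr (_ *m _).
    by apply: eq_bigr => k _; rewrite exprM.
  have WNH : W *m (\sum_(k < p) tau ^+ k) = p%:R *: W + G *m C.
    rewrite mulmx_sumr; under eq_bigr do rewrite Wtau; rewrite big_split /=.
    by rewrite sumr_const card_ord -scaler_nat mulmx_suml.
  have CA : C *m AA = (\sum_(l < a) sY ^+ l) *m C.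
    by rewrite mulmx_sumr mulmx_suml; apply: eq_bigr.
  rewrite mulmxA WNH !mulmxDl -!scalemxAl /eta opprK; congr (_ + _).
  by rewrite -[G *m C *m AA]mulmxA CA mulmxA -mulmxA CC' mulmx1.

have nzp : p%:Z != 0 by rewrite eqz_nat -lt0n prime_gt0.
have [X [U1 [U2 etaX]]] : exists X U1 U2, eta *m X = 1 + U1 *m (sY - 1) + p%:Z *: U2.
  pose etap : 'M['F_p]_r := map_mx intr eta.
  pose Xp := pinvmx etap.
  have [X XE] := mx_int_lift Xp.
  have [V VE] := mx_int_lift (etap *m Xp - 1%:M).
  have [U2 U2E] : exists U2, eta *m X - 1%:M - V = p%:Z *: U2.
    apply: mx_int_div => //; rewrite !map_mxB map_mxM VE XE map_mx1 /=.
    by rewrite subrr.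
  have [U U1E] : exists U, V *m eta = p%:Z *: U.
    apply: mx_int_div => //; rewrite map_mxM VE mulmxBl mul1mx.
    by rewrite mulmxKpV ?subrr.
  exists X, U, U2; rewrite -U2E.
  have -> : U *m (sY - 1) = V.
    apply: (scalemx_inj nzp); rewrite scalemxAl -U1E -mulmxA.
    have -> : eta *m (sY - 1) = (p%:Z)%:M.
      by rewrite mulmxE etaP -scalemx1 -[p%:Z]natz scaler_nat.
    by rewrite mul_mx_scalar.
  by rewrite -[X in _ + X]addrA -opprD subrKC.
pose T0 := mxtrace_orbit s sv q (- (C' *m X *m W)).
have sT0 m : s ^+ m *m T0 = T0 *m s ^+ m.
  have c1 : GRing.comm T0 s by apply/esym/mxtrace_orbit_comm.
  by have /esym := commrX m c1.
have T0NH : T0 *m NH = NH *m T0.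
  rewrite /NH [LHS]mulmx_sumr [RHS]mulmx_suml; apply: eq_bigr => i _; exact/esym/sT0.
have [D CT0] : exists D, C *m T0 = D *m C.
  by exists (C *m T0 *m C'); apply: satC; rewrite -mulmxA T0NH mulmxA CNH mul0mx.
have DsY : D *m sY = sY *m D.
  apply: CC'K; rewrite -[LHS]mulmxA -Cs [LHS]mulmxA -CT0 -[LHS]mulmxA.
  rewrite -[RHS]mulmxA -CT0 [RHS]mulmxA -Cs -[RHS]mulmxA.
  by congr (_ *m _); rewrite -[s]expr1 sT0.
have Wsv l : W *m sv ^+ l *m (tau - 1) = sYv ^+ l *m C.
  rewrite -mulmxA (_ : sv ^+ l *m (tau - 1) = (tau - 1) *m sv ^+ l).
    by rewrite mulmxA WC Csvl.
  by rewrite mulmxBr mulmxBl mulmx1 mul1mx csv.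
have T0E : T0 *m (tau - 1) = - \sum_(l < q) s ^+ l *m C' *m X *m sYv ^+ l *m C.
  rewrite /T0 /mxtrace_orbit mulmx_suml -sumrN; apply: eq_bigr => l _.
  by rewrite mulmxN !mulNmx -[X in _ = - X]mulmxA -Wsv !mulmxA.
have T0tau : T0 *m (tau - 1) = (tau - 1) *m T0.
  by rewrite mulmxBr mulmxBl mulmx1 mul1mx -sT0.
have DE : D = - \sum_(l < q) W *m s ^+ l *m C' *m X *m sYv ^+ l.
  apply: CC'K; rewrite -CT0 -WC -mulmxA -T0tau T0E mulmxN mulNmx mulmx_sumr mulmx_suml.
  by congr (- _); apply: eq_bigr => l _; rewrite WC !mulmxA.
have [Z DZ] : exists Z, D = - (W *m NS *m C' *m X) + Z *m (sY - 1).
  have sYvl l : exists Y, sYv ^+ l = 1 + Y *m (sY - 1).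
    elim: l => [|l [Y IHl]]; first by exists 0; rewrite mul0mx addr0.
    exists (sYv * Y - sYv); rewrite exprS IHl mulrDr mulr1 mulmxBl.
    rewrite -[sYv *m (sY - 1)]/(sYv * (sY - 1)) mulrBr sYvsY mulr1.
    by rewrite -!mulmxE !mulmxA opprB [RHS]addrCA subrKC addrC.
  have [Y YE] := fin_all_exists (fun l : 'I_q => sYvl l).
  exists (- \sum_(l < q) W *m s ^+ l *m C' *m X *m Y l).
  rewrite DE mulNmx -opprD; congr (- _).
  rewrite !mulmx_suml mulmx_sumr !mulmx_suml -big_split /=; apply: eq_bigr => l _.
  by rewrite (YE l : sYv ^+ l = 1%:M + _) mulmxDr mulmx1 !mulmxA.
pose c := \det D.
have cp : ~~ (p %| c)%Z.
  rewrite (dvdz_pcharf (pchar_Fp pr_p)) -det_map_mx.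
  apply: (@unipotent_det_neq0 p r n.+1 (map_mx intr sY) (map_mx intr (Z + U1))) => //.
  - by rewrite -map_mxexp sYq1 -[1]/(1%:M : 'M_r) map_mx1.
  - rewrite DZ WNS mulmxBl -scalemxAl opprB etaX.
    rewrite !(map_mxD, map_mxB, map_mxN, map_mxM, map_mxZ) /=.
    have p0 : p%:Z%:~R = 0 :> 'F_p by rewrite -pmulrn (pcharf0 (pchar_Fp pr_p)).
    rewrite [p%:R]natz p0 !scale0r addr0 subr0.
    have -> : map_mx intr (1 : 'M[int]_r) = 1%:M :> 'M['F_p]_r by apply: map_mx1.
    by rewrite mulmxDl -addrA [X in _ + X]addrC.
  by rewrite -!map_mxM DsY.
have nzc : c != 0 by apply: contraNneq cp => ->; rewrite dvdz0.
exists c, (- (C' *m X *m \adj D *m W)); split => //.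
have DsYv : D *m sYv = sYv *m D.
  have E1 : sYv *m sY = 1%:M by [].
  have E2 : sY *m sYv = 1%:M by [].
  rewrite -[LHS]mul1mx -E1 -mulmxA [sY *m _]mulmxA -DsY.
  by rewrite -[D *m sY *m _]mulmxA E2 mulmx1.
have DsYvl l : D *m sYv ^+ l = sYv ^+ l *m D by exact: commrX.
have adjsYv l : \adj D *m sYv ^+ l = sYv ^+ l *m \adj D.
  apply: (scalemx_inj nzc); rewrite -mul_mx_scalar -mul_mx_adj.
  rewrite mulmxA -[_ *m _ *m D]mulmxA -DsYvl mulmxA mul_adj_mx -/c.
  by rewrite mul_scalar_mx -scalemxAl.
have tauC : tau - 1 = (tau - 1) *m C' *m C by exact: satC.
transitivity (T0 *m (tau - 1) *m C' *m \adj D *m C).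
  rewrite T0E /mxtrace_orbit !mulNmx !mulmx_suml -sumrN; apply: eq_bigr => l _.
  rewrite mulmxN !mulNmx; congr (- _).
  rewrite -[_ *m C *m C']mulmxA CC' mulmx1 -[_ *m \adj D]mulmxA -adjsYv.
  by rewrite !mulmxA -[_ *m _ *m C]mulmxA -Wsv !mulmxA.
rewrite T0tau {1}tauC -[_ *m C *m T0]mulmxA CT0 mulmxA -[_ *m C *m C']mulmxA CC' mulmx1.
rewrite -[_ *m D *m _]mulmxA mul_mx_adj -/c mul_mx_scalar -scalemxAl.
by rewrite -tauC.
Qed.

Definition pair_act d (s sv : 'M[int]_d) (u : 'rV[int]_d * 'cV[int]_d) :=
  (u.1 *m s, sv *m u.2).

Definition pair_inv d (s sv : 'M[int]_d) I := perm_eq (map (pair_act s sv) I) I.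

Lemma pair_inv_flatten (T : eqType) d (s sv : 'M[int]_d) (F : T -> seq _) r :
  (forall x, x \in r -> pair_inv s sv (F x)) ->
  pair_inv s sv (flatten (map F r)).
Proof.
elim: r => //= x r IHr invF; rewrite /pair_inv map_cat; apply: perm_cat.
  exact: (invF _ (mem_head _ _)).
by apply: IHr => y yr; apply: invF; rewrite inE yr orbT.
Qed.

Lemma perm_map_shift (T : eqType) (f f' : nat -> T) q : (0 < q)%N ->
  (forall l, f' l.+1 = f l) -> f' 0%N = f q.-1 ->
  perm_eq (map f' (iota 0 q)) (map f (iota 0 q)).
Proof.
case: q => // q _ fS f0 /=.
have -> : map f' (iota 1 q) = map f (iota 0 q).
  by rewrite -[1%N]addn0 iotaDl -map_comp; apply: eq_map => l /=.
rewrite f0.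
have -> : f 0%N :: map f (iota 1 q) = rcons (map f (iota 0 q)) (f q).
  have <- : map f (iota 0 q.+1) = f 0%N :: map f (iota 1 q) by [].
  by rewrite -addn1 iotaD map_cat cats1.
by rewrite perm_sym perm_rcons.
Qed.

Lemma lattice_invertible p n d (s sv : 'M[int]_d) :
  prime p -> s * sv = 1 -> sv * s = 1 -> s ^+ (p ^ n) = 1 ->
  (forall j (v : 'rV_d), (j <= n)%N ->
     v *m (\sum_(i < p ^ (n - j)) s ^+ (p ^ j * i)) = 0 ->
     exists w, v = w *m (s ^+ (p ^ j) - 1)) ->
  exists (c : int) I, [/\ ~~ (p %| c)%Z, pair_inv s sv I &
    \sum_(u <- I) u.2 *m u.1 = c%:M].
Proof.
move=> pr_p; elim: n d s sv => [|n IHn] d s sv ssv svs sq1 H1.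
  rewrite expn0 expr1 in sq1.
  have sv1 : sv = 1 by rewrite -ssv sq1 mul1r.
  exists 1, [seq (delta_mx 0 i, delta_mx i 0) | i <- enum 'I_d]; split.
  - by rewrite dvdz1 neq_ltn prime_gt1 ?orbT.
  - rewrite /pair_inv map_id_in // => u _; case: u => u1 u2.
    by rewrite /pair_act sv1 sq1 -[1]/(1%:M : 'M_d) mulmx1 mul1mx.
  rewrite big_map mx1_sum_delta big_enum /=; apply: eq_bigr => i _.
  by rewrite mul_delta_mx.
have [|c1 [B [cp1 TB]]] := @trace_splitting p n d s sv pr_p ssv svs sq1.
  by move=> v; have := H1 n v (leqnSn _); rewrite subSnn expn1.
set T := mxtrace_orbit _ _ _ _ in TB.
set tau := s ^+ (p ^ n) in TB.
pose R := c1%:M - T.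
have sT : s *m T = T *m s by apply: mxtrace_orbit_comm.
have sR : s *m R = R *m s by rewrite mulmxBl mulmxBr scalar_mxC sT.
have svR : sv *m R = R *m sv.
  have E1 : sv *m s = 1%:M by [].
  have E2 : s *m sv = 1%:M by [].
  rewrite -[LHS]mulmx1 -E2 mulmxA -[sv *m R *m s]mulmxA -sR mulmxA E1 mul1mx.
  by [].
have Rtau : R *m (tau - 1) = 0 by rewrite mulmxBl TB mul_scalar_mx subrr.
have cstau m : s ^+ m *m (tau - 1) = (tau - 1) *m s ^+ m.
  by rewrite mulmxBl mulmxBr mulmx1 mul1mx !mulmxE -!exprD addnC.
have [r [E [E' [EE' Etau satE]]]] := int_kernel_basis (tau - 1).
have RE : R = R *m E' *m E by apply: satE.
have EK t (M N : 'M_(t, r)) : M *m E = N *m E -> M = N.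
  by move/(congr1 (mulmx^~ E')); rewrite -!mulmxA EE' !mulmx1.
have [s' Es] : exists s', E *m s = s' *m E.
  exists (E *m s *m E'); apply: satE.
  by rewrite -mulmxA -[s]expr1 cstau mulmxA Etau mul0mx.
have csvtau : sv *m (tau - 1) = (tau - 1) *m sv.
  have c1' : GRing.comm sv tau by apply: commrX; rewrite /GRing.comm ssv svs.
  by rewrite mulmxBl mulmxBr mulmx1 mul1mx [_ *m tau]c1'.
have [sv' Esv] : exists sv', E *m sv = sv' *m E.
  by exists (E *m sv *m E'); apply: satE; rewrite -mulmxA csvtau mulmxA Etau mul0mx.
have ssv' : s' * sv' = 1.
  have E2 : s *m sv = 1%:M by [].
  by apply: EK; rewrite -mulmxA -Esv mulmxA -Es -mulmxA E2 mulmx1 mul1mx.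
have svs' : sv' * s' = 1 by apply: mulmx1C.
have Esl l : E *m s ^+ l = s' ^+ l *m E.
  elim: l => [|l IHl]; first by rewrite !expr0 mulmx1 mul1mx.
  by rewrite !mxexprSr mulmxA IHl -mulmxA Es mulmxA.
have sq1' : s' ^+ (p ^ n) = 1.
  apply: EK; rewrite -Esl -[s ^+ _]/tau mul1mx; apply/eqP; rewrite -subr_eq0.
  by rewrite -{2}[E]mulmx1 -mulmxBr Etau.
have [|c2 [I2 [cp2 inv2 sum2]]] := IHn r s' sv' ssv' svs' sq1'.
  move=> j v lejn vN0; have lejn1 : (j <= n.+1)%N by exact: leqW.
  pose N' := \sum_(i < p ^ (n - j)) s' ^+ (p ^ j * i).
  have EN : E *m (\sum_(i < p ^ (n - j)) s ^+ (p ^ j * i)) = N' *m E.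
    by rewrite mulmx_sumr mulmx_suml; apply: eq_bigr => i _.
  have [|w vE] := H1 j (v *m E) lejn1.
    rewrite subSn // expnS; under eq_bigr do rewrite exprM.
    rewrite geometric_sum_mul.
    have Epow k : E *m (s ^+ (p ^ j)) ^+ (p ^ (n - j) * k) = E.
      by rewrite -exprM mulnA -expnD subnKC // Esl exprM sq1' expr1n mul1mx.
    rewrite -mulmxE -mulmxA [E *m (_ *m _)]mulmxA [E *m \sum_k _]mulmx_sumr.
    under eq_bigr do rewrite Epow.
    rewrite sumr_const card_ord -scaler_nat -scalemxAl -scalemxAr.
    under eq_bigr do rewrite -exprM.
    by rewrite EN mulmxA vN0 mul0mx scaler0.
  have wtau : w *m (tau - 1) = 0.
    have -> : tau - 1 = (s ^+ (p ^ j) - 1) *m \sum_(i < p ^ (n - j)) s ^+ (p ^ j * i).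
      rewrite /tau -{1}(subnKC lejn) expnD exprM mulmxE subrX1; congr (_ * _).
      by apply: eq_bigr => i _; rewrite exprM.
    by rewrite mulmxA -vE -mulmxA EN mulmxA vN0 mul0mx.
  exists (w *m E'); apply: EK; rewrite vE {1}(satE _ _ wtau) -!mulmxA.
  congr (_ *m (_ *m _)).
  by rewrite mulmxBr mulmxBl mulmx1 mul1mx Esl.
have svq l : s ^+ l * sv ^+ l = 1.
  by rewrite -exprMn_comm ?ssv ?expr1n // /GRing.comm ssv svs.
have q_gt0 : (0 < p ^ n.+1)%N by rewrite expn_gt0 prime_gt0.
have svq1 : sv ^+ (p ^ n.+1) = 1 by rewrite -[LHS]mul1r -{1}sq1 svq.
have sqP : s ^+ (p ^ n.+1).-1 = sv.
  by rewrite -[LHS]mulr1 -ssv mulrA -exprSr prednK // sq1 mul1r.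
have svqP : sv ^+ (p ^ n.+1).-1 = s.
  by rewrite -[LHS]mulr1 -svs mulrA -exprSr prednK // svq1 mul1r.
exists (c2 * c1), ([seq (u.1, c2 *: u.2) | u <- flatten [seq
   [seq (delta_mx 0 i *m sv ^+ l, s ^+ l *m (B *m delta_mx i 0)) | l <- iota 0 (p ^ n.+1)] | i <- enum 'I_d]]
   ++ [seq (u.1 *m E, R *m E' *m u.2) | u <- I2]); split.
- by rewrite dvdzE abszM Euclid_dvdM // negb_or -!dvdzE [in (_ %| c2)%Z]/= cp2.
- rewrite /pair_inv map_cat; apply: perm_cat.
    rewrite -map_comp (eq_map (g := (fun u => (u.1, c2 *: u.2)) \o pair_act s sv)); last first.
      by move=> u; rewrite /pair_act /= scalemxAr.
    rewrite map_comp; apply/perm_map/pair_inv_flatten => i _.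
    rewrite /pair_inv -map_comp; apply: perm_map_shift => // [l|]; rewrite /pair_act /=.
      rewrite mxexprSr -!mulmxA [sv *m s]svs mulmx1 exprS -mulmxE mulmxA.
      by rewrite [sv *m (s *m _)]mulmxA [sv *m s]svs mul1mx.
    by rewrite expr0 expr0 mulmx1 mul1mx sqP svqP.
  rewrite -map_comp (eq_map (g := (fun u => (u.1 *m E, R *m E' *m u.2)) \o pair_act s' sv')); last first.
    move=> u; rewrite /pair_act /= -!mulmxA Es; congr (_, _).
    rewrite [sv *m _]mulmxA svR {1}RE -!mulmxA [E *m _]mulmxA Esv.
    by rewrite -!mulmxA [E *m (E' *m _)]mulmxA EE' mul1mx.
  by rewrite map_comp; apply: perm_map.
rewrite big_cat /= !big_map big_flatten big_map.
have -> : \sum_(j <- I2) (R *m E' *m j.2 *m (j.1 *m E)) = c2 *: R.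
  rewrite {2}RE -mul_scalar_mx -scalar_mxC -!mulmxA scalar_mxC -sum2.
  rewrite mulmx_suml !mulmx_sumr; apply: eq_bigr => u _.
  by rewrite !mulmxA.
have -> : \sum_(i <- enum 'I_d) \sum_(u <- [seq ((delta_mx 0 i : 'rV_d) *m sv ^+ l, s ^+ l *m (B *m delta_mx i 0))
   | l <- iota 0 (p ^ n.+1)]) c2 *: u.2 *m u.1 = c2 *: T.
  rewrite /T /mxtrace_orbit scaler_sumr.
  under eq_bigr do rewrite big_map.
  rewrite exchange_big /= -val_enum_ord big_map big_enum /=; apply: eq_bigr => l _.
  rewrite big_enum /=; under eq_bigr do rewrite -scalemxAl -!mulmxA [delta_mx _ 0 *m _]mulmxA mul_delta_mx.
  rewrite -scaler_sumr; congr (_ *: _); rewrite -!mulmx_sumr -mulmx_suml -mx1_sum_delta.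
  by rewrite mul1mx mulmxA.
by rewrite -scalerDr addrC subrK scale_scalar_mx.
Qed.

Definition hom_mod (gT : finGroupType) (e : nat) (K : {set gT}) (a : gT -> int) :=
  forall x y, x \in K -> y \in K -> (e %| a (x * y)%g - a x - a y)%Z.

Section HomMod.
Variables (gT : finGroupType) (e : nat).
Implicit Types (K N : {group gT}) (a : gT -> int).

Lemma hom_mod1 K a : hom_mod e K a -> (e %| a 1%g)%Z.
Proof.
move=> /(_ 1%g 1%g (group1 _) (group1 _)); rewrite mulg1.
by rewrite subrr sub0r rpredN.
Qed.

Lemma hom_modX K a x n : hom_mod e K a -> x \in K ->
  (e %| a (x ^+ n)%g - a x *+ n)%Z.
Proof.
move=> ha xK; elim: n => [|n IHn]; first by rewrite expg0 mulr0n subr0 (hom_mod1 ha).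
have := ha x (x ^+ n)%g xK (groupX _ xK).
rewrite expgS mulrS => h; have := rpredD h IHn; congr (_ %| _)%Z; ring.
Qed.

Lemma hom_mod_ext_step N K a x : (0 < e)%N -> abelian N -> (exponent N %| e)%N ->
  K \subset N -> x \in N -> hom_mod e K a ->
  exists a', hom_mod e (K <*> <[x]>)%G a' /\ forall y, y \in K -> (e %| a' y - a y)%Z.
Proof.
move=> e_gt0 cNN expN sKN xN ha.
have nKx : (x \in 'N(K))%g by apply: (subsetP (cents_norm (subset_trans cNN (centS sKN)))).
pose r := #[coset K x]%g.
have inK n : (x ^+ n \in K)%g = (r %| n)%N.
  rewrite order_dvdn -morphX //; apply/idP/eqP => [/coset_id //|].
  by apply: coset_idr; apply: groupX.
have xe1 : (x ^+ e = 1)%g.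
  by apply/eqP; rewrite -order_dvdn (dvdn_trans (dvdn_exponent xN)).
have re : (r %| e)%N by rewrite -inK xe1 group1.
have xrK : (x ^+ r \in K)%g by rewrite inK.
have r_gt0 : (0 < r)%N by apply: order_gt0.
have rdiv : (r %| a (x ^+ r)%g)%Z.
  have [e' De] := dvdnP re.
  have := hom_modX e' ha xrK; rewrite -expgM mulnC -De xe1.
  move=> /(rpredB (hom_mod1 ha)); rewrite opprB addrC subrK.
  rewrite De -mulr_natl natz PoszM dvdz_mul2l //.
  by rewrite eqz_nat; apply: contraTneq e_gt0 => e0; rewrite De e0.
pose y := (a (x ^+ r)%g %/ r)%Z.
pose A g i := a (g * x ^- i)%g + y *+ i.
have AA g i j : (i <= j)%N -> (g * x ^- i \in K)%g -> (g * x ^- j \in K)%g ->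
    (e %| A g i - A g j)%Z.
  move=> leij giK gjK.
  have xd : (g * x ^- i = (g * x ^- j) * x ^+ (j - i))%g.
    by rewrite -{1}(subnK leij) expgD invMg mulgA mulgKV.
  have xdK : (x ^+ (j - i) \in K)%g by rewrite -(groupMl _ gjK) -xd.
  have /dvdnP[t Dt] : (r %| j - i)%N by rewrite -inK.
  have h1 := ha _ _ gjK xdK; rewrite -xd in h1.
  have h2 := hom_modX t ha xrK; rewrite -expgM mulnC -Dt in h2.
  have h3 : y *+ (j - i) = a (x ^+ r)%g *+ t.
    by rewrite Dt mulnC mulrnA; congr (_ *+ _); rewrite -mulr_natr natz divzK.
  have := rpredD h1 h2; congr (_ %| _)%Z; rewrite /A -h3.
  have -> : y *+ (j - i) = y *+ j - y *+ i by rewrite mulrnBr.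
  ring.
have AAw g i j : (g * x ^- i \in K)%g -> (g * x ^- j \in K)%g -> (e %| A g i - A g j)%Z.
  move=> gi gj; have [/AA->//|/ltnW/AA h] := leqP i j.
  by rewrite -rpredN opprB h.
pose a' g := A g (odflt ord0 [pick i : 'I_#[x]%g.+1 | (g * x ^- i \in K)%g]).
have a'P g i : (g * x ^- i \in K)%g -> (e %| a' g - A g i)%Z.
  move=> giK; rewrite /a'; case: pickP => [j gjK|/=]; first exact: AAw.
  have hi : (i %% #[x]%g < #[x]%g.+1)%N by rewrite ltnS ltnW // ltn_pmod // order_gt0.
  by move/(_ (Ordinal hi)); rewrite /= expg_mod_order giK.
have memH g : g \in (K <*> <[x]>)%G -> exists i, (g * x ^- i \in K)%g.
  rewrite /= norm_joinEr ?cycle_subG // => /mulsgP[k _ kK /cycleP[i ->] ->].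
  by exists i; rewrite mulgK.
exists a'; split => [g1 g2 g1H g2H|g gK]; last first.
  have := a'P g 0%N; rewrite expg0 invg1 mulg1 => /(_ gK).
  by rewrite /A expg0 invg1 mulg1 mulr0n addr0.
have [[i1 gi1] [i2 gi2]] := (memH _ g1H, memH _ g2H).
have g2N : g2 \in N by move: g2H; apply/subsetP; rewrite join_subG sKN cycle_subG.
have E : (g1 * g2 * x ^- (i1 + i2) = (g1 * x ^- i1) * (g2 * x ^- i2))%g.
  have c : commute g2 (x ^- i1).
    by apply/(centsP cNN) => //; rewrite groupV groupX.
  by rewrite addnC expgD invMg -!mulgA; congr (_ * _)%g; rewrite !mulgA c.
have := a'P (g1 * g2)%g (i1 + i2)%N; rewrite E groupM // => /(_ isT) h0.
have h1 := a'P _ _ gi1; have h2 := a'P _ _ gi2.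
have h3 := ha _ _ gi1 gi2.
have := rpredD (rpredB (rpredB h0 h1) h2) h3; congr (_ %| _)%Z.
rewrite /A E mulrnDr; ring.
Qed.

Lemma hom_mod_ext N K a : (0 < e)%N -> abelian N -> (exponent N %| e)%N ->
  K \subset N -> hom_mod e K a ->
  exists a', hom_mod e N a' /\ forall y, y \in K -> (e %| a' y - a y)%Z.
Proof.
move=> e_gt0 cNN expN; have [n] := ubnP (#|N| - #|K|).
elim: n K a => // n IHn K a leKn sKN ha.
have [sNK|/subsetPn[x xN xK]] := boolP (N \subset K).
  exists a; split => [x y xN yN|y _]; last by rewrite subrr dvdz0.
  by apply: ha; apply: (subsetP sNK).
have [a1 [ha1 ext1]] := hom_mod_ext_step e_gt0 cNN expN sKN xN ha.
have [||a2 [ha2 ext2]] := IHn (K <*> <[x]>)%G a1 _ _ ha1.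
- have ltK : (#|K| < #|(K <*> <[x]>)%g|)%N.
    apply: proper_card; rewrite properE joing_subl; apply/subsetPn; exists x => //.
    by rewrite mem_gen // inE cycle_id orbT.
  have leN : (#|(K <*> <[x]>)%g| <= #|N|)%N.
    by rewrite subset_leq_card // join_subG sKN cycle_subG.
  by move: leKn ltK leN => /=; lia.
- by rewrite join_subG sKN cycle_subG.
exists a2; split => // y yK.
have yH : y \in (K <*> <[x]>)%G by rewrite mem_gen // inE yK.
by rewrite -(subrK (a1 y) (a2 y)) -addrA rpredD ?ext2 ?ext1.
Qed.
End HomMod.

Lemma finite_orbit_coboundary (T : finType) (f : T -> T) (m : T -> int) r :
  injective f -> (forall x, iter r f x = x) ->
  (forall x, \sum_(i < r) m (iter i f x) = 0) -> (0 < r)%N ->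
  exists w : T -> int, forall x, w (f x) = w x + m x.
Proof.
move=> injf fr sum0 r_gt0.
exists (fun x => \sum_(j < findex f (froot f x) x) m (iter j f (froot f x))) => x.
have symf := fconnect_sym injf.
have xfx := fconnect1 f x.
have -> : froot f (f x) = froot f x by apply/esym/eqP; rewrite (root_connect symf).
set x0 := froot f x.
have x0x : fconnect f x0 x by rewrite symf connect_root.
have := iter_findex x0x; have := findex_max x0x; set i := findex f x0 x => lti Dx.
have -> : findex f x0 (f x) = findex f x0 (iter i.+1 f x0) by rewrite iterS Dx.
rewrite -[X in _ = _ + m X]Dx -[RHS](big_ord_recr i (fun j => m (iter j f x0))) /= -iterS.
have [lt1|] := ltnP i.+1 (fingraph.order f x0).
  by rewrite findex_iter.
rewrite leq_eqVlt ltnNge lti orbF => /eqP Do.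
rewrite -Do iter_order // findex0 big_ord0.
have iter_o k : iter (k * fingraph.order f x0) f x0 = x0.
  by elim: k => // k IHk; rewrite mulSn iterD IHk iter_order.
have o_r : (fingraph.order f x0 %| r)%N.
  have E := divn_eq r (fingraph.order f x0); have := fr x0; rewrite {1}E addnC iterD iter_o.
  move/(congr1 (findex f x0)); rewrite findex_iter ?findex0 ?ltn_pmod ?fingraph.order_gt0 //.
  by rewrite /dvdn => ->.
have sumo k : \sum_(j < k * fingraph.order f x0) m (iter j f x0)
    = (\sum_(j < fingraph.order f x0) m (iter j f x0)) *+ k.
  elim: k => [|k IHk]; first by rewrite mul0n big_ord0 mulr0n.
  rewrite mulSn addnC big_split_ord /= IHk mulrS addrC; congr (_ + _).
  by apply: eq_bigr => j _; rewrite addnC iterD iter_o.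
have := sum0 x0; rewrite -(divnK o_r) sumo => /eqP.
rewrite mulrn_eq0 => /orP[/eqP r0|/eqP->//].
by move: r_gt0; rewrite -(divnK o_r) r0.
Qed.

Section WeightLattice.
Variables (gT : finGroupType) (N : {group gT}) (e : nat).
Hypotheses (e_gt0 : (0 < e)%N) (cNN : abelian N) (expN : (exponent N %| e)%N).

Definition weight_lattice (m : gT -> int) :=
  hom_mod e N m /\ forall x, x \notin N -> (e %| m x)%Z.

Lemma weight_lattice_coflabby g r m : g \in 'N(N)%g -> (g ^+ r = 1)%g -> (0 < r)%N ->
  weight_lattice m -> (forall x, \sum_(i < r) m (x ^ (g ^+ i))%g = 0) ->
  exists2 w, weight_lattice w & forall x, m x = w (x ^ g)%g - w x.
Proof.
move=> nNg gr1 r_gt0 [hm mN] sum0.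
have iterg i x : iter i (conjg^~ g) x = (x ^ (g ^+ i))%g.
  by elim: i => [|i IHi]; rewrite ?expg0 ?conjg1 // iterS IHi expgSr conjgM.
have [||w0 w0P] := @finite_orbit_coboundary _ (conjg^~ g) m r (@conjg_inj _ g) _ _ r_gt0.
- by move=> x; rewrite iterg gr1 conjg1.
- by move=> x; rewrite -[RHS](sum0 x); apply: eq_bigr => i _; rewrite iterg.
have memJ x : (x ^ g \in N)%g = (x \in N) by apply: memJ_norm.
pose kap x := (x ^ g * x^-1)%g.
have kapM x y : x \in N -> y \in N -> kap (x * y)%g = (kap x * kap y)%g.
  move=> xN yN; rewrite /kap conjMg invMg.
  have c : commute x^-1%g (y ^ g * y^-1)%g.
    by apply/(centsP cNN); rewrite ?groupV // groupM ?groupV ?memJ.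
  by rewrite -[LHS]mulgA [X in (_ * X)%g = _]mulgA -c [LHS]mulgA.
have gsK : group_set [set kap x | x in N].
  apply/group_setP; split; first by apply/imsetP; exists 1%g; rewrite ?group1 // /kap conj1g mul1g invg1.
  move=> _ _ /imsetP[x xN ->] /imsetP[y yN ->].
  by rewrite -kapM // imset_f // groupM.
pose K := Group gsK.
have fixm z : (z ^ g = z)%g -> m z = 0.
  move=> zg; have := sum0 z; under eq_bigr => i _.
    have -> : (z ^ (g ^+ i) = z)%g.
      by elim: {i}(nat_of_ord i) => [|i IHi]; rewrite ?expg0 ?conjg1 // expgS conjgM zg.
    over.
  rewrite sumr_const card_ord => /eqP; rewrite mulrn_eq0 => /orP[/eqP r0|/eqP//].
  by rewrite r0 in r_gt0.
have mK x y : x \in N -> y \in N -> kap x = kap y -> (e %| m x - m y)%Z.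
  move=> xN yN kxy; have xyN : (x * y^-1)%g \in N by rewrite groupM ?groupV.
  have := hm _ _ xyN yN; rewrite mulgKV (fixm (x * y^-1)%g) ?subr0 //.
  have xg : (x ^ g = kap y * x)%g by rewrite -kxy /kap mulgKV.
  have yg : (y ^ g = kap y * y)%g by rewrite /kap mulgKV.
  have c : commute (x * y^-1)%g (kap y).
    by apply/(centsP cNN) => //; rewrite groupM ?groupV ?memJ.
  rewrite conjMg conjVg xg yg invMg -[LHS]mulgA [X in (_ * X)%g = _]mulgA.
  by rewrite [LHS]mulgA -c mulgK.
pose chi k := m (odflt 1%g [pick x in N | kap x == k]).
have chiP x : x \in N -> (e %| chi (kap x) - m x)%Z.
  move=> xN; rewrite /chi; case: pickP => [y /andP[yN /eqP kxy]|/(_ x)]; first exact: mK.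
  by rewrite xN eqxx.
have hchi : hom_mod e K chi.
  move=> _ _ /imsetP[x xN ->] /imsetP[y yN ->]; rewrite -kapM //.
  have h1 := chiP _ (groupM xN yN); have h2 := chiP _ xN; have h3 := chiP _ yN.
  have := rpredD (rpredB (rpredB h1 h2) h3) (hm _ _ xN yN).
  congr (_ %| _)%Z; ring.
have sKN : K \subset N.
  by apply/subsetP=> _ /imsetP[x xN ->]; rewrite groupM ?groupV ?memJ.
have [a [ha aP]] := hom_mod_ext e_gt0 cNN expN sKN hchi.
have agm x : x \in N -> (e %| a (x ^ g)%g - a x - m x)%Z.
  move=> xN; have kK : kap x \in K by apply/imsetP; exists x.
  have kN : kap x \in N by apply: (subsetP sKN).
  have h1 := ha _ _ kN xN; rewrite mulgKV in h1.
  have := rpredD (rpredD h1 (aP _ kK)) (chiP _ xN); congr (_ %| _)%Z; ring.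
pose f0 x := w0 x - (if x \in N then a x else 0).
pose f1 x := (f0 x %% e)%Z.
have f0g x : f1 (x ^ g)%g = f1 x.
  apply/eqP; rewrite eqz_mod_dvd /f0 memJ w0P.
  case: ifP => xN; last by have := mN x (negbT xN); congr (_ %| _)%Z; ring.
  by rewrite -rpredN; have := agm x xN; congr (_ %| _)%Z; ring.
have f01 x : (e %| f0 x - f1 x)%Z by rewrite -eqz_mod_dvd modz_mod.
exists (fun x => w0 x - f1 x); last by move=> x; rewrite f0g w0P; ring.
split=> [x y xN yN|x xN].
  have h1 := f01 (x * y)%g; have h2 := f01 x; have h3 := f01 y.
  have := rpredD (rpredB (rpredB h1 h2) h3) (ha _ _ xN yN).
  congr (_ %| _)%Z; rewrite /f0 groupM // xN yN; ring.
by have := f01 x; rewrite /f0 (negPf xN) subr0.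
Qed.
End WeightLattice.

Definition row_val (T : finType) d (E : 'M[int]_(d, #|T|)) (v : 'rV_d) (x : T) :=
  (v *m E) 0 (enum_rank x).

Lemma row_valD (T : finType) d (E : 'M[int]_(d, #|T|)) v w x :
  row_val E (v + w) x = row_val E v x + row_val E w x.
Proof. by rewrite /row_val mulmxDl mxE. Qed.

Lemma weight_lattice_basis (gT : finGroupType) (N : {group gT}) (e : nat) :
  (0 < e)%N ->
  exists d (E : 'M[int]_(d, #|gT|)),
    [/\ forall v, weight_lattice N e (row_val E v),
        forall m, weight_lattice N e m -> exists v, forall x, row_val E v x = m x &
        forall t (v : 'M_(t, d)), v *m E = 0 -> v = 0].
Proof.
move=> e_gt0; pose R := #|{: gT * gT}|.
pose del (x y : gT) : int := (x == y)%:R.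
pose dl x (ab : gT * gT) := if ab.1 \in N then
  (if ab.2 \in N then del x (ab.1 * ab.2)%g - del x ab.1 - del x ab.2 else del x ab.2)
  else del x ab.1.
pose D : 'M[int]_(#|gT|, R) := \matrix_(i, j) dl (enum_val i) (enum_val j).
have sumdel (m : gT -> int) y : \sum_(i < #|gT|) m (enum_val i) * del (enum_val i) y = m y.
  rewrite (bigD1 (enum_rank y)) //= enum_rankK /del eqxx mulr1 big1 ?addr0 // => i ni.
  case: eqVneq => [Di|]; last by rewrite mulr0.
  by case/eqP: ni; rewrite -Di enum_valK.
pose dv (m : gT -> int) ab := if ab.1 \in N then
  (if ab.2 \in N then m (ab.1 * ab.2)%g - m ab.1 - m ab.2 else m ab.2) else m ab.1.
have DE (u : 'rV_#|gT|) (m : gT -> int) j : (forall x, u 0 (enum_rank x) = m x) ->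
    (u *m D) 0 j = dv m (enum_val j).
  move=> Du; rewrite mxE (eq_bigr (fun i => m (enum_val i) * dl (enum_val i) (enum_val j))).
    rewrite /dv /dl; case: ifP => _; last exact: sumdel.
    case: ifP => _; last exact: sumdel.
    under eq_bigr do rewrite !mulrBr.
    by rewrite !sumrB !sumdel.
  by move=> i _; rewrite -Du enum_valK mxE.
have dvP m : weight_lattice N e m <-> forall ab, (e %| dv m ab)%Z.
  split=> [[hm mN] [a b]|H]; rewrite /dv /=.
    case: ifP => aN; last by rewrite mN ?aN.
    by case: ifP => bN; [apply: hm|rewrite mN ?bN].
  split=> [x y xN yN|x xN].
    by have := H (x, y); rewrite /dv /= xN yN.
  by have := H (x, x); rewrite /dv /= (negPf xN).
have [d [F [F' [FF' F0 satF]]]] := int_kernel_basis (col_mx D (- e%:Z%:M)).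
have nze : e%:Z != 0 by rewrite eqz_nat -lt0n.
have F1 : lsubmx F *m D = e%:Z *: rsubmx F.
  move: F0; rewrite -{1}[F]hsubmxK mul_row_col mulmxN mul_mx_scalar => /eqP.
  by rewrite subr_eq0 => /eqP.
exists d, (lsubmx F); split => [v|m /dvP Hm|t v v0].
- apply/dvP => ab; rewrite -[ab]enum_rankK -(DE (v *m lsubmx F)) //.
  by rewrite -mulmxA F1 -scalemxAr mxE dvdz_mulr.
- pose u : 'rV[int]_#|gT| := \row_i m (enum_val i).
  pose w : 'rV[int]_R := \row_j (dv m (enum_val j) %/ e)%Z.
  have ux x : u 0 (enum_rank x) = m x by rewrite mxE enum_rankK.
  have uw0 : row_mx u w *m col_mx D (- e%:Z%:M) = 0.
    rewrite mul_row_col mulmxN mul_mx_scalar; apply/eqP; rewrite subr_eq0; apply/eqP/rowP=> j.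
    by rewrite (DE u m) // !mxE mulrC divzK.
  have /(congr1 lsubmx) := satF _ _ uw0; rewrite row_mxKl => Du.
  exists (row_mx u w *m F') => x; rewrite -ux /row_val.
  suff -> : row_mx u w *m F' *m lsubmx F = u by [].
  by rewrite [RHS]Du -[X in lsubmx (_ *m X)]hsubmxK mul_mx_row row_mxKl.
have v1 : v *m rsubmx F = 0.
  by apply: (scalemx_inj nze); rewrite scalemxAr -F1 mulmxA v0 mul0mx scaler0.
by rewrite -[v]mulmx1 -FF' mulmxA -[F]hsubmxK mul_mx_row v0 v1 row_mx0 mul0mx.
Qed.

Lemma weight_lattice_rep (gT : finGroupType) (N : {group gT}) (e : nat) :
  (0 < e)%N ->
  exists d (E : 'M[int]_(d, #|gT|)) (rho : gT -> 'M[int]_d),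
    [/\ forall v, weight_lattice N e (row_val E v),
        forall m, weight_lattice N e m -> exists v, forall x, row_val E v x = m x,
        forall v w : 'rV_d, row_val E v =1 row_val E w -> v = w,
        forall g v x, g \in 'N(N)%g -> row_val E (v *m rho g) x = row_val E v (x ^ g^-1)%g &
        rho 1%g = 1%:M /\ {in 'N(N)%g &, forall g h, rho (g * h)%g = rho g *m rho h}].
Proof.
move=> e_gt0; have [d [E [EL latE injE]]] := weight_lattice_basis N e_gt0.
pose P g : 'M[int]_#|gT| := \matrix_(i, j) (enum_val i == enum_val j ^ g^-1)%g%:R.
have valP g v x : (v *m E *m P g) 0 (enum_rank x) = row_val E v (x ^ g^-1)%g.
  rewrite mxE (bigD1 (enum_rank (x ^ g^-1)%g)) //= big1 ?addr0 => [|i ni].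
    by rewrite [P g _ _]mxE !enum_rankK eqxx mulr1.
  rewrite [P g _ _]mxE enum_rankK; case: eqVneq => [Di|]; last by rewrite mulr0.
  by case/eqP: ni; rewrite -Di enum_valK.
have EK t (v w : 'M_(t, d)) : v *m E = w *m E -> v = w.
  by move/eqP; rewrite -subr_eq0 -mulmxBl => /eqP/injE/eqP; rewrite subr_eq0 => /eqP.
have injval (v w : 'rV_d) : row_val E v =1 row_val E w -> v = w.
  move=> vw; apply: EK; apply/rowP=> i; have := vw (enum_val i).
  by rewrite /row_val enum_valK.
have exrho g : exists s : 'M_d, g \in 'N(N)%g -> s *m E = E *m P g.
  have [nNg|] := boolP (g \in 'N(N)%g); last by exists 0.
  have exrow i : exists v : 'rV_d, v *m E = row i (E *m P g).
    have [|v vE] := latE (fun x => row_val E (delta_mx 0 i) (x ^ g^-1)%g).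
      have memJ x : (x ^ g^-1 \in N)%g = (x \in N) by rewrite memJ_norm ?groupV.
      have [hm mN] := EL (delta_mx 0 i); split=> [x y xN yN|x xN].
        by rewrite conjMg hm ?memJ.
      by rewrite mN ?memJ.
    exists v; apply/rowP=> j; have := vE (enum_val j).
    by rewrite -valP rowE mulmxA /row_val enum_valK.
  have [v vE] := fin_all_exists exrow.
  exists (\matrix_i v i) => _; apply/row_matrixP=> i.
  by rewrite row_mul rowK.
have [rho rhoP] := fin_all_exists exrho.
have rhoE g v x : g \in 'N(N)%g -> row_val E (v *m rho g) x = row_val E v (x ^ g^-1)%g.
  by move=> nNg; rewrite /row_val -mulmxA rhoP // mulmxA valP.
have rowK' (A B : 'M[int]_d) : (forall v : 'rV_d, v *m A = v *m B) -> A = B.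
  by move=> AB; apply/row_matrixP=> i; rewrite !rowE.
exists d, E, rho; split => //; split => [|g h nNg nNh].
  apply: rowK' => v; apply: injval => x; rewrite rhoE ?group1 //.
  by rewrite invg1 conjg1 mulmx1.
apply: rowK' => v; apply: injval => x; rewrite mulmxA !rhoE ?groupM //.
by rewrite invMg conjgM.
Qed.

Lemma perm_flatten_map (T S : eqType) (F F' : S -> seq T) r :
  {in r, forall x, perm_eq (F x) (F' x)} ->
  perm_eq (flatten (map F r)) (flatten (map F' r)).
Proof.
elim: r => //= x r IHr FF'; apply: perm_cat; first exact: (FF' x (mem_head _ _)).
by apply: IHr => y yr; apply: FF'; rewrite inE yr orbT.
Qed.

Section InvertibleRep.
Variables (gT : finGroupType) (G : {group gT}) (d : nat) (rho : gT -> 'M[int]_d).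
Hypotheses (rho1 : rho 1%g = 1%:M).
Hypotheses (rhoM : {in G &, forall g h, rho (g * h)%g = rho g *m rho h}).

Local Notation act g := (pair_act (rho g) (rho g^-1%g)).

Definition rep_inv (H : {set gT}) I := forall g, g \in H -> perm_eq (map (act g) I) I.

Definition permutation_index (c : int) :=
  exists I, rep_inv G I /\ \sum_(u <- I) u.2 *m u.1 = c%:M.

Lemma permutation_indexD b c :
  permutation_index b -> permutation_index c -> permutation_index (b + c).
Proof.
move=> [I [invI sumI]] [J [invJ sumJ]]; exists (I ++ J); split=> [g gG|].
  by rewrite map_cat; apply: perm_cat; [apply: invI|apply: invJ].
by rewrite big_cat /= sumI sumJ raddfD.
Qed.

Lemma permutation_indexM b c : permutation_index c -> permutation_index (b * c).
Proof.
move=> [I [invI sumI]]; exists (map (fun u => (u.1, b *: u.2)) I); split=> [g gG|].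
  rewrite -map_comp (eq_map (g := (fun u => (u.1, b *: u.2)) \o act g)).
    by rewrite map_comp; apply/perm_map/invI.
  by move=> u; rewrite /pair_act /= scalemxAr.
rewrite big_map /=; under eq_bigr do rewrite -scalemxAl.
by rewrite -scaler_sumr sumI scale_scalar_mx.
Qed.

Lemma act_mul : {in G &, forall g h u, act (g * h)%g u = act h (act g u)}.
Proof.
by move=> g h gG hG u; rewrite /pair_act /= rhoM // invMg rhoM ?groupV // !mulmxA.
Qed.

Lemma rho_inv g : g \in G -> rho g^-1%g *m rho g = 1%:M.
Proof. by move=> gG; rewrite -rhoM ?groupV // mulVg. Qed.

Lemma permutation_index_transfer (S : {group gT}) c I : S \subset G -> rep_inv S I ->
  \sum_(u <- I) u.2 *m u.1 = c%:M -> permutation_index (#|G : S|%g%:Z * c).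
Proof.
move=> sSG invI sumI.
have reprG X : X \in rcosets S G -> fingroup.repr X \in G /\ X = (S :* fingroup.repr X)%g.
  move=> /rcosetsP[g gG ->]; rewrite rcoset_repr; split => //.
  have := mem_repr_rcoset S g; case/rcosetP=> s sS ->.
  by rewrite groupM // (subsetP sSG).
pose F X := map (act (fingroup.repr X)) I.
exists (flatten (map F (enum (rcosets S G)))); split=> [g gG|]; last first.
  rewrite big_flatten big_map big_enum /=.
  rewrite (eq_bigr (fun _ => c%:M)) ?sumr_const.
    rewrite -[#|_|]/(#|G : S|)%g.
    by rewrite -scaler_nat scale_scalar_mx natz.
  move=> X /reprG[xG _]; rewrite big_map /pair_act /=.
  transitivity (rho (fingroup.repr X)^-1%g *m (\sum_(u <- I) u.2 *m u.1) *m rho (fingroup.repr X)).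
    by rewrite mulmx_sumr mulmx_suml; apply: eq_bigr => u _; rewrite !mulmxA.
  by rewrite sumI -mulmxA mul_scalar_mx -scalemxAr rho_inv // scalemx1.
pose E := enum (rcosets S G).
have gE : perm_eq (map (fun X => X :* g)%g E) E.
  apply: uniq_perm; rewrite ?enum_uniq ?map_inj_uniq ?enum_uniq //; first exact: (can_inj (rcosetK g)).
  move=> X; rewrite mem_enum; apply/mapP/idP => [[Y]|].
    rewrite mem_enum => /rcosetsP[a aG ->] ->; apply/rcosetsP; exists (a * g)%g; rewrite ?groupM //.
    by rewrite rcosetM.
  move=> /rcosetsP[a aG ->]; exists (S :* (a * g^-1))%g.
    by rewrite mem_enum; apply/rcosetsP; exists (a * g^-1)%g; rewrite ?groupM ?groupV.
  by rewrite -rcosetM mulgKV.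
rewrite map_flatten -map_comp.
apply: perm_trans (perm_flatten (perm_map F gE)); rewrite -map_comp.
apply: perm_flatten_map => X; rewrite mem_enum => XE /=.
have [xG DX] := reprG _ XE.
have XgE : (X :* g)%g \in rcosets S G.
  by rewrite -mem_enum -(perm_mem gE); apply: (map_f (fun X => X :* g)%g); rewrite mem_enum.
have [yG DY] := reprG _ XgE.
have [s sS Ds] : exists2 s, s \in S & (fingroup.repr X * g = s * fingroup.repr (X :* g))%g.
  have : (fingroup.repr X * g)%g \in (S :* fingroup.repr (X :* g))%g.
    by rewrite -DY mem_rcoset mulgK {2}DX rcoset_refl.
  by case/rcosetP=> s sS ->; exists s.
have sG : s \in G by apply: (subsetP sSG).
have -> : map (act g) (F X) = map (act (fingroup.repr (X :* g)%g)) (map (act s) I).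
  rewrite /F -!map_comp; apply: eq_map => u.
  transitivity (act (fingroup.repr X * g)%g u); first by rewrite act_mul.
  by rewrite Ds act_mul.
by apply/perm_map/invI.
Qed.

Hypothesis coflab : forall g r (v : 'rV_d), g \in G -> (g ^+ r)%g = 1%g -> (0 < r)%N ->
  v *m (\sum_(i < r) rho (g ^+ i)%g) = 0 -> exists w, v = w *m (rho g - 1%:M).

Lemma rhoX g i : g \in G -> rho (g ^+ i)%g = rho g ^+ i.
Proof.
move=> gG; elim: i => [|i IHi]; first by rewrite expg0 expr0 rho1.
by rewrite expgSr rhoM ?groupX // IHi mxexprSr.
Qed.

Lemma permutation_index_prime p : Zgroup G -> prime p ->
  exists2 c, permutation_index c & ~~ (p %| c)%Z.
Proof.
move=> ZG pr_p; have [S sylS] := Sylow_exists p G.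
have /cyclicP[x Sx] : cyclic S by have /forall_inP := ZG; apply; apply/SylowP; exists p.
have sSG : S \subset G := pHall_sub sylS.
have xG : x \in G by rewrite (subsetP sSG) // Sx cycle_id.
have [n ox] : exists n, #[x]%g = (p ^ n)%N.
  by exists (logn p #|G|); rewrite orderE -Sx (card_Hall sylS) p_part.
have xn1 : (x ^+ (p ^ n) = 1)%g by rewrite -ox expg_order.
have [||||c [I [cp invI sumI]]] := @lattice_invertible p n d (rho x) (rho x^-1%g) pr_p.
- by rewrite -[LHS]/(rho x *m rho x^-1%g) -rhoM ?groupV // mulgV rho1.
- exact: rho_inv.
- by rewrite -rhoX // xn1 rho1.
- move=> j v lejn; under eq_bigr do rewrite exprM -(rhoX (p ^ j)) // -rhoX ?groupX //.
  move/(coflab (groupX _ xG)); rewrite -expgM -expnD subnKC // xn1 expn_gt0 prime_gt0 //.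
  by case=> // w ->; exists w; rewrite rhoX.
exists (#|G : S|%g%:Z * c).
  apply: (permutation_index_transfer (I := I)) => // g; rewrite Sx => /cycleP[i ->].
  elim: i => [|i IHi].
    rewrite expg0 invg1 map_id_in // => u _; rewrite /pair_act rho1.
    by rewrite mulmx1 mul1mx; case: u.
  rewrite (eq_map (g := act x \o act (x ^+ i)%g)); last first.
    by move=> u; rewrite expgSr act_mul ?groupX.
  by rewrite map_comp; apply: perm_trans invI; apply: perm_map.
rewrite dvdzE abszM Euclid_dvdM // negb_or [X in _ && X]cp andbT /=.
by have /and3P[_ _] := sylS; rewrite p'natE.
Qed.

Lemma exists_permutation_index1 : Zgroup G -> permutation_index 1.
Proof.
move=> ZG; have key := fun p => @permutation_index_prime p ZG.
suff H n : (0 < n)%N -> permutation_index n%:Z -> permutation_index 1.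
  have [c Jc cp] := key 2 isT.
  apply: (H `|c|%N); last by rewrite abszE normrEsg; apply: permutation_indexM.
  by rewrite absz_gt0; apply: contraNneq cp => ->; rewrite dvdz0.
elim/ltn_ind: n => n IHn n_gt0 Jn.
have [n1|n_neq1] := eqVneq n 1%N; first by rewrite n1 in Jn.
have pr_p := pdiv_prime (_ : 1 < n)%N; have {}pr_p := pr_p (ltac:(by rewrite ltn_neqAle eq_sym n_neq1)).
have [c Jc cp] := key _ pr_p.
have [u [v Duv]] := Bezoutz n c.
have Jg : permutation_index (gcdz n c).
  by rewrite -Duv; apply: permutation_indexD; apply: permutation_indexM.
have g_gt0 : (0 < gcdn n `|c|)%N by rewrite gcdn_gt0 n_gt0.
apply: (IHn _ _ g_gt0 Jg); rewrite ltn_neqAle dvdn_leq ?dvdn_gcdl // andbT.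
apply: contraNneq cp => gn; rewrite dvdzE /= (dvdn_trans (pdiv_dvd n)) // -{1}gn dvdn_gcdr //.
Qed.
End InvertibleRep.

Lemma weight_lattice_invertible (gT : finGroupType) (N G : {group gT}) (e : nat) :
  (0 < e)%N -> abelian N -> (exponent N %| e)%N -> G \subset 'N(N)%g -> Zgroup G ->
  exists d (E : 'M[int]_(d, #|gT|)) (rho : gT -> 'M[int]_d) I,
    [/\ forall v, weight_lattice N e (row_val E v),
        forall m, weight_lattice N e m -> exists v, forall x, row_val E v x = m x,
        forall v w : 'rV_d, row_val E v =1 row_val E w -> v = w,
        forall g v x, g \in G -> row_val E (v *m rho g) x = row_val E v (x ^ g^-1)%g &
        rep_inv rho G I /\ \sum_(u <- I) u.2 *m u.1 = 1%:M].
Proof.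
move=> e_gt0 cNN expN nNG ZG.
have [d [E [rho [EL latE injE rhoE [rho1 rhoM]]]]] := weight_lattice_rep N e_gt0.
have rhoMG : {in G &, forall g h, rho (g * h)%g = rho g *m rho h}.
  by move=> g h gG hG; apply: rhoM; apply: (subsetP nNG).
have [|I [invI sumI]] := exists_permutation_index1 rho1 rhoMG _ ZG; last first.
  exists d, E, rho, I; split => // g v x gG; apply: rhoE; exact: (subsetP nNG).
have row_val0 x : row_val E 0 x = 0 by rewrite /row_val mul0mx mxE.
have row_val_sum n (F : 'I_n -> 'rV_d) x :
    row_val E (\sum_i F i) x = \sum_i row_val E (F i) x.
  apply: (big_morph (fun v => row_val E v x)) => // u v; exact: row_valD.
move=> g r v gG gr1 r_gt0 v0; have nNg := subsetP nNG g gG.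
have [|||w Lw wE] := weight_lattice_coflabby e_gt0 cNN expN (g := g^-1%g) (r := r)
  (m := row_val E v) _ _ r_gt0 (EL v).
- by rewrite groupV.
- by rewrite expgVn gr1 invg1.
- move=> x; rewrite -[RHS](row_val0 x) -v0 mulmx_sumr row_val_sum.
  by apply: eq_bigr => i _; rewrite rhoE ?groupX // expgVn.
have [u uE] := latE w Lw; exists u; apply: injE => x.
rewrite mulmxBr mulmx1 row_valD rhoE // wE -!uE.
by congr (_ + _); rewrite /row_val mulNmx [RHS]mxE.
Qed.

Definition infinite_type (k : eqType) := forall s : seq k, exists x : k, x \notin s.

Lemma poly_nonroot (k F : fieldType) (iota : {rmorphism k -> F}) (u : {poly F}) :
  infinite_type k -> u != 0 -> exists c, u.[iota c] != 0.
Proof.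
move=> inf_k nzu.
have [s us szs] : exists2 s : seq k, uniq s & size s = size u.
  elim: (size u) => [|n [s us szs]]; first by exists [::].
  by have [x xs] := inf_k s; exists (x :: s); rewrite /= ?xs ?szs.
apply: NNPP => nc.
have: all (root u) (map iota s).
  apply/allP=> _ /mapP[c _ ->]; apply: contraT => nr; case: nc.
  by exists c; apply: contraNneq nr => /eqP.
move/(max_poly_roots nzu); rewrite map_inj_uniq ?us; last exact: fmorph_inj.
by rewrite size_map szs ltnn => /(_ isT).
Qed.

Lemma base_expansion_inj B n (a b : 'I_n -> nat) :
  (forall i, a i < B)%N -> (forall i, b i < B)%N ->
  (\sum_i a i * B ^ i = \sum_i b i * B ^ i)%N -> a =1 b.
Proof.
elim: n a b => [|n IHn] a b aB bB E i; first by case: i.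
have E' (c : 'I_n.+1 -> nat) : (\sum_i c i * B ^ i =
    (\sum_i c (lift ord0 i) * B ^ i) * B + c ord0)%N.
  rewrite big_ord_recl expn0 muln1 addnC big_distrl; congr (_ + _)%N.
  by apply: eq_bigr => j _; rewrite /= /bump add1n expnSr mulnA.
rewrite !E' in E.
have E0 : a ord0 = b ord0.
  by have := congr1 (modn^~ B) E; rewrite !modnMDl !modn_small.
have B_gt0 : (0 < B)%N by apply: leq_ltn_trans (aB ord0).
have E1 : (\sum_i a (lift ord0 i) * B ^ i = \sum_i b (lift ord0 i) * B ^ i)%N.
  by have := congr1 (divn^~ B) E; rewrite !divnMDl // !divn_small // !addn0.
have [j ->|->//] := unliftP ord0 i.
exact: (IHn (fun j => a (lift ord0 j)) (fun j => b (lift ord0 j))).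
Qed.

(* Kronecker substitution. *)
Lemma mpoly_univariate (F : fieldType) n (P : {mpoly F[n]}) : P != 0 ->
  exists B, exists2 u : {poly F}, u != 0 &
    forall z, P.@[fun i => z ^+ (B ^ i)] = u.[z].
Proof.
move=> nzP; pose B := msize P.
have ltB m i : m \in msupp P -> (m i < B)%N.
  move=> mP; apply: leq_ltn_trans (msize_mdeg_lt mP).
  by rewrite mdegE (bigD1 i) //= leq_addr.
pose code (m : 'X_{1..n}) := (\sum_i m i * B ^ i)%N.
pose u : {poly F} := \sum_(m <- msupp P) P@_m *: 'X^(code m).
exists B, u => [|z]; last first.
  rewrite mevalE /u horner_sum; apply: eq_bigr => m _.
  rewrite hornerZ hornerXn -prodrXr; congr (_ * _).
  by apply: eq_bigr => i _; rewrite -exprM mulnC.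
have [m0 m0P] : exists m0, m0 \in msupp P.
  case: (msupp P) (msupp_eq0 P) => [|m s _]; first by rewrite eqxx (negPf nzP).
  by exists m; rewrite mem_head.
have E : u`_(code m0) = P@_m0.
  rewrite /u coef_sum (bigD1_seq m0) ?msupp_uniq //= coefZ coefXn eqxx mulr1.
  rewrite big_seq_cond big1 ?addr0 // => m /andP[mP nm].
  rewrite coefZ coefXn; case: eqVneq => [cE|_]; last by rewrite mulr0.
  case/eqP: nm; apply/mnmP => i.
  apply: (base_expansion_inj (B := B) (a := m) (b := m0)) => [j|j|]; rewrite ?ltB //.
have : P@_m0 != 0 by rewrite -mcoeff_msupp.
by apply: contraNneq => u0; rewrite -E u0 coef0.
Qed.

Lemma mpoly_nonroot (k F : fieldType) (iota : {rmorphism k -> F}) n (P : {mpoly F[n]}) :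
  infinite_type k -> P != 0 -> exists c : 'I_n -> k, P.@[fun i => iota (c i)] != 0.
Proof.
move=> inf_k /mpoly_univariate[B [u nzu uE]].
have [c nz] := poly_nonroot iota inf_k nzu.
exists (fun i => c ^+ (B ^ i)).
by rewrite -uE in nz; rewrite (meval_eq _ (v2 := fun i => iota c ^+ (B ^ i))) // => i; rewrite rmorphXn.
Qed.

(* Any nonzero functional fails to vanish at some vector of Y, so Y spans. *)
Lemma spanning_unitmx (F : fieldType) n (Y : 'rV[F]_n -> Prop) :
  (forall v : 'cV_n, v != 0 -> exists2 y, Y y & y *m v != 0) ->
  exists2 M : 'M_n, M \in unitmx & forall i, Y (row i M).
Proof.
move=> spanY; suff H r : (r <= n)%N -> exists2 M : 'M_(r, n), row_free M & forall i, Y (row i M).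
  have [M fM YM] := H n (leqnn _); exists M => //.
  by rewrite -row_free_unit.
elim: r => [|r IHr] ltrn.
  by exists 0 => [|[]//]; rewrite /row_free mxrank0.
have [M fM YM] := IHr (ltnW ltrn).
have [v nzv Mv0] : exists2 v : 'cV_n, v != 0 & M *m v = 0.
  have nzK : (kermx M^T) != 0.
    by rewrite -mxrank_eq0 mxrank_ker mxrank_tr (eqP fM) -lt0n subn_gt0.
  have /rowV0Pn[w /sub_kermxP wM nzw] := nzK.
  exists w^T; first by rewrite -trmx0 (inj_eq trmx_inj).
  by rewrite -[M]trmxK -trmx_mul wM trmx0.
have [y Yy yv] := spanY v nzv.
exists (col_mx y M : 'M_(1 + r, n)) => [|i]; last first.
  have [j ->|j ->] := @split_ordP 1 r i.
    have E : row (lshift r j) (col_mx y M) = y by rewrite rowKu row_id.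
    by move: Yy; rewrite -{1}E.
  have E : row (rshift 1 j) (col_mx y M) = row j M by rewrite rowKd.
  by move: (YM j); rewrite -E.
rewrite /row_free eqn_leq rank_leq_row /=.
have sM : (M <= col_mx y M)%MS by rewrite -addsmxE addsmxSr.
rewrite -{1}(eqP fM) (ltn_leqif (mxrank_leqif_sup sM)) col_mx_sub submx_refl andbT.
by apply: contra yv => /submxP[w ->]; rewrite -mulmxA Mv0 mulmx0.
Qed.

Section FractionExtension.
Variable R : idomainType.

Lemma fraction_numden (z : {fraction R}) :
  z = (\n_(repr z))%:F / (\d_(repr z))%:F.
Proof.
have nzd : (\d_(repr z))%:F != 0 :> {fraction R} by rewrite tofrac_eq0 denom_ratioP.
apply: (mulIf nzd); rewrite divfK //.
rewrite -{1}[z]reprK; set x := repr z.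
rewrite !piE; apply/eqmodP; rewrite /= FracField.equivfE /FracField.mulf.
rewrite !numden_Ratio ?mulf_neq0 ?denom_ratioP ?oner_neq0 //.
by rewrite !mulr1 mulrC.
Qed.

Variables (F : fieldType) (h : {rmorphism R -> F}).
Hypothesis inj_h : injective h.

Definition fraction_map (z : {fraction R}) : F := h \n_(repr z) / h \d_(repr z).

Let hd0 d : d != 0 -> h d != 0.
Proof. by move=> nzd; rewrite -(rmorph0 h) (inj_eq inj_h). Qed.

Lemma fraction_mapE n d : d != 0 -> fraction_map (n%:F / d%:F) = h n / h d.
Proof.
move=> nzd; rewrite /fraction_map; set z := (n%:F / d%:F : {fraction R}).
have nzd' : \d_(repr z) != 0 by apply: denom_ratioP.
have := fraction_numden z; rewrite {1}/z => /eqP.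
rewrite eqr_div ?tofrac_eq0 // -!tofracM tofrac_eq => /eqP E.
by apply/eqP; rewrite eqr_div ?hd0 // -!rmorphM E mulrC.
Qed.

Lemma fraction_map_tofrac x : fraction_map x%:F = h x.
Proof. by rewrite -[x%:F]divr1 -tofrac1 fraction_mapE ?oner_neq0 // rmorph1 divr1. Qed.

Fact fraction_map_is_zmod_morphism : zmod_morphism fraction_map.
Proof.
move=> x y; rewrite (fraction_numden x) (fraction_numden y).
set nx := \n_ _; set dx := \d_ _; set ny := \n_ _; set dy := \d_ _.
have nzx : dx != 0 by apply: denom_ratioP.
have nzy : dy != 0 by apply: denom_ratioP.
have -> : nx%:F / dx%:F - ny%:F / dy%:F = (nx * dy - ny * dx)%:F / (dx * dy)%:F.
  by rewrite -mulNr addf_div ?tofrac_eq0 // mulNr -!tofracM -tofracB.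
rewrite !fraction_mapE ?mulf_neq0 // rmorphB !rmorphM.
by rewrite -[in RHS]mulNr addf_div ?hd0 // mulNr.
Qed.

Fact fraction_map_is_monoid_morphism : monoid_morphism fraction_map.
Proof.
split=> [|x y]; first by rewrite -tofrac1 fraction_map_tofrac rmorph1.
rewrite (fraction_numden x) (fraction_numden y).
set nx := \n_ _; set dx := \d_ _; set ny := \n_ _; set dy := \d_ _.
have nzx : dx != 0 by apply: denom_ratioP.
have nzy : dy != 0 by apply: denom_ratioP.
have -> : nx%:F / dx%:F * (ny%:F / dy%:F) = (nx * ny)%:F / (dx * dy)%:F.
  by rewrite !rmorphM /= mulf_div.
by rewrite !fraction_mapE ?mulf_neq0 // !rmorphM mulf_div.
Qed.

HB.instance Definition _ := GRing.isZmodMorphism.Build _ _ fraction_map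
  fraction_map_is_zmod_morphism.
HB.instance Definition _ := GRing.isMonoidMorphism.Build _ _ fraction_map
  fraction_map_is_monoid_morphism.

Lemma fraction_extension :
  exists h' : {rmorphism {fraction R} -> F}, forall x, h' x%:F = h x.
Proof. by exists fraction_map; apply: fraction_map_tofrac. Qed.
End FractionExtension.

Lemma fraction_extension_family (R : idomainType) (F : fieldType) T (h : T -> {rmorphism R -> F}) :
  (forall t, injective (h t)) ->
  exists h' : T -> {rmorphism {fraction R} -> F}, forall t x, h' t x%:F = h t x.
Proof.
move=> inj_h.
have ex t := constructive_indefinite_description _ (fraction_extension (inj_h t)).
by exists (fun t => sval (ex t)) => t x; case: (ex t).
Qed.

Record is_subfield (F : fieldType) (E : F -> Prop) : Prop := IsSubfield {
  subfield1 : E 1;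
  subfieldB : forall x y, E x -> E y -> E (x - y);
  subfieldM : forall x y, E x -> E y -> E (x * y);
  subfieldV : forall x, E x -> E x^-1 }.

Section SubfieldTheory.
Variables (F : fieldType) (E : F -> Prop).
Hypothesis sE : is_subfield E.

Lemma subfield0 : E 0. Proof. by rewrite -(subrr 1); apply: subfieldB => //; apply: subfield1. Qed.
Lemma subfieldN x : E x -> E (- x).
Proof. by move=> Ex; rewrite -sub0r; apply: subfieldB => //; apply: subfield0. Qed.
Lemma subfieldD x y : E x -> E y -> E (x + y).
Proof. by move=> Ex Ey; rewrite -[y]opprK; apply: subfieldB => //; apply: subfieldN. Qed.
Lemma subfield_div x y : E x -> E y -> E (x / y).
Proof. by move=> Ex Ey; apply: subfieldM => //; apply: subfieldV. Qed.
Lemma subfieldX x n : E x -> E (x ^+ n).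
Proof.
move=> Ex; elim: n => [|n IHn]; first by rewrite expr0; apply: subfield1.
by rewrite exprS; apply: subfieldM.
Qed.
Lemma subfield_sum I (r : seq I) (P : pred I) (f : I -> F) :
  (forall i, P i -> E (f i)) -> E (\sum_(i <- r | P i) f i).
Proof. by move=> Ef; apply: big_ind => //; [apply: subfield0|apply: subfieldD]. Qed.
Lemma subfield_prod I (r : seq I) (P : pred I) (f : I -> F) :
  (forall i, P i -> E (f i)) -> E (\prod_(i <- r | P i) f i).
Proof. by move=> Ef; apply: big_ind => //; [apply: subfield1|apply: subfieldM]. Qed.
End SubfieldTheory.

(* The group G acts on the subfield E of F through endomorphisms of the ambient
   field F, which need not compose like elements of G outside E. *)
Record gfield (k : fieldType) (gT : finGroupType) (G : {group gT}) (F : fieldType)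
    (iota : {rmorphism k -> F}) (E : F -> Prop) (b : gT -> {rmorphism F -> F}) : Prop :=
  GField {
  gf_sub : is_subfield E;
  gf_k : forall c, E (iota c);
  gf_act : forall g x, g \in G -> E x -> E (b g x);
  gf_mul : forall g h x, g \in G -> h \in G -> E x -> b (g * h)%g x = b g (b h x);
  gf_const : forall g c, g \in G -> b g (iota c) = iota c;
  gf_faithful : forall g, g \in G -> (forall x, E x -> b g x = x) -> g = 1%g }.

Section GFieldTheory.
Variables (k : fieldType) (gT : finGroupType) (G : {group gT}) (F : fieldType).
Variables (iota : {rmorphism k -> F}) (E : F -> Prop) (b : gT -> {rmorphism F -> F}).
Hypothesis gfE : gfield G iota E b.

Lemma gf_act1 x : E x -> b 1%g x = x.
Proof.
move=> Ex; apply: (fmorph_inj (b 1%g)).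
by rewrite -(gf_mul gfE) ?mulg1 ?group1.
Qed.

Lemma gf_actV g x : g \in G -> E x -> b g^-1%g (b g x) = x.
Proof. by move=> gG Ex; rewrite -(gf_mul gfE) ?groupV // mulVg gf_act1. Qed.

Lemma gf_eq g h : g \in G -> h \in G -> (forall x, E x -> b g x = b h x) -> g = h.
Proof.
move=> gG hG gh; apply/eqP; rewrite eq_sym eq_mulVg1 eq_sym; apply/eqP/esym.
apply: (gf_faithful gfE) => [|x Ex]; first by rewrite groupM ?groupV.
by rewrite (gf_mul gfE) ?groupV // gh // gf_actV.
Qed.

Lemma dedekind_independence (c : gT -> F) :
  (forall x, E x -> \sum_(g in G) c g * b g x = 0) -> forall g, g \in G -> c g = 0.
Proof.
have [n] := ubnP #|[pred g in G | c g != 0]|; elim: n c => // n IHn c lecn c0 g0 g0G.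
apply/eqP; apply: contraT => nzc0.
have c1 g1 : g1 \in G -> g1 != g0 -> c g1 = 0.
  move=> g1G ne10; apply/eqP; apply: contraT => nzc1.
  case/eqP: ne10; apply: gf_eq => // y Ey.
  pose c' g := c g * (b g y - b g0 y).
  suff /(_ g1 g1G)/eqP : forall g, g \in G -> c' g = 0.
    by rewrite mulf_eq0 (negPf nzc1) subr_eq0 => /eqP.
  apply: IHn => [|x Ex].
    rewrite -ltnS; apply: leq_trans lecn; rewrite ltnS; apply: proper_card.
    apply/properP; split; last first.
      by exists g0; rewrite !inE ?g0G ?nzc0 // /c' subrr mulr0 eqxx andbF.
    apply/subsetP=> g; rewrite !inE => /andP[-> /=]; apply: contraNneq => c00.
    by rewrite /c' c00 mul0r.
  have Eyx : E (y * x) by apply: (subfieldM (gf_sub gfE)).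
  transitivity (\sum_(g in G) c g * b g (y * x) - b g0 y * \sum_(g in G) c g * b g x).
    rewrite mulr_sumr -sumrB; apply: eq_bigr => g _; rewrite rmorphM /c'; ring.
  by rewrite !c0 // mulr0 subrr.
have := c0 1 (subfield1 (gf_sub gfE)); rewrite (bigD1 g0) //= big1 ?addr0.
  by rewrite rmorph1 mulr1 => /eqP; rewrite (negPf nzc0).
by move=> g /andP[gG ne]; rewrite c1 // mul0r.
Qed.
End GFieldTheory.

Section EquivariantFunctions.
Variables (k : fieldType) (gT : finGroupType) (G : {group gT}) (F : fieldType).
Variables (iota : {rmorphism k -> F}) (E : F -> Prop) (b : gT -> {rmorphism F -> F}).
Hypothesis gfE : gfield G iota E b.
Variables (T : eqType) (ga : gT -> T -> T) (chi : gT -> T -> k).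
Hypothesis ga1 : forall t, ga 1%g t = t.
Hypothesis gaM : forall g h t, g \in G -> h \in G -> ga (g * h)%g t = ga g (ga h t).
Hypothesis chi_neq0 : forall g t, g \in G -> chi g t != 0.
Hypothesis chiM : forall g h t, g \in G -> h \in G ->
  chi (g * h)%g t = chi g (ga h t) * chi h t.

Definition equivariant (y : T -> F) :=
  (forall t, E (y t)) /\
  (forall g t, g \in G -> b g (y t) = iota (chi g t) * y (ga g t)).

Lemma equivariant_average (th : T -> F) : (forall t, E (th t)) ->
  equivariant (fun t => \sum_(g in G)
    iota (chi g (ga g^-1%g t))^-1 * b g (th (ga g^-1%g t))).
Proof.
move=> Eth; have sE := gf_sub gfE; split=> [t|h t hG].
  apply: subfield_sum => // g gG; apply: subfieldM => //; first exact: (gf_k gfE).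
  exact: (gf_act gfE).
rewrite rmorph_sum mulr_sumr.
rewrite [RHS](reindex_inj (mulgI h)) [RHS](eq_bigl (fun g => g \in G)) => [|g]; last exact: groupMl.
apply: eq_bigr => g gG; rewrite rmorphM (gf_const gfE) // -(gf_mul gfE) //.
have -> : ga (h * g)^-1%g (ga h t) = ga g^-1%g t.
  by rewrite -gaM ?groupV ?groupM // invMg mulgKV.
rewrite mulrA -rmorphM chiM // -gaM ?groupV // mulgV ga1 invfM mulrA divff ?mul1r //.
exact: chi_neq0.
Qed.

Lemma equivariantZ c y : equivariant y -> equivariant (fun t => iota c * y t).
Proof.
move=> [Ey by_]; split=> [t|g t gG].
  by apply: (subfieldM (gf_sub gfE)) => //; apply: (gf_k gfE).
by rewrite rmorphM by_ // (gf_const gfE) // mulrCA.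
Qed.

Lemma equivariant_sum n (c : 'I_n -> k) (y : 'I_n -> T -> F) :
  (forall i, equivariant (y i)) -> equivariant (fun t => \sum_i iota (c i) * y i t).
Proof.
move=> yE; split=> [t|g t gG].
  by apply: (subfield_sum (gf_sub gfE)) => i _; case: (equivariantZ (c i) (yE i)).
rewrite rmorph_sum mulr_sumr; apply: eq_bigr => i _.
by case: (equivariantZ (c i) (yE i)) => _; apply.
Qed.

Lemma equivariant_spanning n (t : 'I_n -> T) (v : 'cV[F]_n) : injective t -> v != 0 ->
  exists2 y, equivariant y & \sum_i y (t i) * v i 0 != 0.
Proof.
move=> inj_t nzv; have sE := gf_sub gfE.
have [i0 nzi] : exists i, v i 0 != 0.
  apply/existsP; apply: contraR nzv => /existsPn v0; apply/eqP/colP=> i.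
  by have := v0 i; rewrite negbK mxE => /eqP.
pose th (x : F) s := if s == t i0 then x else 0.
pose c g := \sum_(i | ga g^-1%g (t i) == t i0) v i 0 * iota (chi g (t i0))^-1.
have [x Ex nzx] : exists2 x, E x & \sum_(g in G) c g * b g x != 0.
  apply: NNPP => nx; have c0 : forall g, g \in G -> c g = 0.
    apply: (dedekind_independence gfE) => x Ex; apply/eqP/negPn/negP => nz.
    by apply: nx; exists x.
  have := c0 1%g (group1 G); rewrite /c invg1 (bigD1 i0) ?ga1 //= big1 => [|i /andP[]].
    rewrite addr0 => /eqP; rewrite mulf_eq0 (negPf nzi) /= fmorph_eq0 invr_eq0.
    by rewrite (negPf (chi_neq0 _ _)) ?group1.
  by rewrite ga1 => /eqP/inj_t -> /eqP.
have Eth s : E (th x s) by rewrite /th; case: ifP => _ //; apply: subfield0.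
exists (fun s => \sum_(g in G) iota (chi g (ga g^-1%g s))^-1 * b g (th x (ga g^-1%g s))).
  exact: equivariant_average.
apply: contraNneq nzx => E0; apply/eqP; rewrite -[RHS]E0.
under [RHS]eq_bigr do rewrite mulr_suml.
rewrite exchange_big /=; apply: eq_bigr => g gG.
rewrite /c mulr_suml big_mkcond /=; apply: eq_bigr => i _.
rewrite /th; case: eqP => [->|_]; last by rewrite rmorph0 mulr0 mul0r.
by rewrite [RHS]mulrC mulrA.
Qed.

Lemma equivariant_unitmx n (t : 'I_n -> T) : injective t ->
  exists2 y : 'I_n -> T -> F, forall j, equivariant (y j) &
    \matrix_(j, i) y j (t i) \in unitmx.
Proof.
move=> inj_t.
have [v nzv|M uM YM] := @spanning_unitmx F n
    (fun r => exists2 y, equivariant y & r = \row_i y (t i)).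
  have [y yE nz] := equivariant_spanning inj_t nzv.
  exists (\row_i y (t i)); first by exists y.
  apply: contraNneq nz => /matrixP/(_ 0 0); rewrite !mxE => E0.
  by rewrite -[X in _ == X]E0; apply/eqP/eq_bigr => i _; rewrite mxE.
have [y yP] := fin_all_exists (fun j => let: ex_intro2 y yE ry := YM j in
  ex_intro (fun y => equivariant y /\ row j M = \row_i y (t i)) y (conj yE ry)).
exists y => [j|]; first by case: (yP j).
suff -> : \matrix_(j, i) y j (t i) = M by [].
by apply/row_matrixP=> j; have [_ ->] := yP j; apply/rowP=> i; rewrite !mxE.
Qed.

Lemma equivariant_dense n (t : 'I_n -> T) (P : {mpoly F[n]}) : infinite_type k ->
  injective t -> P != 0 -> exists2 y, equivariant y & P.@[fun i => y (t i)] != 0.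
Proof.
move=> inf_k inj_t nzP; have [y yE uM] := equivariant_unitmx inj_t.
set M := \matrix_(j, i) _ in uM.
pose P' := P \mPo [tuple \sum_j M j i *: 'X_j | i < n].
have P'E w : P'.@[w] = P.@[fun i => \sum_j w j * M j i].
  rewrite comp_mpoly_meval; apply: meval_eq => i; rewrite tnth_mktuple.
  rewrite raddf_sum /=; apply: eq_bigr => j _.
  by rewrite mevalZ mevalXU mulrC.
have nzP' : P' != 0.
  have [c nz] := mpoly_nonroot iota inf_k nzP.
  pose w := (\row_i iota (c i)) *m invmx M.
  apply: contraNneq nz => P'0.
  have := P'E (fun j => w 0 j); rewrite P'0 meval0 => ->.
  apply/eqP/meval_eq => i; have /rowP/(_ i) := mulmxKV uM (\row_i iota (c i)).
  by rewrite !mxE => <-; apply: eq_bigr.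
have [c nz] := mpoly_nonroot iota inf_k nzP'.
exists (fun s => \sum_j iota (c j) * y j s); first exact: equivariant_sum.
rewrite P'E in nz; apply: contraNneq nz => E0; rewrite -[X in _ == X]E0; apply/eqP/meval_eq => i.
by apply: eq_bigr => j _; rewrite mxE.
Qed.
End EquivariantFunctions.

Lemma equivariant_basis (k : fieldType) (gT : finGroupType) (G : {group gT}) (F : fieldType)
    (iota : {rmorphism k -> F}) E b (ga : gT -> gT -> gT) : gfield G iota E b ->
  (forall x, ga 1%g x = x) -> (forall g h x, ga (g * h)%g x = ga g (ga h x)) ->
  exists y : 'I_#|gT| -> gT -> F,
    [/\ forall j x, E (y j x), forall j g x, g \in G -> b g (y j x) = y j (ga g x) &
        \matrix_(j, i < #|gT|) y j (enum_val i) \in unitmx].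
Proof.
move=> gfE ga1 gaM.
have inj_t : injective (fun i : 'I_#|gT| => enum_val i) by apply: enum_val_inj.
have chi1 (g x : gT) : g \in G -> (1 : k) != 0 by rewrite oner_neq0.
have chiM (g h x : gT) : g \in G -> h \in G -> (1 : k) = 1 * 1 by rewrite mulr1.
have gaM' (g h x : gT) : g \in G -> h \in G -> ga (g * h)%g x = ga g (ga h x) by [].
have [y yE uM] := equivariant_unitmx gfE ga1 gaM' chi1 chiM inj_t.
exists y; split=> // [j x|j g x gG]; first by case: (yE j).
by rewrite (yE j).2 // rmorph1 mul1r.
Qed.

Section SemilinearSubstitution.
Variables (K : fieldType) (n : nat).

Definition semilinear_subst (f : {rmorphism K -> K}) (c : 'I_n -> K) (s : 'S_n)
    (p : {mpoly K[n]}) : {mpoly K[n]} :=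
  mmap (@mpolyC n K \o f) (fun i => c i *: 'X_(s i)) p.

Variables (f : {rmorphism K -> K}) (c : 'I_n -> K) (s : 'S_n).
Local Notation sub := (semilinear_subst f c s).

Fact semilinear_subst_is_zmod_morphism : zmod_morphism sub.
Proof. by move=> p q; apply: raddfB. Qed.

Fact semilinear_subst_is_monoid_morphism : monoid_morphism sub.
Proof. by split=> [|p q]; [apply: rmorph1|apply: rmorphM]. Qed.

HB.instance Definition _ := GRing.isZmodMorphism.Build _ _ sub
  semilinear_subst_is_zmod_morphism.
HB.instance Definition _ := GRing.isMonoidMorphism.Build _ _ sub
  semilinear_subst_is_monoid_morphism.

Lemma mcoeff_semilinear_subst p m :
  (sub p)@_m = (\prod_i c i ^+ m (s i)) * f p@_([multinom m (s i) | i < n]).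
Proof.
set m0 := [multinom _ | _ < _].
have mm1 m' : mmap1 (fun i => c i *: 'X_(s i)) m' =
    (\prod_i c i ^+ m' i) *: 'X_[[multinom m' (s^-1%g i) | i < n]] :> {mpoly K[n]}.
  rewrite /mmap1; rewrite (eq_bigr (fun i => (c i ^+ m' i) *: ('X_(s i) ^+ m' i : {mpoly K[n]}))) => [|i _]; last exact: exprZn.
  rewrite scaler_prod; congr (_ *: _); rewrite [RHS]mpolyXE_id.
  rewrite [RHS](reindex_perm s) /=; apply: eq_bigr => i _.
  by rewrite mnmE permK.
have cm m' : (mmap1 (fun i => c i *: 'X_(s i)) m' : {mpoly K[n]})@_m =
    (\prod_i c i ^+ m' i) * (m' == m0)%:R.
  rewrite mm1 mcoeffZ mcoeffX; congr (_ * (nat_of_bool _)%:R).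
  apply/eqP/eqP => [E|->]; apply/mnmP=> i; first by rewrite /m0 -E !mnmE permK.
  by rewrite !mnmE permKV.
rewrite /semilinear_subst /mmap raddf_sum /=.
under eq_bigr do rewrite mcoeffCM cm.
have [m0p|m0p] := boolP (m0 \in msupp p); last first.
  have -> : p@_m0 = 0 by apply: memN_msupp_eq0.
  rewrite rmorph0 mulr0 big_seq [LHS]big1 // => m' m'p; case: eqVneq => [E|]; last by rewrite !mulr0.
  by rewrite -E m'p in m0p.
rewrite (bigD1_seq m0) ?msupp_uniq //= eqxx mulr1 [X in _ + X]big1 ?addr0 => [|m' nm]; last by rewrite (negPf nm) !mulr0.
by rewrite mulrC; congr (_ * _); apply: eq_bigr => i _; rewrite mnmE.
Qed.

Lemma semilinear_subst_inj : (forall i, c i != 0) -> injective sub.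
Proof.
move=> nzc; apply: raddf_inj => p p0; apply/mpolyP=> m; rewrite mcoeff0.
pose m' := [multinom m (s^-1%g i) | i < n].
have := congr1 (fun q => q@_m') p0; rewrite mcoeff_semilinear_subst mcoeff0 => /eqP.
rewrite mulf_eq0 fmorph_eq0 => /orP[/eqP E0|/eqP <-]; last first.
  by congr (_@__); apply/mnmP=> i; rewrite !mnmE permK.
have /eqP[] : \prod_i c i ^+ m' (s i) != 0 by apply/prodf_neq0 => i _; apply: expf_neq0.
exact: E0.
Qed.
End SemilinearSubstitution.

Section Composition.
Variables (K : fieldType).

Lemma comp_mpolyA n m l (p : {mpoly K[n]}) (f : n.-tuple {mpoly K[m]})
    (g : m.-tuple {mpoly K[l]}) :
  (p \mPo f) \mPo g = p \mPo [tuple tnth f i \mPo g | i < n].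
Proof.
elim/mpolyind: p => [|c m' p _ _ IHp]; first by rewrite !comp_mpoly0.
rewrite !comp_mpolyD IHp !comp_mpolyZ; congr (_ *: _ + _).
rewrite !comp_mpolyX rmorph_prod; apply: eq_bigr => i _.
by rewrite rmorphXn tnth_mktuple.
Qed.

Definition linear_subst n m (A : 'M[K]_(n, m)) : n.-tuple {mpoly K[m]} :=
  [tuple \sum_j A i j *: 'X_j | i < n].

Lemma linear_subst_comp n m l (A : 'M[K]_(n, m)) (B : 'M_(m, l)) (p : {mpoly K[n]}) :
  (p \mPo linear_subst A) \mPo linear_subst B = p \mPo linear_subst (A *m B).
Proof.
rewrite comp_mpolyA; congr (_ \mPo _); apply: eq_from_tnth => i.
rewrite !tnth_mktuple raddf_sum /=; under eq_bigr => j _.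
  rewrite comp_mpolyZ comp_mpolyXU -tnth_nth tnth_mktuple scaler_sumr; over.
rewrite exchange_big; apply: eq_bigr => j _ /=.
by rewrite mxE scaler_suml; apply: eq_bigr => s _; rewrite scalerA.
Qed.

Lemma linear_subst1 n (p : {mpoly K[n]}) : p \mPo linear_subst 1%:M = p.
Proof.
rewrite -[RHS]comp_mpoly_id; congr (_ \mPo _); apply: eq_from_tnth => i.
rewrite !tnth_mktuple (bigD1 i) //= mxE eqxx scale1r big1 ?addr0 // => j ne.
by rewrite mxE eq_sym (negPf ne) scale0r.
Qed.

Lemma linear_subst_inj n (A : 'M[K]_n) : A \in unitmx -> injective (comp_mpoly (linear_subst A)).
Proof.
move=> uA p q /(congr1 (comp_mpoly (linear_subst (invmx A)))).
by rewrite !linear_subst_comp mulmxV // !linear_subst1.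
Qed.

Definition power_subst n e : n.-tuple {mpoly K[n]} := [tuple 'X_i ^+ e | i < n].

Lemma power_substX n e m : 'X_[m] \mPo power_subst n e = 'X_[(m *+ e)%MM].
Proof.
rewrite comp_mpolyX mpolyXE_id; apply: eq_bigr => i _.
by rewrite tnth_mktuple mulmnE -exprM mulnC.
Qed.

Lemma power_subst_inj n e : (0 < e)%N -> injective (comp_mpoly (power_subst n e)).
Proof.
move=> e_gt0; apply: raddf_inj => p p0; apply/mpolyP => m; rewrite mcoeff0.
have <- : (p \mPo power_subst n e)@_(m *+ e)%MM = 0 by rewrite p0 mcoeff0.
rewrite comp_mpolyEX raddf_sum /=.
under eq_bigr => m' _ do rewrite mcoeffZ power_substX mcoeffX.
have inj m' : ((m' *+ e)%MM == (m *+ e)%MM) = (m' == m).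
  apply/eqP/eqP => [/mnmP E|->//]; apply/mnmP => i.
  by have := E i; rewrite !mulmnE => /eqP; rewrite eqn_pmul2r // => /eqP.
under eq_bigr => m' _ do rewrite inj.
have [mp|mp] := boolP (m \in msupp p); last first.
  rewrite memN_msupp_eq0 // big_seq big1 // => m' m'p.
  by case: eqVneq => [E|_]; rewrite ?mulr0 //; rewrite -E m'p in mp.
rewrite (bigD1_seq m) ?msupp_uniq //= eqxx mulr1 big1 ?addr0 // => m' ne.
by rewrite (negPf ne) mulr0.
Qed.
End Composition.

Section SubfieldLinearAlgebra.
Variables (F : fieldType) (E : F -> Prop).
Hypothesis sE : is_subfield E.

Lemma subfield_sign n : E ((-1) ^+ n).
Proof. by apply: subfieldX => //; apply: subfieldN => //; apply: subfield1. Qed.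

Lemma subfield_det n (A : 'M_n) : (forall i j, E (A i j)) -> E (\det A).
Proof.
move=> EA; apply: subfield_sum => // s _; apply: subfieldM => //; first exact: subfield_sign.
by apply: subfield_prod.
Qed.

Lemma subfield_invmx n (A : 'M_n) : (forall i j, E (A i j)) -> forall i j, E (invmx A i j).
Proof.
move=> EA i j; rewrite /invmx; case: ifP => // _; rewrite mxE.
apply: subfieldM => //; first by apply: subfieldV => //; apply: subfield_det.
rewrite mxE; apply: subfieldM => //; first exact: subfield_sign.
by apply: subfield_det => i' j'; rewrite !mxE.
Qed.

Definition over_subfield n (p : {mpoly F[n]}) := forall m, E p@_m.

Lemma over_subfieldD n (p q : {mpoly F[n]}) :
  over_subfield p -> over_subfield q -> over_subfield (p + q).
Proof. by move=> Ep Eq m; rewrite mcoeffD; apply: subfieldD. Qed.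

Lemma over_subfieldM n (p q : {mpoly F[n]}) :
  over_subfield p -> over_subfield q -> over_subfield (p * q).
Proof.
by move=> Ep Eq m; rewrite mcoeffM; apply: subfield_sum => // i _; apply: subfieldM.
Qed.

Lemma over_subfieldC n c : E c -> over_subfield (c%:MP_[n]).
Proof.
move=> Ec m; rewrite mcoeffC; apply: subfieldM => //.
by case: eqP => _; [apply: subfield1|apply: subfield0].
Qed.

Lemma over_subfieldX n m : over_subfield ('X_[m] : {mpoly F[n]}).
Proof. by move=> m'; rewrite mcoeffX; case: eqP => _; [apply: subfield1|apply: subfield0]. Qed.

Lemma over_subfieldZ n c (p : {mpoly F[n]}) : E c -> over_subfield p -> over_subfield (c *: p).
Proof. by move=> Ec Ep m; rewrite mcoeffZ; apply: subfieldM. Qed.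

Lemma over_subfield_sum n I (r : seq I) (P : pred I) (f : I -> {mpoly F[n]}) :
  (forall i, P i -> over_subfield (f i)) -> over_subfield (\sum_(i <- r | P i) f i).
Proof.
move=> Ef; apply: big_ind => //; last exact: over_subfieldD.
by move=> m; rewrite mcoeff0; apply: subfield0.
Qed.

Lemma over_subfield_comp n m (p : {mpoly F[n]}) (f : n.-tuple {mpoly F[m]}) :
  over_subfield p -> (forall i, over_subfield (tnth f i)) -> over_subfield (p \mPo f).
Proof.
move=> Ep Ef; rewrite comp_mpolyEX; apply: over_subfield_sum => m' _.
apply: over_subfieldZ => //; rewrite comp_mpolyX.
apply: big_ind => [|? ? ? ?|i _]; [exact: over_subfieldC (subfield1 sE)|exact: over_subfieldM|].
elim: (m' i) => [|l IHl]; first by rewrite expr0; apply: over_subfieldC (subfield1 sE).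
by rewrite exprS; apply: over_subfieldM.
Qed.
End SubfieldLinearAlgebra.

Lemma eqn_mod_dvdz (e m1 m2 : nat) : (e %| m1%:Z - m2%:Z)%Z = (m1 == m2 %[mod e])%N.
Proof. by rewrite -eqz_mod_dvd !modz_nat eqz_nat. Qed.

Section MonomialWeights.
Variables (gT : finGroupType) (N : {group gT}) (e : nat).
Local Notation n := #|gT|.
Implicit Types (m : 'X_{1..n}) (h x : gT).

Definition mexp m x : nat := m (enum_rank x).

Lemma conj_rank_inj h : injective (fun i : 'I_n => enum_rank (enum_val i ^ h^-1)%g).
Proof. by move=> i j /enum_rank_inj/conjg_inj/enum_val_inj. Qed.

Definition conj_perm h : 'S_n := perm (@conj_rank_inj h).

Definition mconj h m : 'X_{1..n} := [multinom m (conj_perm h i) | i < n].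

Lemma mexp_mconj h m x : mexp (mconj h m) x = mexp m (x ^ h^-1)%g.
Proof. by rewrite /mexp mnmE permE enum_rankK. Qed.

Lemma mexpD m1 m2 x : mexp (m1 + m2)%MM x = (mexp m1 x + mexp m2 x)%N.
Proof. exact: mnmDE. Qed.

Lemma mexp0 x : mexp 0%MM x = 0%N. Proof. exact: mnm0E. Qed.

Lemma mexp_inj m1 m2 : mexp m1 =1 mexp m2 -> m1 = m2.
Proof.
by move=> E; apply/mnmP=> i; have := E (enum_val i); rewrite /mexp enum_valK.
Qed.

Lemma mconj1 m : mconj 1 m = m.
Proof. by apply: mexp_inj => x; rewrite mexp_mconj invg1 conjg1. Qed.

Lemma mconjM g h m : mconj (g * h) m = mconj h (mconj g m).
Proof. by apply: mexp_inj => x; rewrite !mexp_mconj invMg conjgM. Qed.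

Definition wl m := weight_lattice N e (fun x => (mexp m x)%:Z).

Lemma wl0 : wl 0%MM.
Proof.
by split=> [x y _ _|x _]; rewrite !mexp0 ?subrr ?dvdz0.
Qed.

Lemma wlD m1 m2 : wl m1 -> wl m2 -> wl (m1 + m2)%MM.
Proof.
move=> [h1 o1] [h2 o2]; split=> [x y xN yN|x xN]; rewrite !mexpD !PoszD.
  by have := rpredD (h1 x y xN yN) (h2 x y xN yN); congr (_ %| _)%Z; ring.
by rewrite rpredD ?o1 ?o2.
Qed.

Lemma wl_mconj h m : h \in 'N(N)%g -> wl m -> wl (mconj h m).
Proof.
move=> nNh [hm om]; have memJ x : (x ^ h^-1 \in N)%g = (x \in N).
  by rewrite memJ_norm ?groupV.
split=> [x y xN yN|x xN]; rewrite !mexp_mconj; last by rewrite om ?memJ.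
by rewrite conjMg hm ?memJ.
Qed.

Lemma weight_separates u : abelian N -> (exponent N %| e)%N -> (0 < e)%N ->
  u \in N -> u != 1%g -> exists m, wl m /\ ~~ (e %| mexp m u)%N.
Proof.
move=> cNN expN e_gt0 uN nu1; set o := #[u]%g.
have o_e : (o %| e)%N by apply: dvdn_trans (dvdn_exponent uN) expN.
have o_gt0 : (0 < o)%N by apply: order_gt0.
pose q := (e %/ o)%N; have qo : (q * o)%N = e by rewrite divnK.
pose chi x : int := (q * odflt ord0 [pick i : 'I_o.+1 | x == u ^+ i]%g)%N%:Z.
have chiP i : (e %| chi (u ^+ i)%g - (q * i)%N%:Z)%Z.
  rewrite /chi; case: pickP => [j|/=]; last first.
    have lti : (i %% o < o.+1)%N by rewrite ltnS ltnW // ltn_pmod.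
    by move/(_ (Ordinal lti)); rewrite /= expg_mod_order eqxx.
  rewrite eq_expg_mod_order /= => /eqP E.
  rewrite eqn_mod_dvdz; apply/eqP; rewrite -qo -!muln_modr; congr (_ * _)%N.
  exact: esym.
have hchi : hom_mod e <[u]>%G chi.
  move=> _ _ /cycleP[i ->] /cycleP[j ->]; rewrite -expgD.
  have := rpredB (rpredB (chiP (i + j)%N) (chiP i)) (chiP j).
  by congr (_ %| _)%Z; rewrite mulnDr PoszD; ring.
have suN : <[u]>%G \subset N by rewrite cycle_subG.
have [a [ha aP]] := hom_mod_ext e_gt0 cNN expN suN hchi.
pose c x := absz ((if x \in N then a x else 0) %% e)%Z.
have cE x : (e %| (c x)%:Z - (if x \in N then a x else 0))%Z.
  by rewrite -eqz_mod_dvd /c gez0_abs ?modz_mod // modz_ge0 // eqz_nat -lt0n.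
pose m : 'X_{1..n} := [multinom c (enum_val i) | i < n].
have mE x : mexp m x = c x by rewrite /mexp mnmE enum_rankK.
exists m; split.
  split=> [x y xN yN|x xN]; rewrite !mE; last by have := cE x; rewrite (negPf xN) subr0.
  have := rpredD (rpredB (rpredB (cE (x * y)%g) (cE x)) (cE y)) (ha _ _ xN yN).
  by rewrite groupM // xN yN; congr (_ %| _)%Z; ring.
have q_lt : ~~ (e %| q)%N.
  have o_gt1 : (1 < o)%N by rewrite order_gt1.
  have q_gt0 : (0 < q)%N by rewrite divn_gt0 // dvdn_leq.
  by rewrite gtnNdvd // -[X in (_ < X)%N]qo ltn_Pmulr.
apply: contra q_lt; rewrite mE => ecu.
have := cE u; rewrite uN => h1; have h2 := aP u (cycle_id u).
have h3 := chiP 1%N; rewrite expg1 muln1 in h3.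
have h4 : (e %| (c u)%:Z)%Z by [].
have := rpredB h4 (rpredD (rpredD h1 h2) h3); rewrite -[X in _ -> is_true X]/(e %| q%:Z)%Z.
by congr (_ %| _)%Z; ring.
Qed.
End MonomialWeights.

Section TwistedPolynomials.
Variables (k : fieldType) (gT : finGroupType) (N G0 G : {group gT}) (e : nat) (zeta : k).
Hypothesis sdG : (N ><| G0)%g = G.
Hypothesis cNN : abelian N.
Hypothesis expN : (exponent N %| e)%N.
Hypothesis prim_zeta : e.-primitive_root zeta.
Variables (Phi : fieldType) (iota : {rmorphism k -> Phi}) (Om : Phi -> Prop).
Variable a : gT -> {rmorphism Phi -> Phi}.
Hypothesis gfO : gfield G0 iota Om a.

Local Notation n := #|gT|.
Local Notation S := {mpoly Phi[n]}.
Local Notation z := (iota zeta).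
Local Notation wl := (wl N e).
Local Notation hpart g := (remgr N G0 g).
Local Notation npart g := (divgr N G0 g).

Let sOm := gf_sub gfO.

Lemma zeta_neq0 : zeta != 0.
Proof.
apply/eqP => z0; have /eqP := prim_expr_order prim_zeta.
by rewrite z0 expr0n (gtn_eqF (prim_order_gt0 prim_zeta)) eq_sym oner_eq0.
Qed.

Lemma z_neq0 : z != 0. Proof. by rewrite fmorph_eq0 zeta_neq0. Qed.

Lemma prim_z : e.-primitive_root z. Proof. by rewrite fmorph_primitive_root. Qed.

Lemma sd_facts : [/\ N \subset G, G0 \subset G & G0 \subset 'N(N)%g].
Proof. by have [/andP[sNG _] sG0G _ nNG0 _] := sdprod_context sdG. Qed.

Lemma sd_compl : G0 \in [complements to N in G]%g.
Proof. exact: sdprod_compl. Qed.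

Lemma hpart_in g : g \in G -> hpart g \in G0.
Proof. by move=> gG; rewrite mem_remgr // (sdprodW sdG). Qed.

Lemma npart_in g : g \in G -> npart g \in N.
Proof. by move=> gG; rewrite mem_divgr // (sdprodW sdG). Qed.

Lemma hpartM g h : g \in G -> h \in G -> hpart (g * h)%g = (hpart g * hpart h)%g.
Proof.
by have [nsN _ _ _ _] := sdprod_context sdG; apply: (remgrM sd_compl nsN).
Qed.

Lemma npartM g h : g \in G -> h \in G ->
  npart (g * h)%g = (npart g * (npart h) ^ (hpart g)^-1)%g.
Proof.
move=> gG hG; have E := hpartM gG hG.
have Eg := divgr_eq N G0 g; have Eh := divgr_eq N G0 h.
have := divgr_eq N G0 (g * h)%g; rewrite E => Egh.
apply: (mulIg (hpart g * hpart h)%g); rewrite -Egh {1}Eg {1}Eh conjgE invgK.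
by rewrite !mulgA !mulgKV.
Qed.

Lemma hpart_id h : h \in G0 -> hpart h = h.
Proof. by have [_ _ _ _ ti] := sdprod_context sdG; apply: remgr_id. Qed.

Lemma hpart_N u : u \in N -> hpart u = 1%g.
Proof. exact: remgr1. Qed.

Lemma npart_N u : u \in N -> npart u = u.
Proof. exact: divgr_id. Qed.

Definition sig g : S -> S :=
  semilinear_subst (a (hpart g))
    (fun i => if conj_perm (hpart g) i == enum_rank (npart g) then z else 1)
    (conj_perm (hpart g)).

Fact sig_is_zmod_morphism g : zmod_morphism (sig g).
Proof. by move=> p q; apply: raddfB. Qed.

Fact sig_is_monoid_morphism g : monoid_morphism (sig g).
Proof. by split=> [|p q]; [apply: rmorph1|apply: rmorphM]. Qed.

HB.instance Definition _ g := GRing.isZmodMorphism.Build _ _ (sig g) (sig_is_zmod_morphism g).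
HB.instance Definition _ g := GRing.isMonoidMorphism.Build _ _ (sig g) (sig_is_monoid_morphism g).

Lemma sig_inj g : injective (sig g).
Proof. by apply: semilinear_subst_inj => i; case: ifP; rewrite ?oner_eq0 ?z_neq0. Qed.

Lemma mcoeff_sig g p m :
  (sig g p)@_m = z ^+ mexp m (npart g) * a (hpart g) p@_(mconj (hpart g) m).
Proof.
rewrite mcoeff_semilinear_subst; congr (_ * _).
set s := conj_perm _; set r := enum_rank _.
rewrite (bigD1 (s^-1%g r)) //= permKV eqxx big1 ?mulr1 // => i ni.
case: eqP => [Ei|]; last by rewrite expr1n.
by case/eqP: ni; rewrite -Ei permK.
Qed.

Definition Rp (p : S) := forall m, Om p@_m /\ (p@_m != 0 -> wl m).

Lemma RpB p q : Rp p -> Rp q -> Rp (p - q).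
Proof.
move=> Rp_ Rq m; have [[Op wp] [Oq wq]] := (Rp_ m, Rq m); rewrite mcoeffB; split.
  exact: subfieldB.
move=> nz; have [p0|/wp//] := eqVneq p@_m 0; apply: wq; apply: contraNneq nz => q0.
by rewrite p0 q0 subrr.
Qed.

Lemma RpC c : Om c -> Rp c%:MP.
Proof.
move=> Oc m; rewrite mcoeffC; split.
  by apply: subfieldM => //; case: eqP => _; [apply: subfield1|apply: subfield0].
have [->|] := eqVneq m 0%MM; first by move=> _; apply: wl0.
by rewrite mulr0 eqxx.
Qed.

Lemma RpX m : wl m -> Rp 'X_[m].
Proof.
move=> wm m'; rewrite mcoeffX; split.
  by case: eqP => _; [apply: subfield1|apply: subfield0].
have [<-|] := eqVneq m m'; first by move=> _.
by rewrite eqxx.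
Qed.

Lemma RpM p q : Rp p -> Rp q -> Rp (p * q).
Proof.
move=> Rp_ Rq m; rewrite mcoeffM; split.
  apply: subfield_sum => // i _; apply: subfieldM => //; [apply: (Rp_ _).1|apply: (Rq _).1].
move=> nz; apply: NNPP => nw; case/eqP: nz; rewrite big1 // => i /eqP Em.
have [p0|/(Rp_ _).2 wp] := eqVneq p@_i.1 0; first by rewrite p0 mul0r.
have [q0|/(Rq _).2 wq] := eqVneq q@_i.2 0; first by rewrite q0 mulr0.
by case: nw; rewrite Em; apply: wlD.
Qed.

Lemma Rp0 : Rp 0.
Proof. by rewrite -mpolyC0; apply: RpC (subfield0 sOm). Qed.

Lemma Rp1 : Rp 1.
Proof. by rewrite -mpolyC1; apply: RpC (subfield1 sOm). Qed.

Lemma RpD p q : Rp p -> Rp q -> Rp (p + q).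
Proof. move=> Rp_ Rq; rewrite -[q]opprK -[- q]sub0r; by apply: RpB => //; apply: RpB => //; apply: Rp0. Qed.

Lemma Rp_sig g p : g \in G -> Rp p -> Rp (sig g p).
Proof.
have [_ _ nNG0] := sd_facts.
move=> gG Rp_ m; rewrite mcoeff_sig; have hG := hpart_in gG; split.
  apply: subfieldM => //; first by apply: subfieldX => //; apply: (gf_k gfO).
  by apply: (gf_act gfO) => //; apply: (Rp_ _).1.
rewrite mulf_eq0 negb_or fmorph_eq0 => /andP[_ /(Rp_ _).2 wm].
have := wl_mconj (_ : (hpart g)^-1%g \in 'N(N)%g) wm.
rewrite groupV -mconjM mulgV mconj1; apply; exact: (subsetP nNG0).
Qed.

Lemma sigM g h p : g \in G -> h \in G -> Rp p -> sig (g * h)%g p = sig g (sig h p).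
Proof.
move=> gG hG Rp_; have [_ _ nNG0] := sd_facts.
have [gG0 hG0] := (hpart_in gG, hpart_in hG).
apply/mpolyP=> m; rewrite !mcoeff_sig rmorphM rmorphXn (gf_const gfO) //.
have := hpartM gG hG; rewrite /= => ->; rewrite mconjM npartM //.
have [Om_ wm] := Rp_ (mconj (hpart h) (mconj (hpart g) m)).
rewrite (gf_mul gfO) // mulrA -exprD mexp_mconj.
have [->|/wm wm'] := eqVneq p@_(mconj (hpart h) (mconj (hpart g) m)) 0.
  by rewrite !rmorph0 !mulr0.
congr (_ * _); apply/eqP; rewrite (eq_prim_root_expr prim_z).
have wM : wl m.
  rewrite -mconjM in wm'.
  have := wl_mconj (_ : (hpart g * hpart h)^-1%g \in 'N(N)%g) wm'.
  by rewrite -mconjM mulgV mconj1; apply; rewrite groupV (subsetP nNG0) ?groupM.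
have uN := npart_in gG; have vN : (npart h ^ (hpart g)^-1)%g \in N.
  by rewrite memJ_norm ?npart_in ?groupV ?(subsetP nNG0).
by rewrite -eqn_mod_dvdz PoszD opprD addrA; apply: wM.1.
Qed.

Lemma sigZ g c p : sig g (c *: p) = a (hpart g) c *: sig g p.
Proof. by rewrite -mul_mpolyC rmorphM /= /sig /semilinear_subst mmapC /= mul_mpolyC. Qed.

Lemma sigC g c : sig g c%:MP = (a (hpart g) c)%:MP.
Proof. exact: mmapC. Qed.

Lemma sig_power g i : sig g ('X_i ^+ e) = 'X_(conj_perm (hpart g) i) ^+ e.
Proof.
have -> : sig g ('X_i ^+ e) = (sig g 'X_i) ^+ e by rewrite rmorphXn.
rewrite /sig /semilinear_subst mmapX mmap1U exprZn.
case: ifP => _; last by rewrite expr1n scale1r.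
by rewrite (prim_expr_order prim_z) scale1r.
Qed.

Definition iota1 : {rmorphism k -> {fraction S}} :=
  (@FracField.tofrac S \o (@mpolyC n Phi \o iota)).

Lemma iota1E c : iota1 c = ((iota c)%:MP)%:F. Proof. by []. Qed.

Variable b : gT -> {rmorphism {fraction S} -> {fraction S}}.
Hypothesis bE : forall g x, b g x%:F = (sig g x)%:F.

Definition Om1 (x : {fraction S}) := exists p q, [/\ Rp p, Rp q, q != 0 & x = p%:F / q%:F].

Lemma Om1_tofrac p : Rp p -> Om1 p%:F.
Proof.
move=> Rp_; exists p, 1; split; rewrite ?oner_neq0 ?tofrac1 ?divr1 //; exact: Rp1.
Qed.

Lemma Om1_subfield : is_subfield Om1.
Proof.
split=> [|x y|x y|x].
- by rewrite -tofrac1; apply/Om1_tofrac/Rp1.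
- move=> [p [q [Rp_ Rq nzq ->]]] [p' [q' [Rp' Rq' nzq' ->]]].
  exists (p * q' - p' * q), (q * q'); split; rewrite ?mulf_neq0 //.
  + by apply: RpB; apply: RpM.
  + exact: RpM.
  by rewrite -mulNr addf_div ?tofrac_eq0 // mulNr -!tofracM -tofracB.
- move=> [p [q [Rp_ Rq nzq ->]]] [p' [q' [Rp' Rq' nzq' ->]]].
  exists (p * p'), (q * q'); split; rewrite ?mulf_neq0 ?mulf_div ?tofracM //; exact: RpM.
move=> [p [q [Rp_ Rq nzq ->]]]; have [->|nzp] := eqVneq p 0.
  by rewrite tofrac0 mul0r invr0 -tofrac0; apply/Om1_tofrac/Rp0.
by exists q, p; split; rewrite ?invfM ?invrK // mulrC.
Qed.

Lemma gfield_Om1 : gfield G iota1 Om1 b.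
Proof.
have e_gt0 := prim_order_gt0 prim_zeta.
have nz_sig g q : q != 0 -> sig g q != 0.
  by apply: contraNneq => s0; rewrite -(inj_eq (@sig_inj g)) s0 rmorph0.
split; first exact: Om1_subfield.
- by move=> c; apply/Om1_tofrac/RpC/(gf_k gfO).
- move=> g _ gG [p [q [Rp_ Rq nzq ->]]]; exists (sig g p), (sig g q).
  by split; rewrite ?nz_sig ?fmorph_div ?bE //; apply: Rp_sig.
- move=> g h _ gG hG [p [q [Rp_ Rq nzq ->]]].
  by rewrite !fmorph_div /= !bE !sigM.
- by move=> g c gG; rewrite iota1E bE sigC (gf_const gfO) ?hpart_in.
move=> g gG fixg.
have fix_sig p : Rp p -> sig g p = p.
  by move=> /Om1_tofrac/fixg/eqP; rewrite bE tofrac_eq => /eqP.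
have h1 : hpart g = 1%g.
  apply: (gf_faithful gfO); rewrite ?hpart_in // => c /RpC/fix_sig.
  by rewrite sigC => /(congr1 (mcoeff 0)); rewrite !mcoeffC eqxx !mulr1.
have gN : g \in N by rewrite (divgr_eq N G0 g) h1 mulg1 npart_in.
apply/eqP; apply: contraT => ng1.
have [m [wm nm]] := weight_separates cNN expN e_gt0 gN ng1.
have := congr1 (fun p => p@_m) (fix_sig _ (RpX wm)).
rewrite mcoeff_sig h1 mconj1 npart_N // mcoeffX eqxx rmorph1 mulr1 => /eqP.
by rewrite -(prim_order_dvd prim_z) (negPf nm).
Qed.

Section Invariants.
Hypothesis inf_k : infinite_type k.
Variable y : 'I_n -> gT -> Phi.
Hypothesis y_Om : forall j x, Om (y j x).
Hypothesis y_act : forall j x h, h \in G0 -> a h (y j x) = y j (x ^ h^-1)%g.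
Let M := \matrix_(j < n, i < n) y j (enum_val i).
Hypothesis uM : M \in unitmx.

Let e_gt0 : (0 < e)%N := prim_order_gt0 prim_zeta.

Definition Tp : n.-tuple S :=
  [tuple tnth (linear_subst M) j \mPo power_subst Phi n e | j < n].

Lemma TpE j : tnth Tp j = \sum_i M j i *: 'X_i ^+ e.
Proof.
rewrite !tnth_mktuple raddf_sum /=; apply: eq_bigr => i _.
by rewrite comp_mpolyZ comp_mpolyXU -tnth_nth tnth_mktuple.
Qed.

Lemma comp_TpE p : p \mPo Tp = (p \mPo linear_subst M) \mPo power_subst Phi n e.
Proof. by rewrite comp_mpolyA. Qed.

Lemma comp_Tp_inj : injective (comp_mpoly Tp).
Proof.
move=> p q; rewrite !comp_TpE => /(power_subst_inj e_gt0).
exact: linear_subst_inj.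
Qed.

Lemma wl_dvd m : (forall x, e %| mexp m x)%N -> wl m.
Proof.
by move=> em; split=> [x1 x2 _ _|x _]; last exact: em; rewrite !rpredB //; apply: em.
Qed.

Lemma Rp_sum I (r : seq I) (P : pred I) (f : I -> S) :
  (forall i, P i -> Rp (f i)) -> Rp (\sum_(i <- r | P i) f i).
Proof. by move=> Rf; apply: big_ind => //; [apply: Rp0|apply: RpD]. Qed.

Lemma Rp_Tp j : Rp (tnth Tp j).
Proof.
rewrite TpE; apply: Rp_sum => i _; rewrite -mul_mpolyC; apply: RpM.
  by apply: RpC; rewrite mxE.
rewrite mpolyXn; apply/RpX/wl_dvd => x.
by rewrite /mexp mulmnE dvdn_mull.
Qed.

Lemma sig_Tp g j : g \in G -> sig g (tnth Tp j) = tnth Tp j.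
Proof.
move=> gG; rewrite TpE rmorph_sum /=; under eq_bigr do rewrite sigZ sig_power.
rewrite [RHS](reindex_perm (conj_perm (hpart g))); apply: eq_bigr => i _ /=.
by rewrite !mxE y_act ?hpart_in // permE enum_rankK.
Qed.

Lemma sig_comp_Tp g p : g \in G ->
  sig g (p \mPo Tp) = map_mpoly (a (hpart g)) p \mPo Tp.
Proof.
move=> gG; elim/mpolyind: p => [|c m p _ _ IHp].
  by rewrite !(comp_mpoly0, raddf0).
have -> : map_mpoly (a (hpart g)) (c *: 'X_[m] + p) =
    a (hpart g) c *: 'X_[m] + map_mpoly (a (hpart g)) p.
  by rewrite [LHS]raddfD /= map_mpolyZ map_mpolyX.
rewrite !comp_mpolyD [LHS]raddfD /= IHp; congr (_ + _).
rewrite !comp_mpolyZ sigZ; congr (_ *: _).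
rewrite comp_mpolyX rmorph_prod; apply: eq_bigr => i _.
by rewrite rmorphXn /= sig_Tp.
Qed.

Lemma invariant_poly P : Rp P -> (forall g, g \in G -> sig g P = P) ->
  exists2 p, P = p \mPo Tp &
    forall m, Om p@_m /\ forall h, h \in G0 -> a h p@_m = p@_m.
Proof.
move=> RP invP; have [sNG sG0G nNG0] := sd_facts.
have e_m m x : m \in msupp P -> (e %| mexp m x)%N.
  move=> mP; have [OP wm] := RP m; rewrite mcoeff_msupp in mP.
  have [xN|xN] := boolP (x \in N); last exact: (wm mP).2.
  have := congr1 (fun p => p@_m) (invP x (subsetP sNG x xN)).
  rewrite mcoeff_sig hpart_N // npart_N // mconj1 (gf_act1 gfO) // => /eqP.
  rewrite -subr_eq0 -[X in _ - X]mul1r -mulrBl mulf_eq0 (negPf mP) orbF subr_eq0.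
  by rewrite -(prim_order_dvd prim_z).
pose md m : 'X_{1..n} := [multinom (m i %/ e)%N | i < n].
pose p1 : S := \sum_(m <- msupp P) P@_m *: 'X_[md m].
have P1 : P = p1 \mPo power_subst Phi n e.
  rewrite {1}[P]mpolyE raddf_sum /= big_seq [RHS]big_seq; apply: eq_bigr => m mP.
  rewrite comp_mpolyZ power_substX; congr (_ *: 'X_[_]); apply/mnmP=> i.
  by rewrite mulmnE mnmE divnK //; have := e_m m (enum_val i) mP; rewrite /mexp enum_valK.
pose p2 := p1 \mPo linear_subst (invmx M).
have P2 : P = p2 \mPo Tp.
  by rewrite comp_TpE linear_subst_comp mulVmx // linear_subst1.
exists p2 => // m; split.
  move: m; apply: (over_subfield_comp sOm) => [|i].
    apply: (over_subfield_sum sOm) => m _; apply: (over_subfieldZ sOm); last exact: (over_subfieldX sOm).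
    exact: (RP m).1.
  rewrite tnth_mktuple; apply: (over_subfield_sum sOm) => j _.
  apply: (over_subfieldZ sOm); last exact: (over_subfieldX sOm).
  by apply: (subfield_invmx sOm) => i' j'; rewrite mxE.
move=> h hG0; have hG := subsetP sG0G h hG0.
have := invP h hG; rewrite P2 sig_comp_Tp // => /comp_Tp_inj/(congr1 (mcoeff m)).
by rewrite mcoeff_map_mpoly /= hpart_id.
Qed.
End Invariants.
End TwistedPolynomials.

Definition gf_invariant (gT : finGroupType) (G : {group gT}) (F : fieldType)
    (E : F -> Prop) (b : gT -> {rmorphism F -> F}) (x : F) :=
  E x /\ forall g, g \in G -> b g x = x.

Record rational_basis (k F : fieldType) (iota : {rmorphism k -> F}) (L : F -> Prop)
    m (X : 'I_m -> F) : Prop := RationalBasis {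
  rb_in : forall i, L (X i);
  rb_indep : forall p : {mpoly k[m]}, mmap iota X p = 0 -> p = 0;
  rb_gen : forall x, L x -> exists p q : {mpoly k[m]},
    mmap iota X q != 0 /\ x = mmap iota X p / mmap iota X q }.

Lemma rmorph_mmap (R : ringType) (S1 S2 : comRingType) n (f : {rmorphism S1 -> S2})
    (h : {rmorphism R -> S1}) (v : 'I_n -> S1) h' v' (p : {mpoly R[n]}) :
  (forall c, f (h c) = h' c) -> (forall i, f (v i) = v' i) ->
  f (mmap h v p) = mmap h' v' p.
Proof.
move=> hE vE; rewrite /mmap rmorph_sum; apply: eq_bigr => m _.
rewrite rmorphM hE /mmap1 rmorph_prod; congr (_ * _); apply: eq_bigr => i _.
by rewrite rmorphXn vE.
Qed.

Lemma subfield_mmap (k F : fieldType) (iota : {rmorphism k -> F}) (E : F -> Prop) n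
    (v : 'I_n -> F) (p : {mpoly k[n]}) : is_subfield E ->
  (forall c, E (iota c)) -> (forall i, E (v i)) -> E (mmap iota v p).
Proof.
move=> sE Ek Ev; apply: subfield_sum => // m _; apply: subfieldM => //.
by apply: subfield_prod => // i _; apply: subfieldX.
Qed.

Definition ord_cat (A : Type) m n (f : 'I_m -> A) (g : 'I_n -> A) (i : 'I_(m + n)) : A :=
  match split i with inl j => f j | inr j => g j end.

Lemma ord_catl A m n (f : 'I_m -> A) (g : 'I_n -> A) i : ord_cat f g (lshift n i) = f i.
Proof. by rewrite /ord_cat -[lshift n i]/(unsplit (inl i)) unsplitK. Qed.

Lemma ord_catr A m n (f : 'I_m -> A) (g : 'I_n -> A) i : ord_cat f g (rshift m i) = g i.
Proof. by rewrite /ord_cat -[rshift m i]/(unsplit (inr i)) unsplitK. Qed.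

Lemma indep_adjoin_variables (k F : fieldType) (iota : {rmorphism k -> F}) m n
    (X : 'I_m -> F) (p : {mpoly k[m + n]}) : infinite_type k ->
  (forall q : {mpoly k[m]}, mmap iota X q = 0 -> q = 0) ->
  mmap (@mpolyC n F \o iota) (ord_cat (fun i => (X i)%:MP) (fun j => 'X_j)) p = 0 -> p = 0.
Proof.
move=> inf_k indX; set p' := mmap _ _ p => p'0; apply/eqP; apply: contraT => nzp.
have [c nzc] := mpoly_nonroot (idfun : {rmorphism k -> k}) inf_k nzp.
pose pt : {mpoly k[m]} := mmap (@mpolyC m k)
  (ord_cat (fun i => 'X_i) (fun j => (c (rshift m j))%:MP)) p.
have pt0 : pt = 0.
  apply: indX.
  transitivity (meval (fun j => iota (c (rshift m j))) p'); last by rewrite p'0 meval0.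
  transitivity (mmap iota (ord_cat X (fun j => iota (c (rshift m j)))) p).
    apply: rmorph_mmap => [d|i] /=; first by rewrite mmapC.
    have [j ->|j ->] := split_ordP i; rewrite ?ord_catl ?ord_catr ?mmapC //.
    by rewrite mmapX mmap1U.
  apply/esym; apply: rmorph_mmap => [d|i] /=; first by rewrite mevalC.
  by have [j ->|j ->] := split_ordP i; rewrite ?ord_catl ?ord_catr ?mevalC ?mevalXU.
case/eqP: nzc; transitivity (meval (fun j => c (lshift n j)) pt); last by rewrite pt0 meval0.
apply/esym; apply: rmorph_mmap => [d|i] /=; first by rewrite mevalC.
by have [j ->|j ->] := split_ordP i; rewrite ?ord_catl ?ord_catr ?mevalC ?mevalXU.
Qed.

Section Generated.
Variables (k F : fieldType) (iota : {rmorphism k -> F}) (m : nat) (X : 'I_m -> F).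

Definition generated (x : F) := exists p q : {mpoly k[m]},
  mmap iota X q != 0 /\ x = mmap iota X p / mmap iota X q.

Lemma generated_subfield : is_subfield generated.
Proof.
split=> [|x y|x y|x].
- by exists 1, 1; rewrite rmorph1 oner_neq0 divr1.
- move=> [p [q [nzq ->]]] [p' [q' [nzq' ->]]].
  exists (p * q' - p' * q), (q * q'); rewrite rmorphM mulf_neq0 //; split => //.
  by rewrite -[X in _ + X = _]mulNr addf_div // rmorphB !rmorphM mulNr.
- move=> [p [q [nzq ->]]] [p' [q' [nzq' ->]]].
  by exists (p * p'), (q * q'); rewrite !rmorphM mulf_neq0 // mulf_div.
move=> [p [q [nzq ->]]]; have [->|nzp] := eqVneq (mmap iota X p) 0.
  by exists 0, 1; rewrite rmorph0 rmorph1 oner_neq0 !mul0r invr0.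
by exists q, p; rewrite invfM invrK mulrC.
Qed.

Lemma generated_mmap p : generated (mmap iota X p).
Proof. by exists p, 1; rewrite rmorph1 oner_neq0 divr1. Qed.

Lemma generated_const c : generated (iota c).
Proof. by rewrite -(mmapC X iota); apply: generated_mmap. Qed.

Lemma generated_gen i : generated (X i).
Proof. by rewrite -(mmap1U X i) -[mmap1 _ _](mmapX X iota); apply: generated_mmap. Qed.
End Generated.

Section Rationality.
Variables (k : fieldType) (gT : finGroupType) (N G0 G : {group gT}) (e : nat) (zeta : k).
Hypothesis sdG : (N ><| G0)%g = G.
Hypothesis prim_zeta : e.-primitive_root zeta.
Hypothesis inf_k : infinite_type k.
Variables (Phi : fieldType) (iota : {rmorphism k -> Phi}) (Om : Phi -> Prop).
Variable a : gT -> {rmorphism Phi -> Phi}.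
Hypothesis gfO : gfield G0 iota Om a.
Local Notation n := #|gT|.
Local Notation S := {mpoly Phi[n]}.
Local Notation sig := (sig N G0 zeta iota a).
Local Notation Rp := (Rp N e Om).
Local Notation Om1 := (Om1 N e Om).
Local Notation iota1 := (iota1 gT iota).
Variable b : gT -> {rmorphism {fraction S} -> {fraction S}}.
Hypothesis bE : forall g x, b g x%:F = (sig g x)%:F.

Lemma Rp_prod I (r : seq I) (P : pred I) (f : I -> S) :
  (forall i, P i -> Rp (f i)) -> Rp (\prod_(i <- r | P i) f i).
Proof. by move=> Rf; apply: big_ind => //; [apply: (Rp1 _ _ gfO)|apply: (RpM gfO)]. Qed.

Lemma invariant_quotient x : gf_invariant G Om1 b x -> exists p q,
  [/\ Rp p /\ (forall g, g \in G -> sig g p = p),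
      Rp q /\ (forall g, g \in G -> sig g q = q), q != 0 & x = p%:F / q%:F].
Proof.
move=> [[p [q [Rp_ Rq nzq Dx]]] invx].
have sig1 r : Rp r -> sig 1%g r = r.
  move=> Rr; have := sigM sdG prim_zeta gfO (group1 G) (group1 G) Rr.
  by rewrite mulg1 => /(sig_inj prim_zeta)/esym.
have nz_sig g r : r != 0 -> sig g r != 0.
  apply: contraNneq => s0; apply/eqP.
  by apply: (sig_inj prim_zeta (N := N) (G0 := G0) (iota := iota) (a := a) (g := g)); rewrite s0 rmorph0.
pose Q := \prod_(g in G) sig g q; pose P := p * \prod_(g in G | g != 1%g) sig g q.
have RQ : Rp Q by apply: Rp_prod => g gG; apply: (Rp_sig zeta sdG gfO).
have RP : Rp P.
  apply: (RpM gfO) => //; apply: Rp_prod => g /andP[gG _]; exact: (Rp_sig zeta sdG gfO).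
have nzQ : Q != 0 by apply/prodf_neq0 => g _; apply: nz_sig.
have DxQ : x = P%:F / Q%:F.
  rewrite Dx /Q (bigD1 1%g) //= sig1 // /P !tofracM -mulf_div divff ?mulr1 //.
  by rewrite tofrac_eq0; apply/prodf_neq0 => g _; apply: nz_sig.
have sigQ g : g \in G -> sig g Q = Q.
  move=> gG; rewrite rmorph_prod /= [RHS](reindex_inj (mulgI g)) [RHS](eq_bigl (fun h => h \in G)).
    by apply: eq_bigr => h hG; rewrite (sigM sdG prim_zeta gfO).
  by move=> h; apply: groupMl.
exists P, Q; split => //; split => // g gG; apply/eqP; rewrite -tofrac_eq -bE.
have DP : P%:F = x * Q%:F by rewrite DxQ divfK // tofrac_eq0.
by rewrite DP rmorphM invx // bE sigQ.
Qed.

Variables (m : nat) (X : 'I_m -> Phi).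
Hypothesis rbX : rational_basis iota (gf_invariant G0 Om a) X.
Variable y : 'I_n -> gT -> Phi.
Hypothesis y_Om : forall j x, Om (y j x).
Hypothesis y_act : forall j x h, h \in G0 -> a h (y j x) = y j (x ^ h^-1)%g.
Hypothesis uM : \matrix_(j < n, i < n) y j (enum_val i) \in unitmx.
Local Notation Tp := (Tp e y).

Definition X1 : 'I_(m + n) -> {fraction S} :=
  ord_cat (fun i => ((X i)%:MP)%:F) (fun j => (tnth Tp j)%:F).

Lemma rational_basis_X1 : rational_basis iota1 (gf_invariant G Om1 b) X1.
Proof.
have sOm := gf_sub gfO.
split=> [i|p p0|x invx].
- have [j ->|j ->] := split_ordP i; rewrite ?/X1 ?ord_catl ?ord_catr; split=> [|g gG].
  + by apply: (Om1_tofrac gfO); apply: (RpC _ _ gfO); have [] := rb_in rbX j.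
  + rewrite bE sigC; congr (_%:MP)%:F; have [_] := rb_in rbX j; apply.
    exact: (hpart_in sdG).
  + by apply: (Om1_tofrac gfO); apply: (Rp_Tp N e gfO).
  + by rewrite bE (sig_Tp sdG prim_zeta iota y_act).
- apply: (indep_adjoin_variables inf_k (rb_indep rbX)).
  apply: (comp_Tp_inj prim_zeta uM); rewrite comp_mpoly0.
  apply/eqP; rewrite -tofrac_eq0; apply/eqP; rewrite -[RHS]p0.
  rewrite -[LHS]/((@FracField.tofrac S \o comp_mpoly Tp) (mmap _ _ p)).
  apply: rmorph_mmap => [d|i] /=; first by rewrite comp_mpolyC.
  have [j ->|j ->] := split_ordP i; rewrite /X1 ?ord_catl ?ord_catr ?comp_mpolyC //.
  by rewrite comp_mpolyXU -tnth_nth.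
have sG := generated_subfield iota1 X1.
have genc d : gf_invariant G0 Om a d -> generated iota1 X1 (d%:MP)%:F.
  move=> /(rb_gen rbX)[p [q [nzq ->]]].
  pose f : {rmorphism Phi -> {fraction S}} := @FracField.tofrac S \o @mpolyC n Phi.
  rewrite -[X in generated _ _ X]/(f _) fmorph_div.
  have genf r : generated iota1 X1 (f (mmap iota X r)).
    rewrite (@rmorph_mmap _ _ _ _ f iota X iota1 (fun i => X1 (lshift n i))) //.
      by apply: subfield_mmap => // [c|i]; [apply: generated_const|apply: generated_gen].
    by move=> i; rewrite /X1 ord_catl.
  exact: (subfield_div sG).
suff genP P : Rp P -> (forall g, g \in G -> sig g P = P) -> generated iota1 X1 P%:F.
  have [P [Q [[RP sP] [RQ sQ] nzQ ->]]] := invariant_quotient invx.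
  by apply: (subfield_div sG); apply: genP.
move=> RP sP; have [p -> pP] := invariant_poly sdG prim_zeta gfO y_Om y_act uM RP sP.
rewrite comp_mpolyEX rmorph_sum; apply: subfield_sum => // m' _.
rewrite -mul_mpolyC rmorphM; apply: subfieldM => //.
  by apply: genc; have [] := pP m'.
rewrite comp_mpolyX rmorph_prod; apply: subfield_prod => // j _.
rewrite rmorphXn; apply: subfieldX => //.
by have := generated_gen iota1 X1 (rshift m j); rewrite /X1 ord_catr.
Qed.
End Rationality.

Definition fixed_by (gT : finGroupType) (N : {group gT}) (F : fieldType) (E : F -> Prop)
  (b : gT -> {rmorphism F -> F}) (x : F) := E x /\ forall u, u \in N -> b u x = x.

Lemma gfield_quotient (k : fieldType) (gT : finGroupType) (N G0 G : {group gT})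
    (F : fieldType) (iota : {rmorphism k -> F}) E b :
  (N ><| G0)%g = G -> gfield G iota E b -> gfield G0 iota (fixed_by N E b) b.
Proof.
move=> sdG gfE; have [sNG sG0G nNG0] := sd_facts sdG; have sE := gf_sub gfE.
have inN u : u \in N -> u \in G by apply: (subsetP sNG).
have inG0 h : h \in G0 -> h \in G by apply: (subsetP sG0G).
split.
- split=> [|x y [Ex fx] [Ey fy]|x y [Ex fx] [Ey fy]|x [Ex fx]]; split.
  + exact: subfield1.
  + by move=> u _; rewrite rmorph1.
  + exact: subfieldB.
  + by move=> u uN; rewrite rmorphB fx ?fy.
  + exact: subfieldM.
  + by move=> u uN; rewrite rmorphM fx ?fy.
  + exact: subfieldV.
  + by move=> u uN; rewrite fmorphV fx.
- by move=> c; split; [apply: (gf_k gfE)|move=> u /inN uG; apply: (gf_const gfE)].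
- move=> h x hG0 [Ex fx]; split; first exact: (gf_act gfE) (inG0 _ hG0) Ex.
  move=> u uN; have [uG hG] := (inN u uN, inG0 h hG0).
  have uhN : (u ^ h)%g \in N by rewrite memJ_norm // (subsetP nNG0).
  have uhG := inN _ uhN.
  by rewrite -[LHS](gf_mul gfE) // conjgC [LHS](gf_mul gfE) // fx.
- by move=> g h x gG hG [Ex _]; apply: (gf_mul gfE); rewrite ?inG0.
- by move=> g c gG; apply: (gf_const gfE); apply: inG0.
move=> h hG0 fixh; have hG := inG0 h hG0.
pose c (g : gT) : F := (h^-1 * g \in N)%g%:R - (g \in N)%:R.
have c0 : forall g, g \in G -> c g = 0.
  apply: (dedekind_independence gfE) => x Ex.
  have trx : fixed_by N E b (\sum_(u in N) b u x).
    split; first by apply: subfield_sum => // u uN; apply: (gf_act gfE); rewrite ?inN.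
    move=> v vN; rewrite rmorph_sum /= [RHS](reindex_inj (mulgI v)).
    rewrite [RHS](eq_bigl (fun u => u \in N)) => [|u]; last exact: groupMl.
    by apply: eq_bigr => u uN; rewrite (gf_mul gfE) //; apply: inN.
  have := fixh _ trx => /eqP; rewrite -subr_eq0 => /eqP E0; rewrite -[RHS]E0.
  under eq_bigr do rewrite mulrBl.
  rewrite sumrB; congr (_ - _); last first.
    rewrite [LHS](bigID (fun g => g \in N)) /= [X in _ + X]big1 ?addr0.
      apply: eq_big => [g|g /andP[_ ->]]; last by rewrite mul1r.
      by apply: andb_idl; apply: inN.
    by move=> g /andP[_ /negPf->]; rewrite mul0r.
  rewrite rmorph_sum /= [LHS](bigID (fun g => h^-1 * g \in N)%g) /= [X in _ + X]big1 ?addr0.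
    rewrite (reindex_inj (mulgI h)) /=; apply: eq_big => [g|g /andP[_]].
      by rewrite mulKg; apply: andb_idl => gN; rewrite groupM // inN.
    by rewrite mulKg => gN; rewrite gN mul1r (gf_mul gfE) // inN.
  by move=> g /andP[_ /negPf->]; rewrite mul0r.
have := c0 1%g (group1 G); rewrite /c mulg1 group1 groupV => /eqP.
rewrite subr_eq0; case: (boolP (h \in N)) => [hN _|_]; last by rewrite eq_sym oner_eq0.
have [_ _ _ _ ti] := sdprod_context sdG.
by apply/set1gP; rewrite -ti inE hN.
Qed.

Record gplace (k : fieldType) (gT : finGroupType) (G : {group gT})
    (F1 : fieldType) (iota1 : {rmorphism k -> F1}) (E1 : F1 -> Prop)
    (b1 : gT -> {rmorphism F1 -> F1})
    (F2 : fieldType) (iota2 : {rmorphism k -> F2}) (E2 : F2 -> Prop)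
    (b2 : gT -> {rmorphism F2 -> F2}) (O : F1 -> Prop) (Psi : F1 -> F2) : Prop := GPlace {
  pl_sub : forall x, O x -> E1 x;
  pl_k : forall c, O (iota1 c) /\ Psi (iota1 c) = iota2 c;
  pl_D : forall x y, O x -> O y -> O (x + y) /\ Psi (x + y) = Psi x + Psi y;
  pl_M : forall x y, O x -> O y -> O (x * y) /\ Psi (x * y) = Psi x * Psi y;
  pl_act : forall g x, g \in G -> O x -> O (b1 g x) /\ Psi (b1 g x) = b2 g (Psi x);
  pl_val : forall x, O x -> E2 (Psi x) }.

Section PlaceUnits.
Variables (k : fieldType) (gT : finGroupType) (G : {group gT}).
Variables (F1 : fieldType) (iota1 : {rmorphism k -> F1}) (E1 : F1 -> Prop).
Variables (b1 : gT -> {rmorphism F1 -> F1}) (F2 : fieldType) (iota2 : {rmorphism k -> F2}).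
Variables (E2 : F2 -> Prop) (b2 : gT -> {rmorphism F2 -> F2}) (O : F1 -> Prop) (Psi : F1 -> F2).
Hypothesis pl : gplace G iota1 E1 b1 iota2 E2 b2 O Psi.

Lemma gplace0 : O 0 /\ Psi 0 = 0.
Proof. by have := pl_k pl 0; rewrite !rmorph0. Qed.

Lemma gplace1 : O 1 /\ Psi 1 = 1.
Proof. by have := pl_k pl 1; rewrite !rmorph1. Qed.
End PlaceUnits.

Lemma exprz_eq_mod (k : fieldType) e (zeta : k) (i j : int) :
  e.-primitive_root zeta -> (e %| i - j)%Z -> zeta ^ i = zeta ^ j.
Proof.
move=> pz /dvdzP[q Dq]; have nz : zeta != 0.
  apply/eqP => z0; have /eqP := prim_expr_order pz.
  by rewrite z0 expr0n (gtn_eqF (prim_order_gt0 pz)) eq_sym oner_eq0.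
have zqe : zeta ^ (q * e) = 1.
  by rewrite mulrC -exprz_exp -exprnP (prim_expr_order pz) exp1rz.
by rewrite -(subrK j i) Dq expfzDr // zqe mul1r.
Qed.

Section MonomialEvaluation.
Variables (k : fieldType) (gT : finGroupType) (N G0 G : {group gT}) (e : nat) (zeta : k).
Hypothesis sdG : (N ><| G0)%g = G.
Hypothesis prim_zeta : e.-primitive_root zeta.
Hypothesis inf_k : infinite_type k.
Local Notation n := #|gT|.
Local Notation wl := (wl N e).
Local Notation hpart g := (remgr N G0 g).
Local Notation npart g := (divgr N G0 g).

Variables (d : nat) (E : 'M[int]_(d, n)) (rho : gT -> 'M[int]_d).
Variable I : seq ('rV[int]_d * 'cV[int]_d).
Hypothesis EL : forall v, weight_lattice N e (row_val E v).
Hypothesis latE : forall m, weight_lattice N e m -> exists v, forall x, row_val E v x = m x.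
Hypothesis injE : forall v w : 'rV_d, row_val E v =1 row_val E w -> v = w.
Hypothesis rhoE : forall g v x, g \in G0 -> row_val E (v *m rho g) x = row_val E v (x ^ g^-1)%g.
Hypothesis invI : rep_inv rho G0 I.
Hypothesis sumI : \sum_(u <- I) u.2 *m u.1 = 1%:M.

Variables (F : fieldType) (iota : {rmorphism k -> F}) (EF : F -> Prop).
Variable b : gT -> {rmorphism F -> F}.
Hypothesis gfF : gfield G iota EF b.

Definition lat_act g (t : 'rV[int]_d) := t *m rho (hpart g)^-1%g.
Definition lat_chi g (t : 'rV[int]_d) := zeta ^ row_val E (lat_act g t) (npart g).

Lemma rhoK h (v : 'rV_d) : h \in G0 -> v *m rho h *m rho h^-1%g = v.
Proof.
by move=> hG; apply: injE => x; rewrite !rhoE ?groupV // invgK conjgK.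
Qed.

Lemma hpartG g : g \in G -> hpart g \in G0.
Proof. by move=> gG; apply: (hpart_in sdG). Qed.

Lemma lat_act1 t : lat_act 1%g t = t.
Proof.
rewrite /lat_act (hpart_id sdG) ?group1 //; apply: injE => x.
by rewrite rhoE ?groupV ?group1 // invgK conjg1.
Qed.

Lemma lat_actM g h t : g \in G -> h \in G -> lat_act (g * h)%g t = lat_act g (lat_act h t).
Proof.
move=> gG hG; rewrite /lat_act (hpartM sdG) //; apply: injE => x.
by rewrite !rhoE ?groupV ?groupM ?hpartG // !invgK conjgM.
Qed.

Lemma lat_chi_neq0 g t : g \in G -> lat_chi g t != 0.
Proof. by move=> _; apply/expfz_neq0/(zeta_neq0 prim_zeta). Qed.

Lemma lat_chiM g h t : g \in G -> h \in G ->
  lat_chi (g * h)%g t = lat_chi g (lat_act h t) * lat_chi h t.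
Proof.
move=> gG hG; have [sNG sG0G nNG0] := sd_facts sdG.
have [gN hN] := (npart_in sdG gG, npart_in sdG hG).
have hNg : (npart h ^ (hpart g)^-1)%g \in N.
  by rewrite memJ_norm // groupV (subsetP nNG0) ?hpartG.
rewrite /lat_chi -expfzDr ?(zeta_neq0 prim_zeta) //.
apply: (exprz_eq_mod prim_zeta); rewrite (npartM sdG) // lat_actM //.
have := (EL (lat_act g (lat_act h t))).1 _ _ gN hNg.
rewrite [X in _ - X](_ : _ = row_val E (lat_act h t) (npart h)); last first.
  by rewrite {1}/lat_act rhoE ?groupV ?hpartG // invgK conjgKV.
by rewrite -addrA -opprD.
Qed.

Definition lat_of (m : 'X_{1..n}) : 'rV[int]_d :=
  epsilon (inhabits 0) (fun v => forall x, row_val E v x = (mexp m x)%:Z).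

Lemma lat_ofP m x : wl m -> row_val E (lat_of m) x = (mexp m x)%:Z.
Proof.
move=> /latE ex; rewrite /lat_of.
exact: (epsilon_spec (inhabits 0) (fun v => forall x, row_val E v x = (mexp m x)%:Z) ex x).
Qed.

Lemma lat_ofD m1 m2 : wl m1 -> wl m2 -> lat_of (m1 + m2)%MM = lat_of m1 + lat_of m2.
Proof.
move=> w1 w2; apply: injE => x; rewrite row_valD !lat_ofP //; last exact: wlD.
by rewrite mexpD PoszD.
Qed.

Lemma lat_of0 : lat_of 0%MM = 0.
Proof.
apply: injE => x; rewrite lat_ofP ?mexp0 //; last exact: wl0.
by rewrite /row_val mul0mx mxE.
Qed.

Lemma lat_of_mconj h m : h \in G0 -> wl m -> lat_of (mconj h m) = lat_of m *m rho h.
Proof.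
have [_ _ nNG0] := sd_facts sdG.
move=> hG wm; apply: injE => x; rewrite rhoE // !lat_ofP //; first by rewrite mexp_mconj.
by apply: wl_mconj => //; apply: (subsetP nNG0).
Qed.

Lemma lat_of_inj m1 m2 : wl m1 -> wl m2 -> lat_of m1 = lat_of m2 -> m1 = m2.
Proof.
move=> w1 w2 E12; apply: mexp_inj => x.
by apply/eqP; rewrite -eqz_nat -!lat_ofP // E12.
Qed.

Section Values.
Variable y : 'rV[int]_d -> F.
Hypothesis yE : equivariant G iota EF b lat_act lat_chi y.
Hypothesis y_neq0 : forall w, w \in I -> y w.1 != 0.

Definition lat_val (v : 'rV[int]_d) := \prod_(w <- I) y w.1 ^ (v *m w.2) 0 0.

Lemma lat_val_in v : EF (lat_val v).
Proof.
have sE := gf_sub gfF; apply: subfield_prod => // w _; have Ey := yE.1 w.1.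
case: ((v *m w.2) 0 0) => i; first by apply: subfieldX.
by apply: subfieldV => //; apply: subfieldX.
Qed.

Lemma lat_valD v w : lat_val (v + w) = lat_val v * lat_val w.
Proof.
rewrite /lat_val -big_split /= big_seq [RHS]big_seq; apply: eq_bigr => u uI.
by rewrite mulmxDl mxE expfzDr ?y_neq0.
Qed.

Lemma lat_val_act g v : g \in G ->
  b g (lat_val (v *m rho (hpart g))) = iota (zeta ^ row_val E v (npart g)) * lat_val v.
Proof.
move=> gG; have hG := hpartG gG; set h := hpart g in hG *.
rewrite /lat_val rmorph_prod /=.
have by_ w : b g (y w.1 ^ (v *m rho h *m w.2) 0 0) =
    iota (zeta ^ (row_val E (lat_act g w.1) (npart g) * (v *m rho h *m w.2) 0 0)) *
    y (lat_act g w.1) ^ (v *m rho h *m w.2) 0 0.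
  by rewrite fmorphXz yE.2 // expfzMl -fmorphXz exprz_exp.
under eq_bigr do rewrite by_.
rewrite big_split /=; congr (_ * _).
  rewrite -rmorph_prod /=; congr (iota _).
  rewrite -(big_morph (fun i => zeta ^ i) (fun i j => expfzDr i j (zeta_neq0 prim_zeta)) (expr0z _)).
  congr (_ ^ _).
  have row_valZ c u x : row_val E (c *: u) x = c * row_val E u x.
    by rewrite /row_val -scalemxAl mxE.
  have row_val0 x : row_val E 0 x = 0 by rewrite /row_val mul0mx mxE.
  have row_val_sum (f : 'rV_d * 'cV_d -> 'rV_d) x :
      row_val E (\sum_(w <- I) f w) x = \sum_(w <- I) row_val E (f w) x.
    by apply: (big_morph (fun u => row_val E u x)) => // ? ?; rewrite row_valD.
  transitivity (row_val E (\sum_(w <- I) (v *m rho h *m w.2) 0 0 *: lat_act g w.1) (npart g)).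
    by rewrite row_val_sum; apply: eq_bigr => w _; rewrite row_valZ mulrC.
  congr (row_val E _ _).
  transitivity (v *m rho h *m (\sum_(w <- I) w.2 *m w.1) *m rho h^-1%g); last first.
    by rewrite sumI mulmx1 rhoK.
  rewrite mulmx_sumr mulmx_suml; apply: eq_bigr => w _.
  rewrite /lat_act -/h !mulmxA -[in RHS]mulmxA [X in _ = X *m _]mx11_scalar.
  by rewrite mul_scalar_mx.
have inv := invI (groupVr hG); rewrite invgK in inv.
rewrite -[RHS](perm_big _ inv) big_map /=; apply: eq_bigr => w _.
by rewrite /pair_act /lat_act -/h /= mulmxA.
Qed.

Variables (Phi : fieldType) (iotaP : {rmorphism k -> Phi}) (Om : Phi -> Prop).
Variable a : gT -> {rmorphism Phi -> Phi}.
Variables (O0 : Phi -> Prop) (Psi0 : Phi -> F).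
Hypothesis pl0 : gplace G0 iotaP Om a iota (fixed_by N EF b) b O0 Psi0.
Local Notation S := {mpoly Phi[n]}.
Local Notation RO := (Rp N e O0).
Local Notation sig := (sig N G0 zeta iotaP a).

Let O0_0 := gplace0 pl0.
Let O0_1 := gplace1 pl0.

Lemma O0_sum T (r : seq T) (P : pred T) (f : T -> Phi) :
  (forall i, P i -> O0 (f i)) -> O0 (\sum_(i <- r | P i) f i).
Proof.
move=> Of; apply: big_ind => //; first by case: O0_0.
by move=> u v Ou Ov; have [] := pl_D pl0 Ou Ov.
Qed.

Lemma ROD p q : RO p -> RO q -> RO (p + q).
Proof.
move=> Rp_ Rq m; have [[Op wp] [Oq wq]] := (Rp_ m, Rq m); rewrite mcoeffD; split.
  by have [] := pl_D pl0 Op Oq.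
move=> nz; have [p0|/wp//] := eqVneq p@_m 0; apply: wq; apply: contraNneq nz => q0.
by rewrite p0 q0 addr0.
Qed.

Lemma ROM p q : RO p -> RO q -> RO (p * q).
Proof.
move=> Rp_ Rq m; rewrite mcoeffM; split.
  by apply: O0_sum => i _; have [] := pl_M pl0 (Rp_ i.1).1 (Rq i.2).1.
move=> nz; apply: NNPP => nw; case/eqP: nz; rewrite big1 // => i /eqP Em.
have [p0|/(Rp_ _).2 wp] := eqVneq p@_i.1 0; first by rewrite p0 mul0r.
have [q0|/(Rq _).2 wq] := eqVneq q@_i.2 0; first by rewrite q0 mulr0.
by case: nw; rewrite Em; apply: wlD.
Qed.

Lemma ROZX c m : O0 c -> wl m -> RO (c *: 'X_[m]).
Proof.
move=> Oc wm m'; rewrite mcoeffZ mcoeffX; split.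
  by case: eqP => _; rewrite ?mulr1 ?mulr0 //; case: O0_0.
have [<-|_] := eqVneq m m'; first by move=> _.
by rewrite mulr0 eqxx.
Qed.

Lemma RO0 : RO 0.
Proof. by move=> m; rewrite mcoeff0 eqxx; split => //; case: O0_0. Qed.

Lemma RO_sum T (r : seq T) (P : pred T) (f : T -> S) :
  (forall i, P i -> RO (f i)) -> RO (\sum_(i <- r | P i) f i).
Proof. by move=> Rf; apply: big_ind => //; [apply: RO0|apply: ROD]. Qed.

Lemma ROC c : O0 c -> RO c%:MP.
Proof. by move=> Oc; rewrite -[c%:MP]mulr1 mul_mpolyC -mpolyX0; apply: ROZX => //; apply: wl0. Qed.

Definition mon_val m := lat_val (lat_of m).

Definition ev (p : S) : F := \sum_(m <- msupp p) Psi0 p@_m * mon_val m.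

Lemma ev_sub p (s : seq 'X_{1..n}) : uniq s -> {subset msupp p <= s} ->
  ev p = \sum_(m <- s) Psi0 p@_m * mon_val m.
Proof.
move=> us ps; rewrite [RHS](bigID (fun m => m \in msupp p)) /= [X in _ + X]big1 ?addr0.
  rewrite -[RHS]big_filter; apply: perm_big; apply: uniq_perm; rewrite ?filter_uniq //.
  by move=> m; rewrite mem_filter; have [/ps->|//] := boolP (m \in msupp p).
by move=> m /memN_msupp_eq0->; rewrite O0_0.2 mul0r.
Qed.

Lemma ev0 : ev 0 = 0.
Proof. by rewrite /ev msupp0 big_nil. Qed.

Lemma evD p q : RO p -> RO q -> ev (p + q) = ev p + ev q.
Proof.
move=> Rp_ Rq; pose s := undup (msupp p ++ msupp q).
have sub r : {subset msupp r <= msupp p ++ msupp q} -> {subset msupp r <= s}.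
  by move=> h m /h; rewrite mem_undup.
rewrite !(@ev_sub _ s) ?undup_uniq //; try apply: sub.
- rewrite -big_split /=; apply: eq_bigr => m _; rewrite mcoeffD.
  by have [_ ->] := pl_D pl0 (Rp_ m).1 (Rq m).1; rewrite mulrDl.
- by move=> m mq; rewrite mem_cat mq orbT.
- by move=> m mp; rewrite mem_cat mp.
exact: msuppD_le.
Qed.

Lemma ev_sum T (r : seq T) (f : T -> S) : (forall i, RO (f i)) ->
  ev (\sum_(i <- r) f i) = \sum_(i <- r) ev (f i).
Proof.
move=> Rf; elim: r => [|i r IHr]; first by rewrite !big_nil ev0.
by rewrite !big_cons evD ?IHr //; apply: RO_sum.
Qed.

Lemma evZX c m : ev (c *: 'X_[m]) = Psi0 c * mon_val m.
Proof.
have [->|nzc] := eqVneq c 0; first by rewrite scale0r ev0 O0_0.2 mul0r.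
by rewrite /ev msuppMCX // big_seq1 mcoeffZ mcoeffX eqxx mulr1.
Qed.

Lemma mon_val0 : mon_val 0%MM = 1.
Proof. by rewrite /mon_val lat_of0 /lat_val big1 // => w _; rewrite mul0mx mxE expr0z. Qed.

Lemma evC c : ev c%:MP = Psi0 c.
Proof. by rewrite -[c%:MP]mulr1 mul_mpolyC -mpolyX0 evZX mon_val0 mulr1. Qed.

Lemma ROterm p m : RO p -> RO (p@_m *: 'X_[m]).
Proof.
move=> Rp_; have [Op wm] := Rp_ m; have [->|/wm] := eqVneq p@_m 0; last exact: ROZX.
by rewrite scale0r; apply: RO0.
Qed.

Lemma evM p q : RO p -> RO q -> ev (p * q) = ev p * ev q.
Proof.
move=> Rp_ Rq; have Rt m1 m2 : RO ((p@_m1 *: 'X_[m1]) * (q@_m2 *: 'X_[m2])).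
  by apply: ROM; apply: ROterm.
rewrite {1}[p]mpolyE mulr_suml ev_sum => [|m1]; last by apply: ROM => //; apply: ROterm.
rewrite [ev p]/ev mulr_suml; apply: eq_bigr => m1 _.
rewrite {1}[q]mpolyE mulr_sumr ev_sum // /ev mulr_sumr; apply: eq_bigr => m2 _.
rewrite -/(ev _) -scalerAl -scalerAr scalerA -mpolyXD evZX.
have [_ ->] := pl_M pl0 (Rp_ m1).1 (Rq m2).1.
have [p0|/(Rp_ _).2 w1] := eqVneq p@_m1 0; first by rewrite p0 O0_0.2 !mul0r.
have [q0|/(Rq _).2 w2] := eqVneq q@_m2 0; first by rewrite q0 O0_0.2 !(mulr0, mul0r).
by rewrite /mon_val lat_ofD // lat_valD mulrACA.
Qed.

Lemma ev_in p : RO p -> EF (ev p).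
Proof.
move=> Rp_; have sE := gf_sub gfF; apply: subfield_sum => // m _.
by apply: subfieldM => //; [case: (pl_val pl0 (Rp_ m).1)|apply: lat_val_in].
Qed.

Lemma RO_sig g p : g \in G -> RO p -> RO (sig g p).
Proof.
have [_ _ nNG0] := sd_facts sdG.
move=> gG Rp_ m; rewrite mcoeff_sig; have hG := hpartG gG; split.
  rewrite -rmorphXn; have [Oz _] := pl_k pl0 (zeta ^+ mexp m (npart g)).
  have [Oa _] := pl_act pl0 hG (Rp_ (mconj (hpart g) m)).1.
  by have [] := pl_M pl0 Oz Oa.
rewrite mulf_eq0 negb_or fmorph_eq0 => /andP[_ /(Rp_ _).2 wm].
have := wl_mconj (_ : (hpart g)^-1%g \in 'N(N)%g) wm.
by rewrite groupV -mconjM mulgV mconj1; apply; apply: (subsetP nNG0).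
Qed.

Lemma ev_sig g p : g \in G -> RO p -> ev (sig g p) = b g (ev p).
Proof.
have [sNG sG0G nNG0] := sd_facts sdG.
move=> gG Rp_; have hG := hpartG gG; have uN := npart_in sdG gG.
rewrite {1}[p]mpolyE rmorph_sum ev_sum => [|m]; last by apply: RO_sig => //; apply: ROterm.
rewrite /ev rmorph_sum; apply: eq_bigr => m0 _ /=.
rewrite -/(ev _); set c := p@_m0; have [c0|nzc] := eqVneq c 0.
  by rewrite c0 scale0r raddf0 ev0 O0_0.2 mul0r rmorph0.
have [Oc wm0] := Rp_ m0; have {}wm0 := wm0 nzc.
set h := hpart g in hG *; set u := npart g in uN *.
pose m' := mconj h^-1%g m0.
have m0E : m0 = mconj h m' by rewrite /m' -mconjM mulVg mconj1.
have wm' : wl m' by apply: wl_mconj => //; rewrite groupV (subsetP nNG0).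
have -> : sig g (c *: 'X_[m0]) = (iotaP (zeta ^+ mexp m' u) * a h c) *: 'X_[m'].
  apply/mpolyP => m; rewrite mcoeff_sig !mcoeffZ !mcoeffX -/h -/u.
  have -> : (m0 == mconj h m) = (m' == m).
    apply/eqP/eqP => [E0|<-//]; by rewrite /m' E0 -mconjM mulgV mconj1.
  case: eqVneq => [<-|_]; first by rewrite !mulr1 rmorphXn.
  by rewrite !mulr0 rmorph0 mulr0.
rewrite evZX rmorphM /=.
have [Oz Ez] := pl_k pl0 (zeta ^+ mexp m' u).
have [Oa Ea] := pl_act pl0 hG Oc.
have [_ ->] := pl_M pl0 Oz Oa.
have bgE : b g (Psi0 c) = Psi0 (a h c).
  have [EP fP] := pl_val pl0 Oc; have [_ fa] := pl_val pl0 Oa.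
  have uG : u \in G by apply: (subsetP sNG).
  have hG' : h \in G by apply: (subsetP sG0G).
  have -> : g = (u * h)%g by apply: divgr_eq.
  by rewrite (gf_mul gfF) // -Ea fa.
rewrite bgE Ez {2}/mon_val m0E (lat_of_mconj hG wm') lat_val_act // lat_ofP //.
by rewrite -m0E -/c -/u /mon_val -mulrA mulrCA.
Qed.

Variable b1 : gT -> {rmorphism {fraction S} -> {fraction S}}.
Hypothesis b1E : forall g x, b1 g x%:F = (sig g x)%:F.

Definition O1 (x : {fraction S}) :=
  exists p q, [/\ RO p, RO q, ev q != 0 & x = p%:F / q%:F].

Definition Psi1 (x : {fraction S}) : F := epsilon (inhabits 0) (fun c =>
  exists p q, [/\ RO p, RO q, ev q != 0, x = p%:F / q%:F & c = ev p / ev q]).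

Lemma ev_neq0 q : ev q != 0 -> q != 0.
Proof. by apply: contraNneq => ->; rewrite ev0. Qed.

Lemma Psi1E p q : RO p -> RO q -> ev q != 0 -> Psi1 (p%:F / q%:F) = ev p / ev q.
Proof.
move=> Rp_ Rq nzq.
have [|p' [q' [Rp' Rq' nzq' Ex Ec]]] := epsilon_spec (inhabits 0) (fun c =>
  exists p' q', [/\ RO p', RO q', ev q' != 0, p%:F / q%:F = p'%:F / q'%:F & c = ev p' / ev q']).
  by exists (ev p / ev q), p, q.
rewrite /Psi1 Ec; apply/eqP; rewrite eqr_div // -!evM //.
move/eqP: Ex; rewrite eqr_div ?tofrac_eq0 ?ev_neq0 // -!tofracM tofrac_eq => /eqP E0.
by rewrite -E0.
Qed.

Lemma gplace_Om1 : gplace G (iota1 gT iotaP) (Om1 N e Om) b1 iota EF b O1 Psi1.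
Proof.
have RO_Rp p : RO p -> Rp N e Om p.
  by move=> Rp_ m; have [Op wm] := Rp_ m; split => //; apply: (pl_sub pl0).
have RO1 : RO 1 by rewrite -mpolyC1; apply: ROC; case: O0_1.
have ev1 : ev 1 = 1 by rewrite -mpolyC1 evC; case: O0_1.
have O1_tofrac p : RO p -> O1 p%:F /\ Psi1 p%:F = ev p.
  move=> Rp_; have -> : p%:F = p%:F / 1%:F :> {fraction S} by rewrite tofrac1 divr1.
  split; last by rewrite Psi1E ?ev1 ?oner_neq0 ?divr1.
  by exists p, 1; rewrite ev1 oner_neq0.
have evq0 p q : RO p -> RO q -> ev p != 0 -> ev q != 0 -> ev (p * q) != 0.
  by move=> Rp_ Rq nzp nzq; rewrite evM // mulf_neq0.
split.
- by move=> _ [p [q [/RO_Rp Rp_ /RO_Rp Rq /ev_neq0 nzq ->]]]; exists p, q.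
- move=> c; have [Oc Ec] := pl_k pl0 c; rewrite iota1E.
  by have [O1c ->] := O1_tofrac _ (ROC Oc); rewrite evC.
- move=> _ _ [p [q [Rp_ Rq nzq ->]]] [p' [q' [Rp' Rq' nzq' ->]]].
  have R1 := ROM Rp_ Rq'; have R2 := ROM Rp' Rq; have R3 := ROM Rq Rq'.
  have -> : p%:F / q%:F + p'%:F / q'%:F = (p * q' + p' * q)%:F / (q * q')%:F :> {fraction S}.
    by rewrite addf_div ?tofrac_eq0 ?ev_neq0 // -!tofracM -tofracD.
  split; first by exists (p * q' + p' * q), (q * q'); split; rewrite ?evq0 //; apply: ROD.
  by rewrite !Psi1E ?evq0 ?evD ?evM //; [rewrite addf_div | apply: ROD].
- move=> _ _ [p [q [Rp_ Rq nzq ->]]] [p' [q' [Rp' Rq' nzq' ->]]].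
  have R1 := ROM Rp_ Rp'; have R3 := ROM Rq Rq'.
  have -> : p%:F / q%:F * (p'%:F / q'%:F) = (p * p')%:F / (q * q')%:F :> {fraction S}.
    by rewrite mulf_div -!tofracM.
  split; first by exists (p * p'), (q * q'); rewrite evq0.
  by rewrite !Psi1E ?evq0 ?evM // mulf_div.
- move=> g _ gG [p [q [Rp_ Rq nzq ->]]].
  have R1 := RO_sig gG Rp_; have R2 := RO_sig gG Rq.
  have nz2 : ev (sig g q) != 0 by rewrite ev_sig // fmorph_eq0.
  rewrite fmorph_div /= !b1E; split; first by exists (sig g p), (sig g q).
  by rewrite !Psi1E // !ev_sig // fmorph_div.
move=> _ [p [q [Rp_ Rq nzq ->]]]; rewrite Psi1E //.
by apply: (subfield_div (gf_sub gfF)); apply: ev_in.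
Qed.
End Values.

Section Density.
Variables (Phi : fieldType) (O0 : Phi -> Prop) (Psi0 : Phi -> F).
Hypothesis Psi00 : Psi0 0 = 0.
Local Notation S := {mpoly Phi[n]}.
Local Notation RO := (Rp N e O0).

Lemma exists_equivariant_ev (qs : seq S) :
  (forall q, q \in qs -> RO q) ->
  (forall q, q \in qs -> exists m, Psi0 q@_m != 0) ->
  exists y, [/\ equivariant G iota EF b lat_act lat_chi y,
    forall w, w \in I -> y w.1 != 0 & forall q, q \in qs -> ev y Psi0 q != 0].
Proof.
move=> Rqs nzqs; pose ts := undup (map fst I); pose r := size ts.
pose t (i : 'I_r) := nth 0 ts i.
have inj_t : injective t.
  move=> i j /eqP; rewrite nth_uniq ?undup_uniq ?ltn_ord // => /eqP.
  exact: val_inj.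
have tI w : w \in I -> exists i, w.1 = t i.
  move=> wI; have wt : w.1 \in ts by rewrite mem_undup map_f.
  have lti : (index w.1 ts < r)%N by rewrite index_mem.
  by exists (Ordinal lti); rewrite /t nth_index.
pose al (v : 'rV[int]_d) (i : 'I_r) : int := \sum_(w <- I | w.1 == t i) (v *m w.2) 0 0.
have al_v v : v = \sum_i al v i *: t i.
  under eq_bigr do rewrite scaler_suml.
  rewrite (exchange_big_dep xpredT) //= -{1}[v]mulmx1 -sumI mulmx_sumr.
  rewrite big_seq [RHS]big_seq; apply: eq_bigr => w wI.
  have [i Ei] := tI w wI; rewrite (bigD1 i) ?Ei //= big1 ?addr0.
    by rewrite mulmxA [X in X *m _]mx11_scalar mul_scalar_mx.
  move=> j /andP[/eqP/inj_t->]; rewrite eqxx //.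
have lat_val_al y v : (forall w, w \in I -> y w.1 != 0) ->
    lat_val y v = \prod_i y (t i) ^ al v i.
  move=> nzy; have nzt i : y (t i) != 0.
    have : t i \in ts by apply: mem_nth.
    by rewrite mem_undup => /mapP[w wI ->]; apply: nzy.
  under [RHS]eq_bigr => i _.
    rewrite /al (big_morph (fun j => y (t i) ^ j) (fun j l => expfzDr j l (nzt i)) (expr0z _)); over.
  rewrite [RHS](exchange_big_dep xpredT) //= /lat_val big_seq [RHS]big_seq.
  apply: eq_bigr => w wI; have [i Ei] := tI w wI; rewrite (bigD1 i) ?Ei //= big1 ?mulr1 //.
  by move=> j /andP[/eqP/inj_t->]; rewrite eqxx.
pose K := (\sum_(q <- qs) \sum_(m <- msupp q) \sum_i absz (al (lat_of m) i))%N.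
have leK q m i : q \in qs -> m \in msupp q -> (0 <= al (lat_of m) i + K%:Z)%R.
  move=> qq mq; have : (absz (al (lat_of m) i) <= K)%N.
    rewrite /K (big_rem q) //= (big_rem m) //= (bigD1 i) //=; lia.
  lia.
pose ex m : 'X_{1..r} := [multinom absz (al (lat_of m) i + K%:Z)%R | i < r].
have exE q m i : q \in qs -> m \in msupp q -> (ex m i)%:Z = al (lat_of m) i + K%:Z.
  by move=> qq mq; rewrite mnmE gez0_abs // (leK q).
pose P q : {mpoly F[r]} := \sum_(m <- msupp q) Psi0 q@_m *: 'X_[ex m].
have PE q y : q \in qs -> (forall w, w \in I -> y w.1 != 0) -> (forall i, y (t i) != 0) ->
    (P q).@[fun i => y (t i)] = (\prod_i y (t i) ^+ K) * ev y Psi0 q.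
  move=> qq nzy nzt; rewrite raddf_sum /ev mulr_sumr /= big_seq [RHS]big_seq.
  apply: eq_bigr => m mq; rewrite mevalZ mevalX mulrCA; congr (_ * _).
  rewrite /mon_val lat_val_al // -big_split /=; apply: eq_bigr => i _.
  by rewrite [LHS]exprnP (exE q) // expfzDr ?nzt // mulrC.
have nzP q : q \in qs -> P q != 0.
  move=> qq; have [m0 nz0] := nzqs q qq.
  have m0q : m0 \in msupp q.
    by apply: contraR nz0 => /memN_msupp_eq0->; rewrite Psi00.
  apply: contraNneq nz0 => P0; have : (P q)@_(ex m0) = 0 by rewrite P0 mcoeff0.
  rewrite raddf_sum /= (bigD1_seq m0) ?msupp_uniq //= mcoeffZ mcoeffX eqxx mulr1.
  rewrite big_seq_cond big1 ?addr0 => [->//|m /andP[mq ne]].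
  rewrite mcoeffZ mcoeffX; case: eqVneq => [E0|_]; last by rewrite mulr0.
  case/eqP: ne; apply: lat_of_inj.
  - by apply: (Rqs q qq m).2; rewrite -mcoeff_msupp.
  - by apply: (Rqs q qq m0).2; rewrite -mcoeff_msupp.
  rewrite (al_v (lat_of m)) (al_v (lat_of m0)); apply: eq_bigr => i _; congr (_ *: _).
  by apply: (addIr K%:Z); rewrite -!(exE q) // E0.
pose PP : {mpoly F[r]} := (\prod_(q <- qs) P q) * \prod_i 'X_i.
have nzPP : PP != 0.
  rewrite mulf_neq0 //; last by apply/prodf_neq0 => i _; rewrite -msupp_eq0 msuppX.
  by rewrite prodf_seq_neq0; apply/allP => q qq; apply/implyP => _; apply: nzP.
have [y yE] := equivariant_dense gfF lat_act1 lat_actM lat_chi_neq0 lat_chiM inf_k inj_t nzPP.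
rewrite rmorphM !rmorph_prod /= mulf_eq0 negb_or prodf_seq_neq0 => /andP[/allP nz1 /prodf_neq0 nz2].
have nzt i : y (t i) != 0 by have := nz2 i isT; rewrite mevalXU.
have nzI w : w \in I -> y w.1 != 0 by move=> wI; have [i ->] := tI w wI.
exists y; split => // q qq; have := nz1 q qq; rewrite /= PE // mulf_eq0 negb_or.
by case/andP.
Qed.
End Density.
End MonomialEvaluation.

Definition dense_gfield (k : fieldType) (gT : finGroupType) (G : {group gT})
    (F : fieldType) (iota : {rmorphism k -> F}) (E : F -> Prop)
    (b : gT -> {rmorphism F -> F}) :=
  forall (F' : fieldType) (iota' : {rmorphism k -> F'}) E' b',
    gfield G iota' E' b' -> forall s : seq F, (forall x, x \in s -> E x) ->
  exists O Psi, gplace G iota E b iota' E' b' O Psi /\ forall x, x \in s -> O x.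

Definition rational_dense (k : fieldType) (gT : finGroupType) (G : {group gT}) :=
  exists (F : fieldType) (iota : {rmorphism k -> F}) E b,
    [/\ gfield G iota E b,
        exists m (X : 'I_m -> F), rational_basis iota (gf_invariant G E b) X &
        dense_gfield G iota E b].

Lemma rational_dense1 (k : fieldType) (gT : finGroupType) :
  rational_dense k (1%G : {group gT}).
Proof.
exists k, idfun, (fun=> True), (fun=> idfun); split.
- by split=> // g /set1gP->.
- exists 0, (fun i : 'I_0 => 0); split=> [[]//|p p0|x _].
    apply/mpolyP => m; rewrite mcoeff0 -p0 /mmap.
    have uniq0 (m1 m2 : 'X_{1..0}) : m1 = m2 by apply/mnmP => -[].
    have [->|nzp] := eqVneq p 0; first by rewrite mcoeff0 msupp0 big_nil.
    rewrite (bigD1_seq m) ?msupp_uniq //=; last first.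
      have := nzp; rewrite -msupp_eq0; case E: (msupp p) => [//|m1 s] _.
      by rewrite (uniq0 m m1) mem_head.
    rewrite big1 ?addr0 => [|m1 /negP[]]; last by rewrite (uniq0 m1 m).
    by rewrite /mmap1 big_ord0 mulr1.
  exists x%:MP, 1; rewrite rmorph1 oner_neq0 divr1; split => //.
  by rewrite mmapC.
move=> F' iota' E' b' gf' s _; exists (fun=> True), iota'; split=> //.
split=> // [x y _ _|x y _ _|g x g1 _|x _].
- by rewrite rmorphD.
- by rewrite rmorphM.
- by rewrite (gf_const gf').
exact: (gf_k gf').
Qed.

Lemma rational_dense_sdprod (k : fieldType) (gT : finGroupType) (N G0 G : {group gT})
    e (zeta : k) :
  (N ><| G0)%g = G -> abelian N -> Zgroup G0 -> (exponent N %| e)%N ->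
  e.-primitive_root zeta -> infinite_type k ->
  rational_dense k G0 -> rational_dense k G.
Proof.
move=> sdG cNN ZG0 expN prim_zeta inf_k [Phi [iota [Om [a [gfO [m [X rbX]] dense0]]]]].
have [sNG sG0G nNG0] := sd_facts sdG.
pose S := {mpoly Phi[#|gT|]}.
have inj_sig g : injective (@FracField.tofrac S \o sig N G0 zeta iota a g : {rmorphism S -> _}).
  by move=> x y /eqP; rewrite tofrac_eq => /eqP/(sig_inj prim_zeta).
have [b bE] := fraction_extension_family inj_sig.
exists {fraction S}, (iota1 gT iota), (Om1 N e Om), b; split.
- exact: (gfield_Om1 sdG cNN expN prim_zeta gfO bE).
- have ga1 (x : gT) : (x ^ 1^-1)%g = x by rewrite invg1 conjg1.
  have gaM (g h x : gT) : (x ^ (g * h)^-1 = (x ^ h^-1) ^ g^-1)%g by rewrite invMg conjgM.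
  have [y [y_Om y_act uM]] := equivariant_basis (ga := fun g x => (x ^ g^-1)%g) gfO ga1 gaM.
  exists (m + #|gT|)%N, (X1 e X y).
  by apply: (rational_basis_X1 sdG prim_zeta inf_k gfO bE rbX) => // j x h; apply: y_act.
move=> F' iota' E' b' gf' s Es.
have [ps [psR psE]] : exists ps : seq (S * S),
    (forall p, p \in ps -> [/\ Rp N e Om p.1, Rp N e Om p.2 & p.2 != 0]) /\
    (forall x, x \in s -> exists2 p, p \in ps & x = p.1%:F / p.2%:F).
  elim: s Es => [|x s IHs] Es; first by exists [::].
  have [|ps [psR psE]] := IHs; first by move=> z zs; apply: Es; rewrite inE zs orbT.
  have [p [q [Rp_ Rq nzq Ex]]] := Es x (mem_head _ _).
  exists ((p, q) :: ps); split=> [r|z]; rewrite inE => /predU1P[->|] //; first exact: psR.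
    by exists (p, q); rewrite ?mem_head.
  by move=> /psE[r rps Er]; exists r; rewrite // inE rps orbT.
pose co (p : S) := [seq p@_m | m <- msupp p].
pose cl p := co p.1 ++ co p.2 ++ map GRing.inv (co p.2).
pose s0 := flatten (map cl ps).
have s0Om c : c \in s0 -> Om c.
  have coR p : Rp N e Om p -> forall d, d \in co p -> Om d.
    by move=> Rp_ d /mapP[m' _ ->]; apply: (Rp_ m').1.
  move=> /flattenP[_ /mapP[p pps ->]]; have [R1 R2 _] := psR p pps.
  rewrite !mem_cat => /or3P[||/mapP[d dq ->]]; try exact: coR.
  by apply: (subfieldV (gf_sub gfO)); apply: (coR _ R2).
have [O0 [Psi0 [pl0 s0O]]] := dense0 _ _ _ _ (gfield_quotient sdG gf') s0 s0Om.
have s0p p c : p \in ps -> c \in cl p -> O0 c.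
  by move=> pps cp; apply: s0O; apply/flattenP; exists (cl p) => //; apply: map_f.
have coO (p : S) : Rp N e Om p -> (forall c, c \in co p -> O0 c) -> Rp N e O0 p.
  move=> Rp_ cO m'; split; last exact: (Rp_ m').2.
  have [m'p|/memN_msupp_eq0->] := boolP (m' \in msupp p); last by case: (gplace0 pl0).
  by apply: cO; apply: map_f.
have RO1 p : p \in ps -> Rp N e O0 p.1.
  move=> pps; have [R1 _ _] := psR p pps; apply: coO => // c cp.
  by apply: (s0p p) => //; rewrite mem_cat cp.
have RO2 p : p \in ps -> Rp N e O0 p.2.
  move=> pps; have [_ R2 _] := psR p pps; apply: coO => // c cp.
  by apply: (s0p p) => //; rewrite !mem_cat cp orbT.
have [d [E [rho [I [EL latE injE rhoE [invI sumI]]]]]] :=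
  weight_lattice_invertible (prim_order_gt0 prim_zeta) cNN expN nNG0 ZG0.
have [||q /mapP[p pps ->]|y [yE y_neq0 yq]] := @exists_equivariant_ev k gT N G0 G e zeta sdG prim_zeta inf_k
   d E rho I EL latE injE rhoE sumI F' iota' E' b' gf' Phi O0 Psi0 _ (map snd ps).
- by case: (gplace0 pl0).
- by move=> q /mapP[p pps ->]; apply: RO2.
- have [_ R2 nzq] := psR p pps.
  have := nzq; rewrite -msupp_eq0; case Eq: (msupp p.2) => [//|m0 s1] _.
  have m0q : m0 \in msupp p.2 by rewrite Eq mem_head.
  have nz0 : p.2@_m0 != 0 by rewrite -mcoeff_msupp.
  exists m0; have Oc := (RO2 p pps m0).1.
  have OV : O0 (p.2@_m0)^-1.
    by apply: (s0p p) => //; rewrite !mem_cat (map_f GRing.inv) ?orbT // (map_f (fun m => p.2@_m)).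
  have [_] := pl_M pl0 Oc OV; rewrite divff // (gplace1 pl0).2 => E1.
  by apply: contraPneq E1 => ->; rewrite mul0r; apply/eqP; rewrite oner_eq0.
exists (O1 N e E I y O0 Psi0), (Psi1 N e E I y O0 Psi0); split.
  exact: (gplace_Om1 sdG prim_zeta latE injE rhoE invI sumI gf' yE y_neq0 pl0 bE).
move=> x /psE[p pps ->]; exists p.1, p.2; split=> //; [exact: RO1|exact: RO2|].
by apply: yq; apply: (map_f snd).
Qed.

Lemma exprS_div (F : fieldType) (a b : F) t : a != 0 -> a ^+ t / b = a ^+ t.+1 / (a * b).
Proof. by move=> nza; rewrite exprS -mulf_div divff // mul1r. Qed.

Lemma exprD_div (F : fieldType) (x y a : F) i j : a != 0 ->
  x / a ^+ i + y / a ^+ j = (x * a ^+ j + y * a ^+ i) / a ^+ (i + j).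
Proof. by move=> nza; rewrite addf_div ?expf_neq0 // exprD. Qed.

Lemma exprM_div (F : fieldType) (x y a : F) i j :
  x / a ^+ i * (y / a ^+ j) = (x * y) / a ^+ (i + j).
Proof. by rewrite mulf_div exprD. Qed.

Record is_subalgebra (k F : fieldType) (iota : {rmorphism k -> F}) (A : F -> Prop) : Prop :=
  IsSubalgebra {
  subalgC : forall c, A (iota c);
  subalgD : forall x y, A x -> A y -> A (x + y);
  subalgM : forall x y, A x -> A y -> A (x * y) }.

Section Subalgebras.
Variables (k F : fieldType) (iota : {rmorphism k -> F}).

Lemma subfield_subalgebra E : is_subfield E -> (forall c, E (iota c)) -> is_subalgebra iota E.
Proof. by move=> sE Ek; split=> // x y; [apply: subfieldD|apply: subfieldM]. Qed.

Lemma subalgX A x n : is_subalgebra iota A -> A x -> A (x ^+ n).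
Proof.
move=> sA Ax; elim: n => [|n IHn]; last by rewrite exprS; apply: (subalgM sA).
by rewrite expr0 -(rmorph1 iota); apply: (subalgC sA).
Qed.

Lemma subalg_prod A I (r : seq I) (P : pred I) (f : I -> F) : is_subalgebra iota A ->
  (forall i, P i -> A (f i)) -> A (\prod_(i <- r | P i) f i).
Proof.
move=> sA Af; apply: big_ind => //; last exact: (subalgM sA).
by rewrite -(rmorph1 iota); apply: (subalgC sA).
Qed.

Lemma subalg_sum A I (r : seq I) (P : pred I) (f : I -> F) : is_subalgebra iota A ->
  (forall i, P i -> A (f i)) -> A (\sum_(i <- r | P i) f i).
Proof.
move=> sA Af; apply: big_ind => //; last exact: (subalgD sA).
by rewrite -(rmorph0 iota); apply: (subalgC sA).
Qed.

Lemma subalg_mmap A n (v : 'I_n -> F) (p : {mpoly k[n]}) :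
  is_subalgebra iota A -> (forall i, A (v i)) -> A (mmap iota v p).
Proof.
move=> sA Av; apply: subalg_sum => // m _.
apply: (subalgM sA); first exact: (subalgC sA).
by apply: subalg_prod => // i _; apply: subalgX.
Qed.

Definition adjoin (s : seq F) (a : F) :=
  exists p : {mpoly k[size s]}, a = mmap iota (fun i => s`_i) p.

Lemma adjoin_subalgebra s : is_subalgebra iota (adjoin s).
Proof.
split=> [c|_ _ [p ->] [q ->]|_ _ [p ->] [q ->]].
- by exists c%:MP; rewrite mmapC.
- by exists (p + q); rewrite rmorphD.
by exists (p * q); rewrite rmorphM.
Qed.

Lemma mem_adjoin s x : x \in s -> adjoin s x.
Proof.
move=> xs; have lti : (index x s < size s)%N by rewrite index_mem.
by exists 'X_(Ordinal lti); rewrite mmapX mmap1U nth_index.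
Qed.

Lemma adjoin_min s A : is_subalgebra iota A -> (forall x, x \in s -> A x) ->
  forall a, adjoin s a -> A a.
Proof. by move=> sA As _ [p ->]; apply: subalg_mmap => // i; apply/As/mem_nth. Qed.

Lemma adjoin_common_denominator s n (v : 'I_n -> F) :
  (forall i, exists a b, [/\ adjoin s a, adjoin s b, b != 0 & v i = a / b]) ->
  exists d, [/\ adjoin s d, d != 0 & forall i, adjoin s (v i * d)].
Proof.
move=> vE; have sA := adjoin_subalgebra s.
have /fin_all_exists[w wE] i : exists ab, [/\ adjoin s ab.1, adjoin s ab.2, ab.2 != 0 & v i = ab.1 / ab.2].
  by have [a [b ?]] := vE i; exists (a, b).
exists (\prod_i (w i).2); split.
- by apply: subalg_prod => // i _; case: (wE i).
- by apply/prodf_neq0 => i _; case: (wE i).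
move=> i; rewrite (bigD1 i) //= mulrA; have [A1 A2 nz ->] := wE i; rewrite divfK //.
by apply: (subalgM sA) => //; apply: subalg_prod => // j _; case: (wE j).
Qed.

Lemma mmap_denominator A n (v : 'I_n -> F) d (p : {mpoly k[n]}) :
  is_subalgebra iota A -> A d -> (forall i, A (v i * d)) ->
  exists l, A (mmap iota v p * d ^+ l).
Proof.
move=> sA Ad Av; elim/mpolyind: p => [|c m p _ _ [l Al]].
  by exists 0; rewrite rmorph0 mul0r -(rmorph0 iota); apply: (subalgC sA).
exists (mdeg m + l)%N; rewrite rmorphD mulrDl; apply: (subalgD sA); last first.
  by rewrite addnC exprD mulrA; apply: (subalgM sA) => //; apply: subalgX.
rewrite exprD mulrA; apply: (subalgM sA); last exact: subalgX.
rewrite -mul_mpolyC rmorphM /= mmapC mmapX -mulrA; apply: (subalgM sA); first exact: (subalgC sA).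
rewrite /mmap1 mdegE -prodrXr -big_split /=; apply: subalg_prod => // i _.
by rewrite -exprMn; apply: subalgX.
Qed.
End Subalgebras.

Section RetractCriterion.
Variables (k F : fieldType) (iota : {rmorphism k -> F}) (L : F -> Prop).
Hypotheses (sL : is_subfield L) (Lk : forall c, L (iota c)).
Variables (n : nat) (v : 'I_n -> F).
Hypothesis Lv : forall i, L (v i).
Local Notation R := {mpoly k[n]}.
Variable phi : F -> {fraction R}.
Hypothesis phiD : forall x y, L x -> L y -> phi (x + y) = phi x + phi y.
Hypothesis phiM : forall x y, L x -> L y -> phi (x * y) = phi x * phi y.
Hypothesis phiC : forall c, phi (iota c) = (c%:MP)%:F.
Local Notation val := (mmap iota v).

Definition retracted (f : R) (a : F) :=
  L a /\ exists p j, phi a = p%:F / f%:F ^+ j /\ a = val p / val f ^+ j.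

Lemma retracted_subalgebra f : val f != 0 -> is_subalgebra iota (retracted f).
Proof.
move=> nzf; have nzf' : f%:F != 0 :> {fraction R}.
  by rewrite tofrac_eq0; apply: contraNneq nzf => ->; rewrite rmorph0.
split=> [c|x y|x y].
- by split=> //; exists c%:MP, 0; rewrite !expr0 !divr1 phiC mmapC.
- move=> [Lx [p [i [Epx Ex]]]] [Ly [q [j [Epy Ey]]]]; split; first exact: subfieldD.
  exists (p * f ^+ j + q * f ^+ i), (i + j)%N.
  rewrite phiD // Epx Epy {1}Ex {1}Ey !addf_div ?expf_neq0 //.
  by rewrite !(tofracD, tofracM, tofracXn) !rmorphD !rmorphM !rmorphXn !exprD.
move=> [Lx [p [i [Epx Ex]]]] [Ly [q [j [Epy Ey]]]]; split; first exact: subfieldM.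
exists (p * q), (i + j)%N.
by rewrite phiM // Epx Epy {1}Ex {1}Ey !mulf_div !tofracM !rmorphM !exprD.
Qed.

Lemma val_cross (p q f : R) i j :
  val (p * f ^+ j + q * f ^+ i) = val p * val f ^+ j + val q * val f ^+ i.
Proof. by rewrite rmorphD !rmorphM !rmorphXn. Qed.

Lemma retract_rational_criterion (hs : seq F) :
  (forall h, h \in hs -> L h) ->
  (forall z, L z -> exists a b, [/\ adjoin iota hs a, adjoin iota hs b, b != 0 & z = a / b]) ->
  (forall h, h \in hs -> exists p q,
     [/\ val q != 0, phi h = p%:F / q%:F & h = val p / val q]) ->
  retract_rational iota L.
Proof.
move=> Lhs frac_hs hsE.
have sLk := subfield_subalgebra sL Lk.
have nz_of f : val f != 0 -> f != 0 by apply: contraNneq => ->; rewrite rmorph0.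
have [f0 nzf0 f0E] : exists2 f0, val f0 != 0 & forall h, h \in hs -> retracted f0 h.
  elim: hs Lhs hsE {frac_hs} => [|h hs IHs] Lhs hsE; first by exists 1; rewrite // rmorph1 oner_neq0.
  have [x xs|x xs|f0 nzf0 f0E] := IHs; [by apply: Lhs; rewrite inE xs orbT
    |by apply: hsE; rewrite inE xs orbT|].
  have [p [q [nzq Ep Eh]]] := hsE h (mem_head _ _).
  exists (q * f0) => [|x]; first by rewrite rmorphM mulf_neq0.
  rewrite inE => /predU1P[->|xs].
    split; first by apply/Lhs/mem_head.
    exists (p * f0), 1%N; rewrite !expr1 Ep {1}Eh !tofracM !rmorphM.
    by rewrite -!mulf_div !divff ?mulr1 // tofrac_eq0 nz_of.
  have [Lx [p' [j [Epx Ex]]]] := f0E x xs; split=> //.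
  exists (p' * q ^+ j), j; rewrite Epx {1}Ex !tofracM !tofracXn !rmorphM rmorphXn /= !exprMn.
  by rewrite ![_ * val f0 ^+ _]mulrC ![_ * f0%:F ^+ _]mulrC -!mulf_div !divff ?mulr1 ?expf_neq0 ?tofrac_eq0 ?nz_of.
have sA0 := adjoin_subalgebra iota hs.
have retr0 := adjoin_min (retracted_subalgebra nzf0) f0E.
have [d [Ad nzd dE]] := adjoin_common_denominator (fun i => frac_hs _ (Lv i)).
have [l Au] := mmap_denominator f0 sA0 Ad dE; set u := _ * _ in Au.
have nzu : u != 0 by rewrite mulf_neq0 ?expf_neq0.
have Ae : adjoin iota hs (d * u) by apply: (subalgM sA0).
have [Le [D [t [Epe Ee]]]] := retr0 _ Ae; have nze : d * u != 0 by rewrite mulf_neq0.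
have nzD : val D != 0 by move: nze; rewrite Ee; apply: contraNneq => ->; rewrite mul0r.
pose f := f0 * D; have nzf : val f != 0 by rewrite rmorphM mulf_neq0.
pose s := (d * u)^-1 :: hs; have sA := adjoin_subalgebra iota s.
have sub_s a : adjoin iota hs a -> adjoin iota s a.
  by apply: adjoin_min => // x xs; apply: mem_adjoin; rewrite inE xs orbT.
have Ve : adjoin iota s (d * u)^-1 by apply/mem_adjoin/mem_head.
have nzf0' : f0%:F != 0 :> {fraction R} by rewrite tofrac_eq0 nz_of.
have nzD' : D%:F != 0 :> {fraction R} by rewrite tofrac_eq0 nz_of.
have retr a : adjoin iota s a -> retracted f a.
  apply: adjoin_min; first exact: retracted_subalgebra.
  move=> x; rewrite inE => /predU1P[->|xs].
    have LVe : L (d * u)^-1 by apply: subfieldV.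
    have EV : (d * u)^-1 = val f0 ^+ t / val D by rewrite {1}Ee invf_div.
    have phiV : phi (d * u)^-1 = f0%:F ^+ t / D%:F.
      have E1 : phi (d * u) * phi (d * u)^-1 = 1.
        by rewrite -phiM // divff // -(rmorph1 iota) phiC mpolyC1 tofrac1.
      by rewrite -(mulr1_eq E1) Epe invf_div.
    split=> //; exists (f0 ^+ t.+1), 1%N; rewrite !expr1 phiV EV.
    have -> : val f = val f0 * val D by rewrite rmorphM.
    have -> : val (f0 ^+ t.+1) = val f0 ^+ t.+1 by rewrite rmorphXn.
    rewrite tofracXn tofracM.
    split; last by exact: (exprS_div (val D) t nzf0).
    exact: (exprS_div D%:F t nzf0').
  have [Lx [p [j [Ep Ex]]]] := f0E x xs; split=> //.
  exists (p * D ^+ j), j; rewrite Ep {1}Ex !tofracM !tofracXn !rmorphM rmorphXn /= !exprMn.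
  by rewrite -!mulf_div !divff ?mulr1 ?expf_neq0.
have Av i : adjoin iota s (v i).
  have -> : v i = v i * d * u * (d * u)^-1 by rewrite -[v i * d * u]mulrA mulfK.
  by apply: (subalgM sA) => //; apply/sub_s/(subalgM sA0).
have AVf : adjoin iota s (val f)^-1.
  have -> : (val f)^-1 = (d ^+ l.+1 * (d * u)^-1) ^+ t.+1 * (d * u)^-1.
    have -> : d ^+ l.+1 / (d * u) = (val f0)^-1.
      rewrite exprS -mulf_div divff // mul1r /u invfM mulrC divfK //.
      by rewrite expf_neq0.
    have -> : val f = val f0 * val D by rewrite rmorphM.
    rewrite Ee invf_div invfM mulrA; congr (_ * _).
    by rewrite exprS -mulrA -exprMn mulVf // expr1n mulr1.
  have Ax : adjoin iota s (d ^+ l.+1 * (d * u)^-1).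
    by apply: (subalgM sA) => //; apply/sub_s/(subalgX _ sA0).
  by apply: (subalgM sA) => //; apply: (subalgX _ sA).
pose rep z x := exists p j, z = p%:F / f%:F ^+ j /\ x = val p / val f ^+ j.
pose psi z : F := epsilon (inhabits 0) (rep z).
have nzf' : f%:F != 0 :> {fraction R} by rewrite tofrac_eq0 nz_of.
have psiE p j : psi (p%:F / f%:F ^+ j) = val p / val f ^+ j.
  rewrite /psi; have [|q [i [E ->]]] := epsilon_spec (inhabits 0) (rep (p%:F / f%:F ^+ j)).
    by exists (val p / val f ^+ j), p, j.
  apply/eqP; rewrite eqr_div ?expf_neq0 //; move/eqP: E.
  by rewrite eqr_div ?expf_neq0 // -!tofracXn -!tofracM tofrac_eq -!rmorphXn -!rmorphM => /eqP->.
exists s, n, f, phi, psi; split.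
- exact: nz_of.
- by move=> a /retr[].
- by move=> z /frac_hs[a [b [Aa Ab nzb ->]]]; exists a, b; split=> //; apply: sub_s.
split.
  split=> [a /retr[_ [p [j [E _]]]]|a b /retr[La _] /retr[Lb _]|a b /retr[La _] /retr[Lb _]|//].
  - by exists p, j.
  - exact: phiD.
  - exact: phiM.
split; last by move=> a /retr[_ [p [j [E Ea]]]]; rewrite E psiE.
split=> [_ [p [j ->]]|_ _ [p [i ->]] [q [j ->]]|_ _ [p [i ->]] [q [j ->]]|c].
- rewrite psiE; apply: (subalgM sA); first exact: subalg_mmap.
  by rewrite -exprVn; apply: (subalgX _ sA).
- rewrite (exprD_div _ _ _ _ nzf') !psiE (exprD_div _ _ _ _ nzf).
  rewrite -!tofracXn -!tofracM -tofracD [(f ^+ (i + j))%:F]tofracXn psiE.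
  by rewrite val_cross.
- rewrite (exprM_div p%:F q%:F) !psiE (exprM_div (val p)).
  by rewrite -tofracM psiE [val (p * q)]rmorphM.
by have := psiE c%:MP 0; rewrite !expr0 !divr1 mmapC.
Qed.
End RetractCriterion.

Section NoetherField.
Variables (k : fieldType) (gT : finGroupType).
Local Notation n := #|gT|.
Local Notation S := {mpoly k[n]}.
Local Notation K := (ratfun k gT).
Local Notation x_ g := ('X_(enum_rank g) : S).
Implicit Types (g h : gT) (p q : S) (z : K).
Local Notation perm_mpoly := (@perm_mpoly k gT).

Fact perm_mpoly_is_zmod_morphism g : zmod_morphism (perm_mpoly g).
Proof. exact: rmorphB. Qed.

Fact perm_mpoly_is_monoid_morphism g : monoid_morphism (perm_mpoly g).
Proof. split=> [|p q]; [exact: rmorph1|exact: rmorphM]. Qed.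

HB.instance Definition _ g := GRing.isZmodMorphism.Build _ _ (perm_mpoly g)
  (perm_mpoly_is_zmod_morphism g).
HB.instance Definition _ g := GRing.isMonoidMorphism.Build _ _ (perm_mpoly g)
  (perm_mpoly_is_monoid_morphism g).

Lemma perm_mpolyC g c : perm_mpoly g c%:MP = c%:MP.
Proof. exact: mmapC. Qed.

Lemma perm_mpolyX g h : perm_mpoly g (x_ h) = x_ (g * h)%g.
Proof. by rewrite /perm_mpoly mmapX mmap1U enum_rankK. Qed.

Lemma perm_mpolyM g h p : perm_mpoly (g * h)%g p = perm_mpoly g (perm_mpoly h p).
Proof.
apply/esym; apply: rmorph_mmap => [c|i] /=; first exact: perm_mpolyC.
by rewrite perm_mpolyX mulgA.
Qed.

Lemma perm_mpoly1 p : perm_mpoly 1%g p = p.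
Proof.
rewrite -[RHS](comp_mpoly_id p); apply: (@rmorph_mmap _ _ _ _ idfun) => // i /=.
by rewrite mul1g enum_valK tnth_mktuple.
Qed.

Lemma perm_mpoly_inj g : injective (perm_mpoly g).
Proof.
by apply: (can_inj (g := perm_mpoly g^-1%g)) => p; rewrite -perm_mpolyM mulVg perm_mpoly1.
Qed.

Lemma act_ratfun_rmorphism : exists al : gT -> {rmorphism K -> K},
  (forall g p, al g p%:F = (perm_mpoly g p)%:F) /\ forall g z, act_ratfun g z = al g z.
Proof.
have inj g : injective (@FracField.tofrac S \o perm_mpoly g : {rmorphism S -> K}).
  by move=> p q /eqP; rewrite tofrac_eq => /eqP/perm_mpoly_inj.
have [al alE] := fraction_extension_family inj.
exists al; split=> // g z.
by rewrite [in RHS](fraction_numden z) fmorph_div /= !alE.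
Qed.

Variable al : gT -> {rmorphism K -> K}.
Hypothesis alE : forall g p, al g p%:F = (perm_mpoly g p)%:F.

Definition ratfunC : {rmorphism k -> K} := @FracField.tofrac S \o @mpolyC n k.

Lemma al_mul g h z : al (g * h)%g z = al g (al h z).
Proof. by rewrite (fraction_numden z) !fmorph_div /= !alE !perm_mpolyM. Qed.

Lemma gfield_ratfun : gfield [set: gT]%G ratfunC (fun=> True) al.
Proof.
split=> // [g h z _ _ _|g c _|g _ fix_g]; first exact: al_mul.
  by rewrite /ratfunC /= alE perm_mpolyC.
have /eqP := fix_g (x_ 1%g)%:F I; rewrite alE perm_mpolyX tofrac_eq mulg1.
move/eqP/(congr1 (fun p : S => p@_U_(enum_rank g))).
rewrite !mcoeffXU eqxx; case: eqVneq => [/enum_rank_inj->//|_ /eqP].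
by rewrite oner_eq0.
Qed.

Definition perm_trace p : S := \sum_g perm_mpoly g p.

Definition orbit_poly : {poly S} := \prod_(i < n) ('X - ('X_i)%:P).

Lemma perm_mpoly_trace g p : perm_mpoly g (perm_trace p) = perm_trace p.
Proof.
rewrite /perm_trace rmorph_sum [RHS](reindex_inj (mulgI g)) /=.
by apply: eq_bigr => h _; rewrite perm_mpolyM.
Qed.

Lemma perm_trace_mull p q : (forall g, perm_mpoly g p = p) ->
  perm_trace (p * q) = p * perm_trace q.
Proof.
by move=> pE; rewrite /perm_trace mulr_sumr; apply: eq_bigr => g _; rewrite rmorphM /= pE.
Qed.

Lemma perm_trace_zmod_morphism : zmod_morphism perm_trace.
Proof.
by move=> p q; rewrite /perm_trace -sumrB; apply: eq_bigr => g _; rewrite rmorphB.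
Qed.

HB.instance Definition _ := GRing.isZmodMorphism.Build _ _ perm_trace perm_trace_zmod_morphism.

Lemma perm_mpoly_orbit_poly g j : perm_mpoly g orbit_poly`_j = orbit_poly`_j.
Proof.
suff E : map_poly (perm_mpoly g) orbit_poly = orbit_poly by rewrite -{2}E coef_map.
rewrite rmorph_prod /=.
have inj : injective (fun i : 'I_n => enum_rank (g * enum_val i)%g).
  by move=> i1 i2 /enum_rank_inj/mulgI/enum_val_inj.
rewrite [RHS](reindex_inj inj) /=; apply: eq_bigr => i _.
rewrite rmorphB /= map_polyX map_polyC /=; congr ('X - _%:P).
by rewrite -[in LHS](enum_valK i) perm_mpolyX.
Qed.

Lemma size_orbit_poly : size orbit_poly = n.+1.
Proof. by rewrite size_prod_XsubC -sum1_size big_const_ord iter_addn_0 mul1n. Qed.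

Lemma exp_orbit_poly i : 'X_i ^+ n = - \sum_(j < n) orbit_poly`_j * 'X_i ^+ j :> S.
Proof.
have root_i : orbit_poly.['X_i] = 0.
  by apply/rootP; rewrite /orbit_poly (bigD1 i) // rootM root_XsubC eqxx.
have lead : orbit_poly`_n = 1.
  have := monicP (monic_prod_XsubC (index_enum 'I_n) predT (fun i => 'X_i : S)).
  by rewrite lead_coefE size_orbit_poly.
move: root_i; rewrite horner_coef size_orbit_poly big_ord_recr /= lead mul1r.
by move/eqP; rewrite addrC addr_eq0 => /eqP.
Qed.

Definition noether_generators : seq S :=
  [seq orbit_poly`_j | j <- iota 0 n] ++
  [seq perm_trace 'X_[[multinom nat_of_ord (f i) | i < n]] | f : {ffun 'I_n -> 'I_n}].

Lemma noether_generators_fixed p g : p \in noether_generators -> perm_mpoly g p = p.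
Proof.
rewrite mem_cat => /orP[/mapP[j _ ->]|/imageP[f _ ->]].
  exact: perm_mpoly_orbit_poly.
exact: perm_mpoly_trace.
Qed.

Local Notation adjoin_gens := (adjoin ratfunC (map (@FracField.tofrac S) noether_generators)).

Lemma adjoin_trace p : adjoin_gens (perm_trace p)%:F.
Proof.
have sA := adjoin_subalgebra ratfunC (map (@FracField.tofrac S) noether_generators).
have An (q : S) : adjoin_gens q%:F ->
    adjoin_gens (- q)%:F.
  move=> Aq; rewrite -mulN1r tofracM; apply: (subalgM sA) => //.
  have -> : (-1)%:F = ratfunC (-1) by rewrite /ratfunC /= mpolyCN mpolyC1.
  exact: (subalgC sA).
elim/mpolyind: p => [|c m p _ _ IHp]; first by rewrite raddf0 tofrac0 -(rmorph0 ratfunC); apply: (subalgC sA).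
rewrite raddfD /= tofracD; apply: (subalgD sA) => // {p IHp}.
rewrite -mul_mpolyC perm_trace_mull => [|g]; last exact: perm_mpolyC.
rewrite tofracM; apply: (subalgM sA); first exact: (subalgC sA).
have [d] := ubnP (mdeg m); elim: d m => // d IHd m lemd.
have [/forallP small|] := boolP [forall i, m i < n]%N.
  apply/mem_adjoin/map_f; rewrite mem_cat; apply/orP; right.
  pose f := [ffun i => Ordinal (small i)]; apply/imageP; exists f => //.
  by congr (perm_trace 'X_[_]); apply/mnmP => i; rewrite mnmE ffunE.
rewrite negb_forall => /existsP[i]; rewrite -leqNgt => lenm.
have -> : 'X_[m] = 'X_i ^+ n * 'X_[m - U_(i) *+ n] :> S.
  rewrite mpolyXn -mpolyXD; congr 'X_[_]; apply/mnmP => j.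
  rewrite mnmDE mnmBE mulmnE mnm1E; case: eqVneq => [<-|_]; last by rewrite !mul0n subn0.
  by rewrite mul1n subnKC.
rewrite exp_orbit_poly mulNr raddfN /=; apply: An.
rewrite mulr_suml (raddf_sum perm_trace) rmorph_sum /=; apply: (subalg_sum _ sA) => j _.
rewrite -mulrA perm_trace_mull => [|g]; last exact: perm_mpoly_orbit_poly.
rewrite tofracM; apply: (subalgM sA).
  apply/mem_adjoin/map_f; rewrite mem_cat; apply/orP; left.
  by apply/mapP; exists (nat_of_ord j) => //; rewrite mem_iota /= ltn_ord.
rewrite mpolyXn -mpolyXD; apply: IHd; rewrite ltnS in lemd; apply: leq_trans lemd.
rewrite mdegD mdegMn mdeg1 mul1n.
have {2}<- : (m - U_(i) *+ n + U_(i) *+ n)%MM = m.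
  apply/mnmP => l; rewrite mnmDE mnmBE mulmnE mnm1E; case: eqVneq => [<-|_].
    by rewrite mul1n subnK.
  by rewrite !mul0n subn0 addn0.
by rewrite mdegD mdegMn mdeg1 mul1n addnC ltn_add2l.
Qed.

Lemma noether_field_fraction z : (forall g, al g z = z) -> exists a b,
  [/\ adjoin_gens a, adjoin_gens b,
      b != 0 & z = a / b].
Proof.
move=> fix_z; set p := \n_(repr z); set q := \d_(repr z).
have nzq : q != 0 by apply: denom_ratioP.
have Dz : z = p%:F / q%:F by apply: fraction_numden.
pose w := (\prod_(g | g != 1%g) perm_mpoly g q) * x_ 1%g.
have nz_tr : perm_trace (q * w) != 0.
  have -> : q * w = (\prod_g perm_mpoly g q) * x_ 1%g.
    by rewrite mulrA [in RHS](bigD1 1%g) //= perm_mpoly1.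
  rewrite perm_trace_mull => [|h]; last first.
    rewrite rmorph_prod [RHS](reindex_inj (mulgI h)) /=.
    by apply: eq_bigr => g _; rewrite perm_mpolyM.
  apply: mulf_neq0.
    apply/prodf_neq0 => g _; apply: contraNneq nzq => q0.
    by rewrite -(inj_eq (@perm_mpoly_inj g)) q0 rmorph0.
  apply: contraTneq (oner_neq0 k) => tr0; rewrite negbK.
  have := congr1 (mcoeff U_(enum_rank (1%g : gT))) tr0; rewrite mcoeff0 => <-.
  rewrite /perm_trace raddf_sum /= (bigD1 1%g) //= perm_mpoly1 mcoeffXU eqxx big1 ?addr0 //.
  move=> g ne; rewrite perm_mpolyX mulg1 mcoeffXU (inj_eq enum_rank_inj) (negPf ne) //.
exists (perm_trace (p * w))%:F, (perm_trace (q * w))%:F; split; try exact: adjoin_trace.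
  by rewrite tofrac_eq0.
have alTr r : (perm_trace r)%:F = \sum_g al g r%:F.
  by rewrite rmorph_sum; apply: eq_bigr => g _; rewrite alE.
apply: (canRL (mulfK _)); first by rewrite tofrac_eq0.
rewrite !alTr mulr_sumr; apply: eq_bigr => g _.
by rewrite -{1}(fix_z g) -rmorphM tofracM mulrA Dz divfK ?tofrac_eq0 // -tofracM.
Qed.
End NoetherField.

Lemma mcoeff_mmap_closed (k R : comNzRingType) (A : R -> Prop) (h : {rmorphism k -> R})
    n m (v : 'I_n -> {mpoly R[m]}) (p : {mpoly k[n]}) :
  (forall x y, A x -> A y -> A (x + y)) -> (forall x y, A x -> A y -> A (x * y)) ->
  (forall c, A (h c)) -> (forall i mu, A (v i)@_mu) ->
  forall mu, A (mmap (@mpolyC m R \o h) v p)@_mu.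
Proof.
move=> AD AM Ah Av.
have A0 : A 0 by rewrite -(rmorph0 h).
have A1 : A 1 by rewrite -(rmorph1 h).
pose ov (q : {mpoly R[m]}) := forall mu, A q@_mu.
have ovD q r : ov q -> ov r -> ov (q + r) by move=> Aq Ar mu; rewrite mcoeffD; apply: AD.
have ovM q r : ov q -> ov r -> ov (q * r).
  by move=> Aq Ar mu; rewrite mcoeffM; apply: big_ind => // i _; apply: AM.
have ovC c : A c -> ov c%:MP.
  by move=> Ac mu; rewrite mcoeffC; case: eqP; rewrite ?mulr1 ?mulr0.
have ov0 : ov 0 by move=> mu; rewrite mcoeff0.
have ov1 : ov 1 by rewrite -mpolyC1; apply: ovC.
have ovv i : ov (v i) by apply: Av.
have ovh c : ov (h c)%:MP by apply: ovC.
suff: ov (mmap (@mpolyC m R \o h) v p) by [].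
clearbody ov; rewrite /mmap. apply: (big_ind ov) => // mu _.
apply: (ovM); first exact: ovh.
apply: (big_ind ov ov1 ovM) => i _.
elim: (mu i) => [|e IHe]; first by rewrite expr0.
by rewrite exprS; apply: ovM.
Qed.

Section PlaceTheory.
Variables (k : fieldType) (gT : finGroupType) (G : {group gT}).
Variables (F1 : fieldType) (iota1 : {rmorphism k -> F1}) (E1 : F1 -> Prop).
Variables (b1 : gT -> {rmorphism F1 -> F1}) (F2 : fieldType) (iota2 : {rmorphism k -> F2}).
Variables (E2 : F2 -> Prop) (b2 : gT -> {rmorphism F2 -> F2}) (O : F1 -> Prop) (Psi : F1 -> F2).
Hypothesis pl : gplace G iota1 E1 b1 iota2 E2 b2 O Psi.

Definition place_graph (c : F1 * F2) := O c.1 /\ Psi c.1 = c.2.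

Lemma place_graphD c d : place_graph c -> place_graph d -> place_graph (c + d).
Proof. by move=> [Oc Ec] [Od Ed]; have [O_ E_] := pl_D pl Oc Od; split; rewrite /= ?E_ ?Ec ?Ed. Qed.

Lemma place_graphM c d : place_graph c -> place_graph d -> place_graph (c * d).
Proof. by move=> [Oc Ec] [Od Ed]; have [O_ E_] := pl_M pl Oc Od; split; rewrite /= ?E_ ?Ec ?Ed. Qed.

Lemma gplace_sum I (r : seq I) (f : I -> F1) : (forall i, O (f i)) ->
  O (\sum_(i <- r) f i) /\ Psi (\sum_(i <- r) f i) = \sum_(i <- r) Psi (f i).
Proof.
move=> Of; elim: r => [|i r [IHO IHE]]; first by rewrite !big_nil; apply: (gplace0 pl).
by rewrite !big_cons; have [O_ ->] := pl_D pl (Of i) IHO; rewrite IHE.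
Qed.

Definition pair_const (c : k) : F1 * F2 := (iota1 c, iota2 c).

Fact pair_const_is_zmod_morphism : zmod_morphism pair_const.
Proof. by move=> x y; rewrite /pair_const !rmorphB. Qed.

Fact pair_const_is_monoid_morphism : monoid_morphism pair_const.
Proof. by split=> [|x y]; rewrite /pair_const ?rmorph1 ?rmorphM. Qed.

HB.instance Definition _ := GRing.isZmodMorphism.Build _ _ pair_const
  pair_const_is_zmod_morphism.
HB.instance Definition _ := GRing.isMonoidMorphism.Build _ _ pair_const
  pair_const_is_monoid_morphism.

Lemma gplace_mmap m (X : 'I_m -> F1) (p : {mpoly k[m]}) : (forall i, O (X i)) ->
  O (mmap iota1 X p) /\ Psi (mmap iota1 X p) = mmap iota2 (Psi \o X) p.
Proof.
move=> OX; pose q := mmap pair_const (fun i => (X i, Psi (X i)) : F1 * F2) p.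
have E1q : q.1 = mmap iota1 X p by apply: (@rmorph_mmap _ _ _ _ fst).
have E2q : q.2 = mmap iota2 (Psi \o X) p by apply: (@rmorph_mmap _ _ _ _ snd).
suff: place_graph q by rewrite /place_graph E1q E2q.
apply: (big_ind place_graph) => [||mu _]; [by apply: (gplace0 pl)|exact: place_graphD|].
apply: place_graphM; first by have [] := pl_k pl p@_mu.
apply: (big_ind place_graph) => [||i _]; [by apply: (gplace1 pl)|exact: place_graphM|].
elim: (mu i) => [|e IHe]; first by rewrite expr0; apply: (gplace1 pl).
by rewrite exprS; apply: place_graphM => //; split=> //; apply: OX.
Qed.

Lemma gplace_eval n r (gr : 'I_n -> {mpoly (F1 * F2)%type[r]}) (v : 'I_n -> {mpoly F1[r]})
    (c : 'I_r -> F2) (w : 'I_n -> F2) (p : {mpoly k[n]}) :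
  (forall i mu, place_graph (gr i)@_mu) ->
  (forall i, map_mpoly fst (gr i) = v i) ->
  (forall i, (map_mpoly snd (gr i)).@[c] = w i) ->
  let q := mmap (@mpolyC r F1 \o iota1) v p in
  (forall mu, O q@_mu) /\
  \sum_(mu <- msupp q) Psi q@_mu * \prod_j c j ^+ mu j = mmap iota2 w p.
Proof.
move=> grP vE wE q.
pose Q := mmap (@mpolyC r (F1 * F2)%type \o pair_const) gr p.
have graphQ mu : place_graph Q@_mu.
  apply: mcoeff_mmap_closed; [exact: place_graphD|exact: place_graphM| |].
    by move=> d; have [] := pl_k pl d.
  exact: grP.
have fstQ : map_mpoly fst Q = q.
  apply: rmorph_mmap => [d|i] /=; first by rewrite map_mpolyC.
  exact: vE.
have qE mu : q@_mu = (Q@_mu).1 by rewrite -fstQ mcoeff_map_mpoly.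
split=> [mu|]; first by rewrite qE; case: (graphQ mu).
have <- : (map_mpoly snd Q).@[c] = mmap iota2 w p.
  rewrite -[LHS]/((meval c \o map_mpoly snd) Q); apply: rmorph_mmap => [d|i] /=.
    by rewrite map_mpolyC mevalC.
  exact: wE.
have sndE mu : (map_mpoly snd Q)@_mu = Psi q@_mu.
  by rewrite mcoeff_map_mpoly /= qE; case: (graphQ mu).
apply/esym; rewrite mevalE [RHS](bigID (fun mu => mu \in msupp (map_mpoly snd Q))) /= [X in _ = _ + X]big1 ?addr0.
  rewrite -[RHS]big_filter; under [LHS]eq_bigr do rewrite sndE.
  apply: perm_big; apply: uniq_perm; rewrite ?filter_uniq // => mu.
  rewrite mem_filter; apply/esym/andb_idr; rewrite !mcoeff_msupp sndE.
  by apply: contraNneq => ->; rewrite (gplace0 pl).2.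
by move=> mu; rewrite mcoeff_msupp negbK sndE => /eqP->; rewrite mul0r.
Qed.
End PlaceTheory.

Section RegularValue.
Variables (k F : fieldType) (iota : {rmorphism k -> F}) (N : nat) (v : 'I_N -> F).
Local Notation R := {mpoly k[N]}.
Local Notation val := (mmap iota v).

Definition regular_value (w : {fraction R}) (z : F) :=
  exists P Q, [/\ val Q != 0, w = P%:F / Q%:F & z = val P / val Q].

Lemma regular_valueD w w' z z' : regular_value w z -> regular_value w' z' ->
  regular_value (w + w') (z + z').
Proof.
move=> [P [Q [nzQ -> ->]]] [P' [Q' [nzQ' -> ->]]].
have nz (q : R) : val q != 0 -> q%:F != 0 :> {fraction R}.
  by rewrite tofrac_eq0; apply: contraNneq => ->; rewrite rmorph0.
exists (P * Q' + P' * Q), (Q * Q'); split; first by rewrite rmorphM mulf_neq0.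
  by rewrite addf_div ?nz // -!tofracM -tofracD.
by rewrite addf_div // rmorphD !rmorphM.
Qed.

Lemma regular_valueM w w' z z' : regular_value w z -> regular_value w' z' ->
  regular_value (w * w') (z * z').
Proof.
move=> [P [Q [nzQ -> ->]]] [P' [Q' [nzQ' -> ->]]].
exists (P * P'), (Q * Q'); split; first by rewrite rmorphM mulf_neq0.
  by rewrite mulf_div -!tofracM.
by rewrite mulf_div !rmorphM.
Qed.

Lemma regular_value_tofrac P : regular_value P%:F (val P).
Proof. by exists P, 1; rewrite tofrac1 rmorph1 !divr1 oner_neq0. Qed.

Lemma regular_value0 : regular_value 0 0.
Proof. by have := regular_value_tofrac 0; rewrite tofrac0 rmorph0. Qed.

Lemma regular_value_div P Q z : val Q != 0 -> z * val Q = val P ->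
  regular_value (P%:F / Q%:F) z.
Proof. by move=> nzQ E; exists P, Q; rewrite -E mulfK. Qed.
End RegularValue.

Lemma mulfV_neq0 (F : fieldType) (x y : F) : x * y = 1 -> x != 0.
Proof. by apply: contra_eqN => /eqP->; rewrite mul0r eq_sym oner_eq0. Qed.

Section VersalTorsor.
Variables (k : fieldType) (gT : finGroupType).
Local Notation n := #|gT|.
Local Notation S := {mpoly k[n]}.
Local Notation K := (ratfun k gT).
Local Notation G := [set: gT]%G.
Hypothesis inf_k : infinite_type k.
Variable al : gT -> {rmorphism K -> K}.
Hypothesis alE : forall g p, al g p%:F = (perm_mpoly g p)%:F.
Variables (Phi : fieldType) (iota : {rmorphism k -> Phi}) (Om : Phi -> Prop).
Variable b : gT -> {rmorphism Phi -> Phi}.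
Hypothesis gfO : gfield G iota Om b.
Variables (m : nat) (X : 'I_m -> Phi).
Hypothesis rbX : rational_basis iota (gf_invariant G Om b) X.
Variable y : 'I_n -> gT -> Phi.
Hypothesis y_Om : forall j x, Om (y j x).
Hypothesis y_act : forall j g x, b g (y j x) = y j (g * x)%g.
Let M := \matrix_(j < n, i < n) y j (enum_val i).
Hypothesis uM : M \in unitmx.
Local Notation R := {mpoly k[m + n]}.
Local Notation T := {mpoly Phi[n]}.

Definition versal_point (i : 'I_n) : T := \sum_j y j (enum_val i) *: 'X_j.

Definition to_versal : {rmorphism S -> T} := mmap (@mpolyC n Phi \o iota) versal_point.

Definition from_base : {rmorphism R -> T} :=
  mmap (@mpolyC n Phi \o iota) (ord_cat (fun i => (X i)%:MP) (fun j => 'X_j)).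

Lemma to_versal_inj : injective to_versal.
Proof.
have E p : to_versal p = map_mpoly iota p \mPo linear_subst M^T.
  apply/esym; apply: rmorph_mmap => [c|i] /=; first exact: comp_mpolyC.
  rewrite comp_mpolyXU -tnth_nth tnth_mktuple.
  by apply: eq_bigr => j _; rewrite !mxE.
move=> p q; rewrite !E => /linear_subst_inj; rewrite unitmx_tr => /(_ uM) Epq.
apply/mpolyP => mu; apply: (fmorph_inj iota).
by rewrite -!mcoeff_map_mpoly Epq.
Qed.

Lemma from_base_inj : injective from_base.
Proof.
move=> p q /eqP; rewrite -subr_eq0 -rmorphB => /eqP/(indep_adjoin_variables inf_k (rb_indep rbX))/eqP.
by rewrite subr_eq0 => /eqP.
Qed.

Lemma to_versal_act g p : map_mpoly (b g) (to_versal p) = to_versal (perm_mpoly g p).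
Proof.
transitivity (mmap (@mpolyC n Phi \o iota)
    (fun i => versal_point (enum_rank (g * enum_val i)%g)) p); last first.
  apply/esym; apply: rmorph_mmap => [c|i] /=; first by rewrite /to_versal /= mmapC.
  by rewrite /to_versal /= mmapX mmap1U.
apply: rmorph_mmap => [c|i] /=; first by rewrite map_mpolyC /= (gf_const gfO) ?inE.
rewrite rmorph_sum; apply: eq_bigr => j _ /=.
by rewrite map_mpolyZ map_mpolyX /= y_act enum_rankK.
Qed.

Lemma to_versal_invariant p : (forall g, perm_mpoly g p = p) ->
  forall mu, gf_invariant G Om b (to_versal p)@_mu.
Proof.
have sOm := gf_sub gfO.
move=> fix_p mu; split=> [|g _].
  apply: mcoeff_mmap_closed; [exact: (subfieldD sOm)|exact: (subfieldM sOm)|exact: (gf_k gfO)|].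
  move=> i l; rewrite raddf_sum /=; apply: (subfield_sum sOm) => j _.
  rewrite mcoeffZ mcoeffX; apply: (subfieldM sOm) => //.
  by case: eqP => _; [apply: subfield1|apply: subfield0].
by rewrite -mcoeff_map_mpoly to_versal_act fix_p.
Qed.

Definition base_fraction (d : Phi) : {mpoly k[m]} * {mpoly k[m]} :=
  epsilon (inhabits (0, 0)) (fun PQ => mmap iota X PQ.2 != 0 /\
    d = mmap iota X PQ.1 / mmap iota X PQ.2).

Lemma base_fractionP d : gf_invariant G Om b d ->
  mmap iota X (base_fraction d).2 != 0 /\
  d = mmap iota X (base_fraction d).1 / mmap iota X (base_fraction d).2.
Proof.
move=> /(rb_gen rbX)[P [Q PQ]]; rewrite /base_fraction; set R_ := fun _ => _.
by apply: (epsilon_spec _ R_); exists (P, Q).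
Qed.

Definition base_mpoly (P : {mpoly k[m]}) : R :=
  mmap (@mpolyC (m + n) k) (fun i => 'X_(lshift n i)) P.

Lemma from_base_mpoly P : from_base (base_mpoly P) = (mmap iota X P)%:MP.
Proof.
transitivity (mmap (@mpolyC n Phi \o iota) (fun i => (X i)%:MP) P); last first.
  by apply/esym; apply: (@rmorph_mmap _ _ _ _ (@mpolyC n Phi)).
apply: (@rmorph_mmap _ _ _ _ from_base) => [c|i]; rewrite /from_base /= ?mmapC //.
by rewrite mmapX mmap1U ord_catl.
Qed.

Definition fiber_monomial (mu : 'X_{1..n}) : R := \prod_j 'X_(rshift m j) ^+ mu j.

Lemma from_base_monomial mu : from_base (fiber_monomial mu) = 'X_[mu].
Proof.
rewrite rmorph_prod mpolyXE_id; apply: eq_bigr => j _.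
by rewrite rmorphXn /from_base /= mmapX mmap1U ord_catr.
Qed.

Variable th : {rmorphism {fraction R} -> {fraction T}}.
Hypothesis thE : forall P, th P%:F = (from_base P)%:F.
Variable nu : {rmorphism K -> {fraction T}}.
Hypothesis nuE : forall p, nu p%:F = (to_versal p)%:F.

Definition base_lift (P : T) : {fraction R} := \sum_(mu <- msupp P)
  (base_mpoly (base_fraction P@_mu).1)%:F / (base_mpoly (base_fraction P@_mu).2)%:F *
  (fiber_monomial mu)%:F.

Lemma th_base_lift P : (forall mu, gf_invariant G Om b P@_mu) -> th (base_lift P) = P%:F.
Proof.
move=> invP; rewrite [in RHS](mpolyE P) !rmorph_sum; apply: eq_bigr => mu _ /=.
rewrite rmorphM fmorph_div /= !thE !from_base_mpoly from_base_monomial -mul_mpolyC tofracM.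
congr (_ * _); have [nzQ {3}->] := base_fractionP (invP mu).
exact/esym/(fmorph_div (@FracField.tofrac T \o @mpolyC n Phi : {rmorphism Phi -> {fraction T}})).
Qed.

Lemma exists_versal_lift z : (forall g, al g z = z) -> exists w, th w = nu z.
Proof.
move=> /(noether_field_fraction alE)[a [c [Aa Ac nzc ->]]].
suff lift_adj : forall x, adjoin (ratfunC k gT) (map (@FracField.tofrac S) (noether_generators k gT)) x ->
    exists w, th w = nu x.
  have [[wa Ea] [wc Ec]] := (lift_adj a Aa, lift_adj c Ac).
  by exists (wa / wc); rewrite !fmorph_div /= Ea Ec.
apply: (adjoin_min (A := fun x => exists w, th w = nu x)) => [|_ /mapP[p pG ->]].
  split=> [d|u v [wu Eu] [wv Ev]|u v [wu Eu] [wv Ev]].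
  - by exists (d%:MP)%:F; rewrite thE /ratfunC /= nuE /from_base /to_versal /= !mmapC.
  - by exists (wu + wv); rewrite !rmorphD /= Eu Ev.
  by exists (wu * wv); rewrite !rmorphM /= Eu Ev.
exists (base_lift (to_versal p)); rewrite th_base_lift ?nuE //.
by apply: to_versal_invariant => g; apply: noether_generators_fixed.
Qed.

Section Place.
Variables (O : Phi -> Prop) (Psi : Phi -> K).
Hypothesis pl : gplace G iota Om b (ratfunC k gT) (fun=> True) al O Psi.
Hypothesis OX : forall i, O (X i).
Hypothesis Oy : forall j x, O (y j x).
Hypothesis OV : forall i j, O (invmx M i j).
Local Notation x_ i := (('X_i : S)%:F : K).

Definition fiber_coord j : K := \sum_i x_ i * Psi (invmx M i j).

Let Mh := map_mx Psi M.
Let Vh := map_mx Psi (invmx M).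
Let xr : 'rV[K]_n := \row_i x_ i.

Lemma OM i j : O (M i j). Proof. by rewrite mxE. Qed.

Lemma place_invmx : Vh *m Mh = 1%:M.
Proof.
apply/matrixP => i l; rewrite !mxE.
transitivity (Psi (\sum_j invmx M i j * M j l)).
  have [_ ->] := gplace_sum pl (index_enum 'I_n) (fun j => (pl_M pl (OV i j) (OM j l)).1).
  by apply: eq_bigr => j _; rewrite !mxE; have [_ ->] := pl_M pl (OV i j) (Oy j (enum_val l)).
have -> : \sum_j invmx M i j * M j l = (invmx M *m M) i l by rewrite [RHS]mxE.
rewrite mulVmx // mxE; case: (i == l); first by case: (gplace1 pl).
by case: (gplace0 pl).
Qed.

Lemma fiber_coordE (i : 'I_n) : \sum_j Psi (y j (enum_val i)) * fiber_coord j = x_ i.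
Proof.
have -> : x_ i = (xr *m (Vh *m Mh)) 0 i by rewrite place_invmx mulmx1 mxE.
rewrite mulmxA mxE; apply: eq_bigr => j _; rewrite mulrC !mxE; congr (_ * _).
by apply: eq_bigr => l _; rewrite !mxE.
Qed.

Lemma al_fiber_coord g j : al g (fiber_coord j) = fiber_coord j.
Proof.
pose c1 : 'rV[K]_n := \row_j al g (fiber_coord j).
suff: c1 = xr *m Vh.
  move/rowP/(_ j); rewrite !mxE => ->.
  by apply: eq_bigr => i _; rewrite !mxE.
have xE : c1 *m Mh = xr.
  apply/rowP => i; rewrite !mxE.
  have -> : x_ i = al g (x_ (enum_rank (g^-1 * enum_val i)%g)).
    by rewrite alE perm_mpolyX mulKVg enum_valK.
  rewrite -fiber_coordE rmorph_sum; apply: eq_bigr => l _ /=.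
  rewrite !mxE rmorphM mulrC enum_rankK; congr (_ * _).
  have [_ <-] := pl_act pl (in_setT g) (Oy l (g^-1 * enum_val i)%g).
  by rewrite y_act mulKVg.
by rewrite -xE -mulmxA (mulmx1C place_invmx) mulmx1.
Qed.

Lemma al_place_base g i : al g (Psi (X i)) = Psi (X i).
Proof.
have [_ <-] := pl_act pl (in_setT g) (OX i).
by have [_ ->] := rb_in rbX i.
Qed.

Definition base_point : 'I_(m + n) -> K := ord_cat (fun i => Psi (X i)) fiber_coord.
Local Notation val := (mmap (ratfunC k gT) base_point).

Lemma val_base_mpoly P : val (base_mpoly P) = Psi (mmap iota X P).
Proof.
have [_ ->] := gplace_mmap pl P OX.
apply: (@rmorph_mmap _ _ _ _ (mmap (ratfunC k gT) base_point)) => [c|i]; rewrite /= ?mmapC //.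
by rewrite mmapX mmap1U /base_point ord_catl.
Qed.

Lemma val_fiber_monomial mu : val (fiber_monomial mu) = \prod_j fiber_coord j ^+ mu j.
Proof.
rewrite rmorph_prod; apply: eq_bigr => j _.
by rewrite rmorphXn /= mmapX mmap1U /base_point ord_catr.
Qed.

Local Notation regular := (regular_value (ratfunC k gT) base_point).

Lemma regular_value_versal p : (forall g, perm_mpoly g p = p) ->
  (forall mu, mu \in msupp (to_versal p) ->
     O (mmap iota X (base_fraction (to_versal p)@_mu).2)^-1) ->
  regular (base_lift (to_versal p)) p%:F.
Proof.
move=> fix_p OQ; pose gr (i : 'I_n) : {mpoly (Phi * K)%type[n]} :=
  \sum_j (y j (enum_val i), Psi (y j (enum_val i))) *: 'X_j.
have [] := @gplace_eval _ _ _ _ _ _ _ _ _ _ _ _ _ pl n n gr versal_point fiber_coord (fun i => x_ i) p.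
- move=> i mu; rewrite raddf_sum /=; apply: (big_ind (place_graph O Psi)).
  + exact: (gplace0 pl).
  + exact: (place_graphD pl).
  move=> j _; rewrite mcoeffZ mcoeffX; apply: (place_graphM pl); first by split; rewrite //=.
  by case: (_ == _); [exact: (gplace1 pl)|exact: (gplace0 pl)].
- move=> i; rewrite (raddf_sum (map_mpoly fst)); apply: eq_bigr => j _ /=.
  by rewrite map_mpolyZ map_mpolyX.
- move=> i; rewrite -fiber_coordE (raddf_sum (map_mpoly snd)) raddf_sum; apply: eq_bigr => j _ /=.
  by rewrite map_mpolyZ map_mpolyX mevalZ mevalXU.
rewrite -/(to_versal p) => Oq; have -> : mmap (ratfunC k gT) (fun i => x_ i) p = p%:F.
  rewrite -[in RHS](comp_mpoly_id p); apply/esym.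
  apply: (@rmorph_mmap _ _ _ _ (@FracField.tofrac S)) => // i.
  by rewrite tnth_mktuple.
move=> <-; rewrite /base_lift big_seq [X in regular_value _ _ _ X]big_seq.
apply: (big_ind2 regular) => [||mu mup].
- exact: regular_value0.
- by move=> w w' z z'; apply: regular_valueD.
apply: regular_valueM; last by rewrite -val_fiber_monomial; apply: regular_value_tofrac.
have [nzQ Ed] := base_fractionP (to_versal_invariant fix_p mu).
set P := (base_fraction _).1 in Ed *; set Q := (base_fraction _).2 in Ed nzQ *.
have [OP _] := gplace_mmap pl P OX; have [OQ1 _] := gplace_mmap pl Q OX.
have nzQh : Psi (mmap iota X Q) != 0.
  have [_] := pl_M pl OQ1 (OQ mu mup); rewrite divff // (gplace1 pl).2 => E1.
  exact: (mulfV_neq0 (esym E1)).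
apply: regular_value_div; rewrite !val_base_mpoly //.
by have [_ <-] := pl_M pl (Oq mu) OQ1; rewrite {1}Ed divfK.
Qed.
End Place.
End VersalTorsor.

Lemma retract_rational_of_dense (k : fieldType) (gT : finGroupType) :
  infinite_type k -> rational_dense k [set: gT]%G ->
  retract_rational (@ratfun_const k gT) (@noether_field k gT).
Proof.
move=> inf_k [Phi [iota [Om [b [gfO [m [X rbX]] dense]]]]].
have [al [alE actE]] := act_ratfun_rmorphism k gT.
have sOm := gf_sub gfO.
have [y [y_Om y_actG uM]] := equivariant_basis gfO (@mul1g gT) (fun g h x => esym (mulgA g h x)).
have y_act j g x : b g (y j x) = y j (g * x)%g by apply: y_actG; rewrite inE.
set M := \matrix_(_, _) _ in uM.
pose gens := noether_generators k gT.
pose dn p mu := (mmap iota X (base_fraction iota X (to_versal iota y p)@_mu).2)^-1.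
pose den p := [seq dn p mu | mu <- msupp (to_versal iota y p)].
pose s := [seq X i | i <- enum 'I_m] ++ [seq y j x | j <- enum 'I_#|gT|, x <- enum gT] ++
  [seq invmx M i j | i <- enum 'I_#|gT|, j <- enum 'I_#|gT|] ++ flatten (map den gens).
have X_Om i : Om (X i) by have [] := rb_in rbX i.
have sO x : x \in s -> Om x.
  rewrite !mem_cat => /or4P[/mapP[i _ ->]//|/allpairsP[[j z] [_ _ ->]]//|/allpairsP[[i j] [_ _ ->]]|].
    by apply: (subfield_invmx sOm) => i1 j1; rewrite mxE.
  move=> /flattenP[_ /mapP[p _ ->] /mapP[mu _ ->]]; apply: (subfieldV sOm).
  exact: (subfield_mmap _ sOm (gf_k gfO)).
have [O [Psi [pl Os]]] := dense _ _ _ _ (gfield_ratfun alE) s sO.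
have OX i : O (X i) by apply: Os; rewrite mem_cat map_f // mem_enum.
have Oy j x : O (y j x).
  by apply: Os; rewrite !mem_cat (allpairs_f y) ?mem_enum ?orbT.
have OV i j : O (invmx M i j).
  by apply: Os; rewrite !mem_cat (allpairs_f (fun i j => invmx M i j)) ?mem_enum ?orbT.
have OQ p mu : p \in gens -> mu \in msupp (to_versal iota y p) ->
    O (dn p mu).
  move=> pg mup; apply: Os; rewrite !mem_cat; apply/or4P/Or44/flattenP.
  exists (den p); first exact: map_f.
  exact: (map_f (dn p)).
pose T := {mpoly Phi[#|gT|]}.
have inj_th : injective
    (@FracField.tofrac T \o from_base gT iota X : {rmorphism {mpoly k[m + #|gT|]} -> _}).
  by move=> P Q /eqP; rewrite tofrac_eq => /eqP/(from_base_inj inf_k rbX).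
have inj_nu : injective
    (@FracField.tofrac T \o to_versal iota y : {rmorphism {mpoly k[#|gT|]} -> _}).
  by move=> P Q /eqP; rewrite tofrac_eq => /eqP/(to_versal_inj uM).
have [th thE] := fraction_extension inj_th.
have [nu nuE] := fraction_extension inj_nu.
have exphi := exists_versal_lift alE gfO rbX y_Om y_act thE nuE.
pose phi z := epsilon (inhabits 0) (fun w => th w = nu z).
have phiE z : noether_field z -> th (phi z) = nu z.
  move=> Lz; apply: (epsilon_spec (inhabits 0) (fun w => th w = nu z)).
  by apply: exphi => g; rewrite -actE.
have phi_eq z w : noether_field z -> th w = nu z -> phi z = w.
  by move=> Lz Ew; apply: (fmorph_inj th); rewrite phiE.
have LD : is_subfield (@noether_field k gT).
  split=> [g|u v Lu Lv g|u v Lu Lv g|u Lu g]; rewrite actE.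
  - exact: rmorph1.
  - by rewrite rmorphB -!actE Lu Lv.
  - by rewrite rmorphM -!actE Lu Lv.
  by rewrite fmorphV -!actE Lu.
have Lk c : noether_field (ratfunC k gT c).
  by move=> g; rewrite actE (gf_const (gfield_ratfun alE)) ?inE.
have Lgens p : p \in gens -> noether_field p%:F.
  by move=> pg g; rewrite actE alE noether_generators_fixed.
apply: (@retract_rational_criterion k (ratfun k gT) (ratfunC k gT) (@noether_field k gT) LD Lk
  (m + #|gT|) (base_point X y Psi) _ phi _ _ _ (map (@FracField.tofrac _) gens)).
- move=> i g; rewrite actE; have [j ->|j ->] := split_ordP i; rewrite /base_point ?ord_catl ?ord_catr.
    exact: (al_place_base rbX pl OX).
  exact: (al_fiber_coord alE y_act uM pl Oy OV).
- move=> u v Lu Lv; apply: phi_eq; first exact: (subfieldD LD).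
  by rewrite !rmorphD /= !phiE.
- move=> u v Lu Lv; apply: phi_eq; first exact: (subfieldM LD).
  by rewrite !rmorphM /= !phiE.
- move=> c; apply: phi_eq => //.
  by rewrite thE /ratfunC /= nuE /from_base /to_versal /= !mmapC.
- by move=> _ /mapP[p pg ->]; apply: Lgens.
- move=> z Lz; apply: (noether_field_fraction alE) => g; by rewrite -actE.
move=> _ /mapP[p pg ->]; have fix_p g : perm_mpoly g p = p by apply: noether_generators_fixed.
have -> : phi p%:F = base_lift iota X (to_versal iota y p).
  apply: phi_eq; first exact: Lgens.
  by rewrite nuE (th_base_lift rbX thE) // => mu; apply: (to_versal_invariant gfO y_Om y_act fix_p).
exact: (regular_value_versal gfO rbX y_Om y_act uM pl OX Oy OV fix_p (fun mu => @OQ p mu pg)).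
Qed.

Section ZGroups.
Local Open Scope group_scope.
Variable gT : finGroupType.
Implicit Types G S K Q : {group gT}.

Lemma abelian_Sylow_fusion p G S a g : p.-Sylow(G) S -> abelian S ->
  a \in S -> g \in G -> a ^ g \in S -> exists2 n, n \in 'N_G(S) & a ^ n = a ^ g.
Proof.
move=> sylS abS aS gG agS; have sSG := pHall_sub sylS.
have sSC : S \subset 'C_G[a ^ g] by rewrite subsetI sSG sub_cent1 (subsetP abS).
have sSgC : S :^ g \subset 'C_G[a ^ g].
  by rewrite subsetI conj_subG // sub_cent1 centJ memJ_conjg (subsetP abS).
have sylC := pHall_subl sSC (subsetIl _ _) sylS.
have sylCg : p.-Sylow('C_G[a ^ g]) (S :^ g)%G.
  by apply: (pHall_subl sSgC (subsetIl _ _)); rewrite pHallJ.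
have [c /setIP[cG /cent1P cC] E] := Sylow_trans sylCg sylC.
exists (g * c); first by rewrite inE groupM //=; apply/normP; rewrite conjsgM -E.
by rewrite conjgM; apply/conjg_fixP/commgP/commute_sym.
Qed.

(* Burnside's transfer argument: the transfer to S restricts on S to the power
   map with exponent the index, which is injective. *)
Lemma Burnside_normal_complement p G S : p.-Sylow(G) S -> abelian S ->
  'N_G(S) \subset 'C(S) -> exists2 K : {group gT}, K <| G & p^'.-Hall(G) K.
Proof.
move=> sylS abS cNS; have [sSG pS p'GS] := and3P sylS.
have abI : abelian (idm S @* S) by rewrite morphim_idm.
pose V := [morphism of transfer G abI]; pose K := ('ker V)%G.
have nsKG : K <| G := ker_normal V.
have tiKS : K :&: S = 1.
  apply/trivgP/subsetP => s /setIP[Ks sS]; have sG := dom_ker Ks.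
  have trX := transversalP (rcosets_cycle_partition sSG sG).
  have sI : s \in idm S @* S by rewrite morphim_idm.
  have := transfer_cycle_expansion sSG abI sG trX.
  rewrite [LHS](mker Ks) (eq_bigr (fun x => FiniteModule.fmod abI s *+ #|<[s]> : S :* x|)%R).
    rewrite GRing.sumrMnr (sum_index_rcosets_cycle sSG sG trX) => /esym V0.
    have := congr1 FiniteModule.fmval V0; rewrite FiniteModule.fmvalZ FiniteModule.fmodK //.
    rewrite [RHS]FiniteModule.fmval0 => /eqP; rewrite -order_dvdn => s_GS.
    apply/set1gP/eqP; rewrite -order_eq1 -dvdn1.
    rewrite -(eqnP (pnat_coprime pS p'GS)) dvdn_gcd s_GS order_dvdG //.
  move=> x xX; set m := #|_ : _|.
  have smS : s ^+ m \in S by apply: groupX.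
  have smxS : s ^+ m ^ x^-1 \in S.
    by have := mulg_exp_card_rcosets S s x; rewrite mem_rcoset -mulgA conjgE invgK.
  have xG : x^-1 \in G by rewrite groupV (subsetP (transversal_sub trX)).
  have [g /setIP[gG gN] <-] := abelian_Sylow_fusion sylS abS smS xG smxS.
  have cgs : g * s ^+ m = s ^+ m * g.
    by apply: (centP (subsetP cNS g _)) => //; rewrite inE gG.
  rewrite conjgE -cgs mulKg.
  by rewrite /restrm /= FiniteModule.fmodX.
have leGK : (#|G : K| <= #|S|)%N.
  rewrite -[in #|G : K|](setIid G) -card_morphim; apply: leq_trans (max_card _) _.
  rewrite card_sub; apply/subset_leq_card/subsetP => x.
  by rewrite inE /= morphim_idm.
have p'K : p^'.-group K.
  have E1 := card_Hall (Sylow_setI_normal nsKG sylS).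
  have : (1 = #|K|`_p)%N.
    by transitivity #|K :&: S|; [rewrite tiKS cards1 | exact: E1].
  by move/esym/eqP; rewrite partn_eq1.
exists K => //; rewrite /pHall p'K normal_sub //= pnatNK.
have -> // : #|G : K| = #|S|.
apply/eqP; rewrite eqn_leq leGK -(leq_pmul2l (cardG_gt0 K)) Lagrange ?normal_sub //.
rewrite -(TI_cardMg tiKS); apply/subset_leq_card; rewrite mul_subG //.
exact: normal_sub.
Qed.

Lemma cyclic_Sylow_central G S : (pdiv #|G|).-Sylow(G) S -> cyclic S ->
  G :!=: 1 -> 'N_G(S) \subset 'C(S).
Proof.
set p := pdiv _ => sylS cS ntG; have [sSG pS p'GS] := and3P sylS.
have p_pr : prime p by rewrite pdiv_prime // cardG_gt1.
have cSS : S \subset 'C(S) := cyclic_abelian cS.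
rewrite -ker_conj_aut ker_trivg_morphim subsetIr subG1 trivg_card1 /=.
set A := _ @* _; apply: contraT => ntA.
have r_pr : prime (pdiv #|A|) by rewrite pdiv_prime // ltn_neqAle eq_sym ntA cardG_gt0.
set r := pdiv _ in r_pr; have rA : (r %| #|A|)%N := pdiv_dvd _.
have pr : (p <= r)%N.
  apply: pdiv_min_dvd; first exact: prime_gt1.
  by apply: dvdn_trans rA (dvdn_trans (dvdn_morphim _ _) (cardSg (subsetIl _ _))).
have p'A : ~~ (p %| #|A|)%N.
  apply: contraL p'GS => pA; rewrite p'natE //; apply/negPn/(dvdn_trans pA).
  rewrite card_morphim (setIidPr (subsetIr _ _)) ker_conj_aut.
  have sSN : S \subset 'N_G(S) by rewrite subsetI sSG normG.
  apply: dvdn_trans (indexgS _ cSS) _.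
  by rewrite -(Lagrange_index (subsetIl _ _) sSN) dvdn_mull.
have [a cardS] := p_natP pS.
have : (r %| totient #|S|)%N.
  by rewrite -card_Aut_cyclic //; apply: dvdn_trans rA (cardSg (Aut_conj_aut _ _)).
case: a cardS => [|a] cardS; first by rewrite cardS expn0 dvdn1 => /eqP r1; rewrite r1 in r_pr.
rewrite cardS totient_pfactor // Euclid_dvdM // => /orP[/dvdn_leq|].
  have p_gt1 := prime_gt1 p_pr; move=> /(_ _); lia.
rewrite Euclid_dvdX // dvdn_prime2 // => /andP[/eqP rp _].
by rewrite -rp rA in p'A.
Qed.

Lemma Zgroup_normal_Sylow G : Zgroup G -> G :!=: 1 ->
  exists q Q, [/\ Q :!=: 1, Q <| G & q.-Sylow(G) Q].
Proof.
have [n] := ubnP #|G|; elim: n G => // n IHn G leGn ZG ntG.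
pose p := pdiv #|G|; have [S sylS] := Sylow_exists p G.
have cS : cyclic S := forall_inP ZG S (p_Sylow sylS).
have p_pr : prime p by rewrite pdiv_prime // cardG_gt1.
have ntS : S :!=: 1.
  by rewrite -cardG_gt1 (card_Hall sylS) p_part_gt1 pi_pdiv cardG_gt1.
have [K nsKG hallK] := Burnside_normal_complement sylS (cyclic_abelian cS)
  (cyclic_Sylow_central sylS cS ntG).
have sKG := normal_sub nsKG.
have [K1 | ntK] := eqsVneq K 1.
  exists p, S; split=> //; have -> : S = G; last exact: normal_refl.
  apply/val_inj/eqP; rewrite /= eqEcard (pHall_sub sylS) (card_Hall sylS).
  have cK : (#|G|`_p^')%N = 1%N by rewrite -(card_Hall hallK) K1 cards1.
  by rewrite -[X in (X <= _)%N](partnC p (cardG_gt0 G)) cK muln1 leqnn.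
have ltKG : (#|K| < #|G|)%N.
  rewrite proper_card // properEneq sKG andbT; apply: contraNneq ntS => KG.
  have := pHall_pgroup hallK; rewrite KG => p'G.
  by rewrite trivg_card1 (card_Hall sylS) part_p'nat.
have [|q [Q [ntQ nsQK sylQ]]] := IHn K (leq_trans ltKG _) (ZgroupS sKG ZG) ntK; first by [].
exists q, Q; split=> //.
  rewrite -(normal_Hall_pcore sylQ nsQK); exact: char_normal_trans (pcore_char _ _) nsKG.
apply: (subHall_Sylow hallK _ sylQ); rewrite !inE; apply: contraNneq ntQ => qp.
have p'K := pHall_pgroup hallK.
have p'Q : p^'.-group Q := pgroupS (normal_sub nsQK) p'K.
by rewrite trivg_card1 -(part_pnat_id (pHall_pgroup sylQ)) qp part_p'nat.
Qed.
End ZGroups.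

Lemma rational_dense_Zgroup (k : fieldType) (gT : finGroupType) (G : {group gT}) e (zeta : k) :
  infinite_type k -> e.-primitive_root zeta -> Zgroup G -> (exponent G %| e)%N ->
  rational_dense k G.
Proof.
move=> inf_k prim_zeta; have [n] := ubnP #|G|; elim: n G => // n IHn G leGn ZG expG.
have [G1 | ntG] := eqsVneq G 1%g.
  by rewrite (_ : G = 1%G); [apply: rational_dense1 | apply: val_inj].
have [q [Q [ntQ nsQG sylQ]]] := Zgroup_normal_Sylow ZG ntG.
have /splitsP[H] := SchurZassenhaus_split (pHall_Hall sylQ) nsQG.
rewrite complgC => /(sdprod_normal_complP nsQG) sdG.
have [_ sHG _ _ _] := sdprod_context sdG; have sQG := normal_sub nsQG.
have cQ : abelian Q := cyclic_abelian (forall_inP ZG Q (p_Sylow sylQ)).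
have ltHG : (#|H| < #|G|)%N.
  by rewrite -(sdprod_card sdG) -[X in (X < _)%N]mul1n ltn_pmul2r ?cardG_gt0 ?cardG_gt1.
have ZH := ZgroupS sHG ZG.
apply: (rational_dense_sdprod sdG cQ ZH _ prim_zeta inf_k).
  exact: dvdn_trans (exponentS sQG) expG.
apply: IHn => //; first exact: leq_trans ltHG _.
exact: dvdn_trans (exponentS sHG) expG.
Qed.

Theorem theorem4p3 (gT : finGroupType) (N G0 : {group gT})
  (k : fieldType) (zeta : k) :
  (N ><| G0)%g = [set: gT] ->
  abelian N ->
  Zgroup G0 ->
  (forall s : seq k, exists x : k, x \notin s) ->
  (lcmn (exponent N) (exponent G0)).-primitive_root zeta ->
  retract_rational (@ratfun_const k gT) (@noether_field k gT).
Proof.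
move=> sdG cNN ZG0 inf_k prim_zeta; apply: (retract_rational_of_dense inf_k).
apply: (rational_dense_sdprod sdG cNN ZG0 (dvdn_lcml _ _) prim_zeta inf_k).
exact: (rational_dense_Zgroup inf_k prim_zeta ZG0 (dvdn_lcmr _ _)).
Qed.
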